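(* Let $p$ be a prime, $\tau>0$ and $\delta\ge0$ with $\tau>4\delta(1+(m+1)\tau)$. Let $\beta=a/b$ with integers $a\neq0$, $b\ge1$ satisfying $\gcd(a,b)=1$, \[ |a|_p<2^{-\delta(2,p)}|s|_p,\qquad |a|_p\le|a|^{-1+\delta},\qquad |a|>b^{2(1+1/\tau)}e^{2(c_2(1+1/\tau)+(c_8+2)(m+1+1/\tau))}. \] Then \[ |\ell_0+\ell_1\varphi_1(\beta)+\cdots+\ell_m\varphi_m(\beta)|_p>\tilde H^{-1-(m+1)\tau} \] for all $(\ell_0,\dots,\ell_m)\in\mathbb{Z}^{m+1}\setminus\{0\}$ with $\tilde H\ge\tilde H_0$, where \[ \log\tilde H_0=\max\left\{\frac{(\tilde N_1+m+1)\log|a|}{1+(m+1)\tau},\ \frac{8\log|a|}{\tau}\right\},\qquad \tilde N_1=\max\{(m+1)c(\theta),\ c_1+c_5,\ \log(2\tilde d)+4\delta(p)\log|a|\}. \]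
   Context: Let $m\ge1$ and let $\alpha_0,\alpha_1,\dots,\alpha_m$ be positive rational numbers with $\alpha_i-\alpha_j\notin\mathbb{Z}$ for $1\le i<j\le m$. Pochhammer symbol: $(x)_0=1$, $(x)_n=x(x+1)\cdots(x+n-1)$. $\varphi_j(z)=\sum_{n\ge0}\frac{(\alpha_j)_n}{(\alpha_j+\alpha_0)_n}z^n$; under the hypotheses these series converge in $\mathbb{Q}_p$ at $z=\beta$ and $\varphi_j(\beta)$ denotes the $p$-adic sum. Write $\alpha_j=r_j/s_j$ ($j=0,\dots,m$) and $\alpha_j+\alpha_0=u_j/v_j$ ($j=1,\dots,m$) with positive integers, $\gcd(r_j,s_j)=\gcd(u_j,v_j)=1$; $R=\max_{1\le j\le m} r_j$, $S=\max s_j$, $U=\max u_j$, $V=\max v_j$; $d_j$ is the positive integer with $s_0s_j=d_jv_j$; $s,v,d$ are the least common multiples of $s_j$, $v_j$, $d_j$ ($j=1,\dots,m$); $\tilde d=d/\gcd(d,s_0)$; $\epsilon(n)=\prod_{p\mid n}p^{1/(p-1)}$. $|\cdot|_p$ is the $p$-adic absolute value with $|p|_p=p^{-1}$; $\delta(2,p)=1$ if $p=2$ and $s$ is even, $0$ otherwise; $\delta(p)=1$ if $p\mid s$, $0$ otherwise. Fix $\theta>1$ and a real $c(\theta)\ge2$ such that $\pi(x)\le\theta x/\log x$ for all $x\ge c(\theta)$. Constants: $c_1=\theta(m(R+S)+U)$, $c_2=m\theta S$, $c_3=\log(s_0^2\epsilon(s_0)\epsilon(v))$, $c_4=\theta V+\log(d\epsilon(s)/\gcd(d,s_0))$,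 $c_5=\theta(2(r_0-s_0)+mU)$, $c_6=2\theta s_0+\log(d\epsilon(s)/s_0)$, $c_7=m\theta V$, $c_8=c_3+c_4+c_6+c_7+3$. For $(\ell_0,\dots,\ell_m)\in\mathbb{Z}^{m+1}$: $h_0=\max\{|\ell_0|,\dots,|\ell_m|\}$, $h_j=\max\{1,|\ell_j|\}$ ($j=1,\dots,m$), $\tilde H=\prod_{j=0}^mh_j$. *)

(* Defs.v *)
From Stdlib Require Import Reals QArith Qreals ZArith List Lia Znumtheory.
Import ListNotations.
Open Scope R_scope.

Definition isprimeb (k : nat) : bool :=
  Nat.ltb 1 k && forallb (fun d => negb (Nat.eqb (k mod d) 0)) (seq 2 (k - 2)).

Definition prime_pi (x : R) : nat :=
  length (filter isprimeb (seq 0 (S (Z.to_nat (Int_part x))))).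

(* p-adic valuation of a nonzero integer z (fuel |z| suffices) *)
Fixpoint pval_aux (fuel : nat) (p z : Z) : nat :=
  match fuel with
  | O => O
  | S f => if Z.eqb (Z.modulo z p) 0 then S (pval_aux f p (Z.div z p)) else O
  end.
Definition pval (p z : Z) : nat := pval_aux (Z.to_nat (Z.abs z)) p z.

Definition padicZ (p z : Z) : R :=
  if Z.eqb z 0 then 0 else / (IZR p ^ pval p z).
Definition padicQ (p : Z) (q : Q) : R :=
  if Z.eqb (Qnum q) 0 then 0
  else IZR p ^ pval p (Zpos (Qden q)) / IZR p ^ pval p (Qnum q).

Definition epsilon (n : Z) : R :=
  fold_right Rmult 1
    (map (fun q => Rpower (INR q) (1 / (INR q - 1)))
       (filter (fun q => isprimeb q && Nat.eqb (Z.to_nat n mod q) 0)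
          (seq 0 (S (Z.to_nat n))))).

Fixpoint poch (x : Q) (n : nat) : Q :=
  match n with
  | O => 1%Q
  | S k => (poch x k * (x + inject_Z (Z.of_nat k)))%Q
  end.

Definition coef (alpha : nat -> Q) (j n : nat) : Q :=
  (poch (alpha j) n / poch (alpha j + alpha 0%nat) n)%Q.

Definition phi_partial (alpha : nat -> Q) (j : nat) (beta : Q) (N : nat) : Q :=
  fold_right Qplus 0%Q
    (map (fun n => (coef alpha j n * Qpower beta (Z.of_nat n))%Q) (seq 0 N)).

Definition Lpart (m : nat) (alpha : nat -> Q) (ell : nat -> Z) (beta : Q) (N : nat) : Q :=
  (inject_Z (ell 0%nat) +
   fold_right Qplus 0%Q
     (map (fun j => inject_Z (ell j) * phi_partial alpha j beta N) (seq 1 m)))%Q.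

Definition rZ (alpha : nat -> Q) (j : nat) : Z := Qnum (Qred (alpha j)).
Definition sZ (alpha : nat -> Q) (j : nat) : Z := Zpos (Qden (Qred (alpha j))).
Definition uZ (alpha : nat -> Q) (j : nat) : Z := Qnum (Qred (alpha j + alpha 0%nat)).
Definition vZ (alpha : nat -> Q) (j : nat) : Z := Zpos (Qden (Qred (alpha j + alpha 0%nat))).
(* s_0 s_j = d_j v_j *)
Definition dZ (alpha : nat -> Q) (j : nat) : Z := (sZ alpha 0 * sZ alpha j / vZ alpha j)%Z.

Definition maxZ (m : nat) (f : nat -> Z) : Z := fold_right Z.max 0%Z (map f (seq 1 m)).
Definition lcmZ (m : nat) (f : nat -> Z) : Z := fold_right Z.lcm 1%Z (map f (seq 1 m)).

Definition RR m alpha := maxZ m (rZ alpha).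
Definition SS m alpha := maxZ m (sZ alpha).
Definition UU m alpha := maxZ m (uZ alpha).
Definition VV m alpha := maxZ m (vZ alpha).
Definition s_l m alpha := lcmZ m (sZ alpha).
Definition v_l m alpha := lcmZ m (vZ alpha).
Definition d_l m alpha := lcmZ m (dZ alpha).
Definition dtilde m alpha := (d_l m alpha / Z.gcd (d_l m alpha) (sZ alpha 0))%Z.

Definition two_factor (p s : Z) : R :=
  if Z.eqb p 2 && Z.even s then / 2 else 1.
Definition delta_p (p s : Z) : R := if Z.eqb (Z.modulo s p) 0 then 1 else 0.

Definition c1 m alpha theta : R :=
  theta * (INR m * (IZR (RR m alpha) + IZR (SS m alpha)) + IZR (UU m alpha)).
Definition c2 m alpha theta : R := INR m * theta * IZR (SS m alpha).
Definition c3 m alpha : R :=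
  ln (IZR (sZ alpha 0) ^ 2 * epsilon (sZ alpha 0) * epsilon (v_l m alpha)).
Definition c4 m alpha theta : R :=
  theta * IZR (VV m alpha)
  + ln (IZR (d_l m alpha) * epsilon (s_l m alpha)
        / IZR (Z.gcd (d_l m alpha) (sZ alpha 0))).
Definition c5 m alpha theta : R :=
  theta * (2 * (IZR (rZ alpha 0) - IZR (sZ alpha 0)) + INR m * IZR (UU m alpha)).
Definition c6 m alpha theta : R :=
  2 * theta * IZR (sZ alpha 0)
  + ln (IZR (d_l m alpha) * epsilon (s_l m alpha) / IZR (sZ alpha 0)).
Definition c7 m alpha theta : R := INR m * theta * IZR (VV m alpha).
Definition c8 m alpha theta : R :=
  c3 m alpha + c4 m alpha theta + c6 m alpha theta + c7 m alpha theta + 3.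

Definition h0 (m : nat) (ell : nat -> Z) : Z :=
  fold_right Z.max 0%Z (map (fun i => Z.abs (ell i)) (seq 0 (S m))).
Definition Htilde (m : nat) (ell : nat -> Z) : Z :=
  (h0 m ell * fold_right Z.mul 1%Z
                (map (fun j => Z.max 1 (Z.abs (ell j))) (seq 1 m)))%Z.

Definition N1 m alpha theta ctheta (p a : Z) : R :=
  Rmax ((INR m + 1) * ctheta)
    (Rmax (c1 m alpha theta + c5 m alpha theta)
       (ln (2 * IZR (dtilde m alpha))
        + 4 * delta_p p (s_l m alpha) * ln (IZR (Z.abs a)))).
Definition logH0 m alpha theta ctheta (tau : R) (p a : Z) : R :=
  Rmax ((N1 m alpha theta ctheta p a + INR m + 1) * ln (IZR (Z.abs a))
          / (1 + (INR m + 1) * tau))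
       (8 * ln (IZR (Z.abs a)) / tau).

(* Main.v *)
(** For degrees [n_0 >= n_1, ..., n_m] with sum [N], type II Pade approximation gives a polynomial [Q]
    of degree at most [N - n_0] and polynomials [P_j] of degree at most [N - n_j] such that
    [Q phi_j - P_j] vanishes to order [N + 1] at [0].  If [q_l] is the coefficient of [z^(deg - l)]
    in [Q], the vanishing of a coefficient of [Q phi_j] says that
    [sum_l q_l (x)_l (x + alpha_0 + l)_(deg - l)], a polynomial in [x], vanishes at [x = alpha_j + K]
    for [n_0 - n_j < K <= n_0].  So this polynomial is known up to a constant; evaluating it at
    [x = 0, -1, -2, ...] and using Vandermonde's identity gives [q_l] in closed form, hence its
    denominator and its size.

    Lowering one of the degrees by one gives [m + 1] approximations, whose determinant is a nonzero
    monomial; so for one of them the integer [A = D b^N (l_0 Q + sum_j l_j P_j)(beta)] is nonzero,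
    where [D] is the common denominator.  With [B = D b^N Q(beta)] and [Lambda] the linear form,
    [B Lambda - A] is divisible by about [a^N] in the p-adic sense.  The degrees
    [n_j = floor ((log h_j + tau log H) / log |a|)] make [|A|] smaller than [|a|_p^(-N)], so that
    [|Lambda|_p = |A|_p / |B|_p >= 1 / |A|].  The same holds for every long enough partial sum of
    [Lambda], with the same [A] and [B]: the p-adic absolute values of the partial sums are
    eventually constant. *)

Require Import Defs.
From Stdlib Require Import Reals QArith Qreals ZArith List Znumtheory Lra Lia.
From Stdlib Require Qcanon Qpower.
From mathcomp Require all_boot all_order all_fingroup all_algebra ring lra zify Rstruct.
Open Scope R_scope.

(** * Valuations, denominators and real inequalities *)

(** The obstacle is the growth of denominators: the remainder [B Lambda - A] involves coefficients
    of the [phi_j] of every degree [k >= N], whereas [D] clears those up to degree [N] only. Let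
    [W k] be a common denominator up to degree [k]. The condition on [|a|_p] and [|s|_p] makes each
    further factor [a] pay for the growth of [W], up to a single factor [p] in total; so
    [B Lambda - A] is divisible by [p^(N v_p(a) - 1)] whatever the length of the partial sum. By
    [|a|_p <= |a|^(-1 + delta)] this power is at least about [|a|^((1 - delta) N)]. On the other
    side, [log |A|] is at most [N log |a| - tau log H] plus losses: the summand [tau log H] in the
    degrees is the gain. A quarter of it pays for [delta], whence [4 delta]; a quarter for the
    rounding of the degrees and the lost factor [p], whence [8 log |a| / tau]; half for the
    denominators, the size of the coefficients and the powers of [b], whence the lower bound for
    [|a|]. Lastly [N log |a| <= (1 + (m + 1) tau) log H] yields the exponent of the theorem. *)

Lemma pval_aux_spec (f : nat) (p z : Z) : (1 < p)%Z -> z <> 0%Z -> (Z.abs z <= Z.of_nat f)%Z ->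
  exists c, z = (p ^ Z.of_nat (pval_aux f p z) * c)%Z /\ ~ (p | c)%Z.
Proof.
intros Hp; revert z; induction f as [|f IH]; intros z Hz Hf; [lia|].
cbn [pval_aux]; destruct (Z.eqb_spec (z mod p) 0) as [E|E].
- assert (Ez : z = (p * (z / p))%Z) by (apply Z.div_exact; lia).
  assert (Hq : (z / p <> 0)%Z) by nia.
  destruct (IH (z / p)%Z Hq) as [c [Hc Hn]].
  { set (q := (z / p)%Z) in *; rewrite Ez, Z.abs_mul, (Z.abs_eq p) in Hf by lia.
    assert (1 <= Z.abs q)%Z by lia; nia. }
  exists c; split; [|exact Hn].
  rewrite Nat2Z.inj_succ, Z.pow_succ_r by lia.
  rewrite <- Z.mul_assoc, <- Hc; exact Ez.
- exists z; split; [change (Z.of_nat 0) with 0%Z; rewrite Z.pow_0_r; ring|].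
  intros D; apply E, Z.mod_divide; [lia | exact D].
Qed.

Lemma pval_spec (p z : Z) : (1 < p)%Z -> z <> 0%Z ->
  exists c, z = (p ^ Z.of_nat (pval p z) * c)%Z /\ ~ (p | c)%Z.
Proof. intros; apply pval_aux_spec; lia. Qed.

Lemma pow_divide_le (p c : Z) (n k : nat) : (1 < p)%Z -> ~ (p | c)%Z ->
  (p ^ Z.of_nat n | p ^ Z.of_nat k * c)%Z -> (n <= k)%nat.
Proof.
intros Hp Hc [d Hd].
destruct (Nat.le_gt_cases n k) as [H|H]; [exact H|].
exfalso; apply Hc.
replace (Z.of_nat n) with (Z.of_nat k + (1 + Z.of_nat (n - k - 1)))%Z in Hd by lia.
rewrite Z.pow_add_r, (Z.pow_add_r p 1), Z.pow_1_r in Hd by lia.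
assert (0 < p ^ Z.of_nat k)%Z by (apply Z.pow_pos_nonneg; lia).
exists (d * p ^ Z.of_nat (n - k - 1))%Z; nia.
Qed.

Lemma pval_unique (p z c : Z) (n : nat) : (1 < p)%Z -> z <> 0%Z ->
  z = (p ^ Z.of_nat n * c)%Z -> ~ (p | c)%Z -> pval p z = n.
Proof.
intros Hp Hz Hn Hc; destruct (pval_spec p z Hp Hz) as [d [Hd Hd']].
apply Nat.le_antisymm.
- apply (pow_divide_le p c); auto; rewrite <- Hn; exists d; rewrite Z.mul_comm; exact Hd.
- apply (pow_divide_le p d); auto; rewrite <- Hd; exists c; rewrite Z.mul_comm; exact Hn.
Qed.

Lemma pval_mul (p x y : Z) : prime p -> x <> 0%Z -> y <> 0%Z ->
  pval p (x * y) = (pval p x + pval p y)%nat.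
Proof.
intros Hp Hx Hy; assert (H1 := prime_ge_2 p Hp).
destruct (pval_spec p x) as [c [Hc Hc']]; [lia | lia |].
destruct (pval_spec p y) as [d [Hd Hd']]; [lia | lia |].
apply pval_unique with (c * d)%Z; [lia | nia | |].
- rewrite Hc at 1; rewrite Hd at 1; rewrite Nat2Z.inj_add, Z.pow_add_r by lia; ring.
- intros D; destruct (prime_mult p Hp _ _ D); contradiction.
Qed.

Lemma pval_unit (p c : Z) : (1 < p)%Z -> c <> 0%Z -> ~ (p | c)%Z -> pval p c = 0%nat.
Proof. intros; apply pval_unique with c; auto; change (Z.of_nat 0) with 0%Z; rewrite Z.pow_0_r; ring. Qed.

Lemma pval_pow_le (p z : Z) : (1 < p)%Z -> z <> 0%Z -> (p ^ Z.of_nat (pval p z) <= Z.abs z)%Z.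
Proof.
intros Hp Hz; destruct (pval_spec p z Hp Hz) as [c [Hc _]].
assert (0 < p ^ Z.of_nat (pval p z))%Z by (apply Z.pow_pos_nonneg; lia).
assert (c <> 0)%Z by nia.
rewrite Hc at 2; rewrite Z.abs_mul; nia.
Qed.

(** A power of [p] dividing [z] is at most [|z|]: this turns an upper bound for an integer into a
    lower bound for its p-adic absolute value. *)
Lemma padicZ_bounds (p z : Z) : (1 < p)%Z -> z <> 0%Z -> / IZR (Z.abs z) <= padicZ p z <= 1.
Proof.
intros Hp Hz; unfold padicZ.
destruct (Z.eqb_spec z 0); [lia|].
assert (H := pval_pow_le p z Hp Hz).
rewrite pow_IZR.
assert (0 < p ^ Z.of_nat (pval p z))%Z by (apply Z.pow_pos_nonneg; lia).
assert (1 <= IZR (p ^ Z.of_nat (pval p z))) by (apply (IZR_le 1); lia).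
apply IZR_le in H; split.
- apply Rinv_le_contravar; lra.
- rewrite <- Rinv_1; apply Rinv_le_contravar; lra.
Qed.

(* The difference of [B * x] and [A * d] has larger valuation than [A * d], so the valuations of the
   two products agree. *)
Lemma padicQ_close (p A B x c z : Z) (d : positive) (e : nat) : prime p -> A <> 0%Z ->
  (Z.abs A < p ^ Z.of_nat e)%Z -> ~ (p | c)%Z ->
  (c * (B * x - A * Zpos d) = p ^ Z.of_nat e * z * Zpos d)%Z ->
  B <> 0%Z /\ padicQ p (Qmake x d) = padicZ p A / padicZ p B.
Proof.
intros Hp HA HAe Hc E; assert (H1 := prime_ge_2 p Hp).
assert (H1' : (1 < p)%Z) by lia.
assert (Hd0 : Zpos d <> 0%Z) by lia.
assert (Hc0 : c <> 0%Z) by (intros ->; apply Hc; exists 0%Z; lia).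
assert (HAd : (A * Zpos d)%Z <> 0%Z) by nia.
assert (LA : (pval p A < e)%nat).
{ assert (H := pval_pow_le p A H1' HA).
  destruct (Nat.lt_ge_cases (pval p A) e) as [L|L]; [exact L|].
  assert (p ^ Z.of_nat e <= p ^ Z.of_nat (pval p A))%Z by (apply Z.pow_le_mono_r; lia).
  lia. }
destruct (pval_spec p (Zpos d) H1' Hd0) as [d' [Hd Hd']].
destruct (pval_spec p A H1' HA) as [A' [EA HA']].
set (vd := pval p (Zpos d)) in *; set (vA := pval p A) in *.
set (t := (p ^ Z.of_nat (e - vA - 1))%Z).
assert (Ee : (p ^ Z.of_nat e = p ^ Z.of_nat vA * (p * t))%Z).
{ unfold t; replace (Z.of_nat e) with (Z.of_nat vA + (1 + Z.of_nat (e - vA - 1)))%Z by lia.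
  rewrite Z.pow_add_r, (Z.pow_add_r p 1), Z.pow_1_r by lia; ring. }
assert (EB : (c * (B * x))%Z = (p ^ Z.of_nat (vA + vd) * (c * A' * d' + p * (t * z * d')))%Z).
{ rewrite Nat2Z.inj_add, Z.pow_add_r by lia.
  assert (c * (B * x) = c * A * Zpos d + p ^ Z.of_nat e * z * Zpos d)%Z by lia.
  rewrite H, Ee, EA; rewrite Hd at 1 2; ring. }
assert (Hn : ~ (p | c * A' * d' + p * (t * z * d'))%Z).
{ intros D. assert (D2 : (p | c * A' * d')%Z).
  { replace (c * A' * d')%Z with ((c * A' * d' + p * (t * z * d')) - p * (t * z * d'))%Z by ring.
    apply Z.divide_sub_r; [exact D | exists (t * z * d')%Z; ring]. }
  destruct (prime_mult p Hp _ _ D2) as [D3|D3]; [|contradiction].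
  destruct (prime_mult p Hp _ _ D3); contradiction. }
assert (HBx : (c * (B * x))%Z <> 0%Z).
{ rewrite EB; intros H0; apply Z.mul_eq_0 in H0; destruct H0 as [H0|H0].
  - assert (0 < p ^ Z.of_nat (vA + vd))%Z by (apply Z.pow_pos_nonneg; lia); lia.
  - apply Hn; rewrite H0; exists 0%Z; lia. }
assert (HBx0 : (B * x)%Z <> 0%Z) by (intros H; apply HBx; rewrite H; ring).
assert (HB : B <> 0%Z) by (intros ->; apply HBx0; ring).
assert (Hx : x <> 0%Z) by (intros ->; apply HBx0; ring).
split; [exact HB|].
assert (V := pval_unique p _ _ _ H1' HBx EB Hn).
rewrite pval_mul, pval_unit, pval_mul in V by auto.
unfold padicQ, padicZ; cbn [Qnum Qden].
destruct (Z.eqb_spec x 0); [contradiction|].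
destruct (Z.eqb_spec A 0); [contradiction|].
destruct (Z.eqb_spec B 0); [contradiction|].
fold vd vA.
assert (P : forall n, IZR p ^ n <> 0) by (intros; apply pow_nonzero, not_0_IZR; lia).
assert (V' : IZR p ^ pval p B * IZR p ^ pval p x = IZR p ^ vA * IZR p ^ vd).
{ rewrite <- !pow_add; f_equal; exact V. }
unfold Rdiv; rewrite Rinv_inv.
apply (Rmult_eq_reg_r (IZR p ^ pval p x * IZR p ^ vA)).
2: { apply Rmult_integral_contrapositive; split; apply P. }
transitivity (IZR p ^ vA * IZR p ^ vd).
- field; apply P.
- rewrite <- V'; field; apply P.
Qed.

Lemma maxZ_ge (m : nat) (f : nat -> Z) (j : nat) : (1 <= j <= m)%nat -> (f j <= maxZ m f)%Z.
Proof.
intros Hj; unfold maxZ.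
assert (Hin : In j (seq 1 m)) by (apply in_seq; lia).
revert Hin; generalize (seq 1 m); intros l; induction l as [|i l IH]; [easy|].
intros [->|Hin]; cbn; [lia | specialize (IH Hin); lia].
Qed.

Lemma lcmZ_divide (m : nat) (f : nat -> Z) (j : nat) : (1 <= j <= m)%nat -> (f j | lcmZ m f)%Z.
Proof.
intros Hj; unfold lcmZ.
assert (Hin : In j (seq 1 m)) by (apply in_seq; lia).
revert Hin; generalize (seq 1 m); intros l; induction l as [|i l IH]; [easy|].
intros [->|Hin]; cbn [map fold_right]; [apply Z.divide_lcm_l|].
eapply Z.divide_trans; [exact (IH Hin) | apply Z.divide_lcm_r].
Qed.

Lemma lcmZ_least (m : nat) (f : nat -> Z) (x : Z) :
  (forall j, (1 <= j <= m)%nat -> (f j | x)%Z) -> (lcmZ m f | x)%Z.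
Proof.
intros H; unfold lcmZ.
assert (H' : forall j, In j (seq 1 m) -> (f j | x)%Z).
{ intros j Hj; apply in_seq in Hj; apply H; lia. }
revert H'; generalize (seq 1 m); intros l; induction l as [|i l IH]; intros H'.
- cbn; apply Z.divide_1_l.
- cbn [map fold_right]; apply Z.lcm_least; [apply H'; now left|].
  apply IH; intros; apply H'; now right.
Qed.

Lemma lcmZ_pos (m : nat) (f : nat -> Z) :
  (forall j, (1 <= j <= m)%nat -> (0 < f j)%Z) -> (0 < lcmZ m f)%Z.
Proof.
intros H; unfold lcmZ.
assert (H' : forall j, In j (seq 1 m) -> (0 < f j)%Z).
{ intros j Hj; apply in_seq in Hj; apply H; lia. }
revert H'; generalize (seq 1 m); intros l; induction l as [|i l IH]; intros H'.
- cbn; lia.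
- cbn [map fold_right].
  assert (0 < f i)%Z by (apply H'; now left).
  assert (0 < fold_right Z.lcm 1%Z (map f l))%Z by (apply IH; intros; apply H'; now right).
  assert (0 <= Z.lcm (f i) (fold_right Z.lcm 1%Z (map f l)))%Z by apply Z.lcm_nonneg.
  assert (Z.lcm (f i) (fold_right Z.lcm 1%Z (map f l)) <> 0)%Z.
  { intros E; apply Z.lcm_eq_0 in E; lia. }
  lia.
Qed.

Lemma Q2R_Qred (q : Q) : Q2R q = IZR (Qnum (Qred q)) / IZR (Zpos (Qden (Qred q))).
Proof. rewrite <- (Qeq_eqR _ _ (Qred_correct q)); reflexivity. Qed.

Lemma Qred_coprime (q : Q) : Z.gcd (Qnum (Qred q)) (Zpos (Qden (Qred q))) = 1%Z.
Proof. apply Qcanon.Qred_iff, Qred_complete, Qred_correct. Qed.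

Lemma Qred_num_pos (q : Q) : (0 < q)%Q -> (0 < Qnum (Qred q))%Z.
Proof.
intros H; rewrite <- (Qred_correct q) in H; unfold Qlt in H; cbn in H; lia.
Qed.

Lemma Q2R_inject_Z (z : Z) : Q2R (inject_Z z) = IZR z.
Proof. unfold Q2R; cbn; lra. Qed.

Lemma eq_frac_cross (x y z w : Z) : (0 < z)%Z -> (0 < w)%Z ->
  IZR x / IZR z = IZR y / IZR w -> (x * w = y * z)%Z.
Proof.
intros Hz Hw H; apply eq_IZR; rewrite !mult_IZR.
assert (0 < IZR z) by (apply (IZR_lt 0); lia); assert (0 < IZR w) by (apply (IZR_lt 0); lia).
replace (IZR x) with (IZR x / IZR z * IZR z) by (field; lra).
rewrite H; field; lra.
Qed.

(** * Divisibility relations between the denominators of the parameters *)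

Section Denominators.
Variables (m : nat) (alpha : nat -> Q).
Hypothesis alpha_pos : forall j, (j <= m)%nat -> (0 < alpha j)%Q.
Notation s := (sZ alpha).
Notation v := (vZ alpha).
Notation d := (dZ alpha).

(** Before reduction, [alpha_j + alpha_0] has denominator [s 0 * s j]. The divisibility makes the
    floor quotient in [dZ] exact. *)
Lemma v_divide (j : nat) : (v j | s 0 * s j)%Z.
Proof.
assert (E : Q2R (alpha j + alpha 0%nat) = Q2R (alpha j) + Q2R (alpha 0%nat)) by apply Q2R_plus.
rewrite !Q2R_Qred in E.
change (Zpos (Qden (Qred (alpha j + alpha 0%nat)))) with (v j) in E.
change (Zpos (Qden (Qred (alpha j)))) with (s j) in E.
change (Zpos (Qden (Qred (alpha 0%nat)))) with (s 0) in E.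
set (x := Qnum (Qred (alpha j))) in E; set (y := Qnum (Qred (alpha 0%nat))) in E.
assert (S0 : (0 < s 0)%Z) by reflexivity; assert (Sj : (0 < s j)%Z) by reflexivity.
assert (Vj : (0 < v j)%Z) by reflexivity.
assert (E2 : (uZ alpha j * (s j * s 0) = (x * s 0 + y * s j) * v j)%Z).
{ apply eq_frac_cross; [exact Vj | lia |].
  unfold uZ; rewrite E, plus_IZR, !mult_IZR; field.
  split; apply not_0_IZR; lia. }
apply (Gauss (v j) (uZ alpha j)).
- exists (x * s 0 + y * s j)%Z; lia.
- apply rel_prime_sym, Zgcd_1_rel_prime; exact (Qred_coprime (alpha j + alpha 0%nat)).
Qed.

Lemma dv_eq (j : nat) : (s 0 * s j = d j * v j)%Z.
Proof.
unfold dZ; destruct (v_divide j) as [k ->].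
assert (v j <> 0%Z) by discriminate. rewrite Z.div_mul by assumption; reflexivity.
Qed.

Lemma d_pos (j : nat) : (0 < d j)%Z.
Proof.
assert (E := dv_eq j); assert (0 < s 0)%Z by reflexivity; assert (0 < s j)%Z by reflexivity.
assert (0 < v j)%Z by reflexivity; nia.
Qed.

Lemma dl_pos : (0 < d_l m alpha)%Z.
Proof. apply lcmZ_pos; intros; apply d_pos. Qed.

Lemma sl_pos : (0 < s_l m alpha)%Z.
Proof. apply lcmZ_pos; intros; reflexivity. Qed.

Lemma vl_pos : (0 < v_l m alpha)%Z.
Proof. apply lcmZ_pos; intros; reflexivity. Qed.

Lemma dtilde_eq : (d_l m alpha = dtilde m alpha * Z.gcd (d_l m alpha) (s 0))%Z.
Proof.
unfold dtilde; rewrite Z.mul_comm.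
apply Z.div_exact; [|apply Z.mod_divide; [|apply Z.gcd_divide_l]];
intros E; apply Z.gcd_eq_0 in E; assert (H := dl_pos); lia.
Qed.

Lemma gcd_pos : (0 < Z.gcd (d_l m alpha) (s 0))%Z.
Proof.
assert (H := dl_pos). assert (0 <= Z.gcd (d_l m alpha) (s 0))%Z by apply Z.gcd_nonneg.
assert (Z.gcd (d_l m alpha) (s 0) <> 0)%Z by (intros E; apply Z.gcd_eq_0 in E; lia); lia.
Qed.

Lemma dtilde_pos : (0 < dtilde m alpha)%Z.
Proof. assert (H := dtilde_eq); assert (H1 := dl_pos); assert (H2 := gcd_pos); nia. Qed.

(** After multiplication by [s 0], a multiple of the gcd, this follows from [s 0 * s j = d j * v j]
    and [d j | d]. It says that one factor [dtilde] per degree clears the ratio [v_j / s_j] which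
    each further factor of [(alpha_j)_k / (alpha_j + alpha_0)_k] brings in. *)
Lemma s_divide_dtilde (j : nat) : (1 <= j <= m)%nat -> (s j | dtilde m alpha * v j)%Z.
Proof.
intros Hj; assert (Hd : (d j | d_l m alpha)%Z) by now apply lcmZ_divide.
destruct Hd as [k Hk]; assert (E := dtilde_eq); assert (E2 := dv_eq j).
destruct (Z.gcd_divide_r (d_l m alpha) (s 0)) as [t Ht].
assert (H2 := gcd_pos); set (g := Z.gcd _ _) in *.
assert (S0 : (0 < s 0)%Z) by reflexivity.
exists (k * t)%Z; apply (Z.mul_reg_l _ _ (s 0)); [lia|].
transitivity (t * v j * (dtilde m alpha * g))%Z; [rewrite Ht; ring|].
rewrite <- E, Hk.
transitivity (t * k * (d j * v j))%Z; [ring|].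
rewrite <- E2; ring.
Qed.

(** Cancel the gcd [g] in [d | s_0 s]: [dtilde] is prime to [s_0 / g]. Hence the powers of [dtilde]
    contain no more of [p] than those of [s], which the hypothesis on [|a|_p] controls. *)
Lemma dtilde_divide_sl : (dtilde m alpha | s_l m alpha)%Z.
Proof.
assert (Hd : (d_l m alpha | s 0 * s_l m alpha)%Z).
{ apply lcmZ_least; intros j Hj; apply Z.divide_trans with (s 0 * s j)%Z.
  - rewrite dv_eq; exists (v j); ring.
  - apply Z.mul_divide_mono_l; now apply lcmZ_divide. }
assert (E := dtilde_eq); assert (H2 := gcd_pos).
destruct (Z.gcd_divide_r (d_l m alpha) (s 0)) as [t Ht].
assert (Hg : Z.gcd (dtilde m alpha) t = 1%Z).
{ assert (G : Z.gcd (d_l m alpha / Z.gcd (d_l m alpha) (s 0)) (s 0 / Z.gcd (d_l m alpha) (s 0)) = 1%Z)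
    by (apply Z.gcd_div_gcd; lia).
  fold (dtilde m alpha) in G; rewrite <- G; f_equal.
  rewrite Ht at 1; rewrite Z.div_mul; lia. }
set (g := Z.gcd (d_l m alpha) (s 0)) in *.
apply (Gauss (dtilde m alpha) t).
- destruct Hd as [q Hq]; exists q.
  apply (Z.mul_reg_l _ _ g); [lia|].
  transitivity (q * d_l m alpha)%Z; [rewrite <- Hq, Ht; ring | rewrite E; ring].
- now apply Zgcd_1_rel_prime.
Qed.

(** From [s_j <= s_0 s_j = d_j v_j]. The bound is wanted in terms of [d] and [V] because [c8]
    contains [log d] and multiples of [V]. *)
Lemma s_le_dV (j : nat) : (1 <= j <= m)%nat -> (s j <= d_l m alpha * VV m alpha)%Z.
Proof.
intros Hj.
assert (Hd : (d j <= d_l m alpha)%Z).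
{ apply Z.divide_pos_le; [exact dl_pos | now apply lcmZ_divide]. }
assert (Hv : (v j <= VV m alpha)%Z) by now apply (maxZ_ge m (vZ alpha)).
assert (E := dv_eq j); assert (0 < s 0)%Z by reflexivity; assert (0 < s j)%Z by reflexivity.
assert (0 < v j)%Z by reflexivity; assert (D := d_pos j); nia.
Qed.

End Denominators.

(** * Inequalities between logarithms and the constants of the theorem *)

Lemma ln_le (x y : R) : 0 < x -> x <= y -> ln x <= ln y.
Proof. intros Hx [H|<-]; [left; apply ln_increasing; assumption | right; reflexivity]. Qed.

Lemma ln_le_sub1 (x : R) : 0 < x -> ln x <= x - 1.
Proof. intros Hx; assert (H := exp_ineq1_le (ln x)); rewrite exp_ln in H; lra. Qed.

Lemma ln_le_half (x : R) : 0 < x -> ln x <= x / 2.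
Proof.
intros Hx; assert (H := ln_le_sub1 (x / 2)); assert (H2 := ln_le_sub1 2).
replace x with (x / 2 * 2) at 1 by field; rewrite ln_mult; lra.
Qed.

Lemma ln_ge0 (x : R) : 1 <= x -> 0 <= ln x.
Proof. intros [H|<-]; [left; rewrite <- ln_1; apply ln_increasing; lra | rewrite ln_1; lra]. Qed.

(** Here [la], [lb], [lH] are the logarithms of [|a|], [b], [Htilde]; [M] is [m + 1] and [C] is
    [c8 + 2]. The gain [tau * lH] is shared out: a quarter to [delta * (N * la)], a quarter to
    [2 * la], and half to the powers of [b] and to [C * N]. *)
Lemma parameter_balance (la lb lH tau delta c2 C M N : R) :
  0 < la -> 0 <= lb -> 0 < lH -> 0 < tau -> 0 <= delta -> 0 <= c2 -> 0 <= C -> 0 <= M ->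
  4 * delta * (1 + M * tau) < tau ->
  2 * (1 + 1 / tau) * lb + 2 * (c2 * (1 + 1 / tau) + C * (M + 1 / tau)) < la ->
  8 * la <= tau * lH -> N * la <= (1 + M * tau) * lH ->
  2 * la + (1 + tau) * (lH / la) * lb + C * N + delta * (N * la) < tau * lH.
Proof.
intros Hla Hlb HlH Ht Hd Hc2 HC HM H1 H2 H3 H4.
assert (D : delta * (N * la) <= tau * lH / 4).
{ apply Rle_trans with (delta * ((1 + M * tau) * lH)); [now apply Rmult_le_compat_l|].
  assert (delta * (1 + M * tau) * lH <= tau / 4 * lH) by (apply Rmult_le_compat_r; lra); lra. }
(* This is [tau / 2] times the lower bound for [la]. The left side is the cost per unit of
   [lH / la], because [N <= (1 + M * tau) * (lH / la)]. *)
assert (P : (1 + tau) * lb + C * (1 + M * tau) < tau * la / 2).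
{ assert (E : tau / 2 * (2 * (1 + 1 / tau) * lb + 2 * (c2 * (1 + 1 / tau) + C * (M + 1 / tau)))
     = (1 + tau) * lb + c2 * (1 + tau) + C * (1 + M * tau)) by (field; lra).
  assert (0 <= c2 * (1 + tau)) by (apply Rmult_le_pos; lra).
  assert (tau / 2 * (2 * (1 + 1 / tau) * lb + 2 * (c2 * (1 + 1 / tau) + C * (M + 1 / tau)))
     < tau / 2 * la) by (apply Rmult_lt_compat_l; lra).
  lra. }
set (k := lH / la).
assert (Hk : 0 < k) by (apply Rdiv_lt_0_compat; lra).
assert (E : k * la = lH) by (unfold k; field; lra).
assert (HN : N <= (1 + M * tau) * k).
{ apply Rmult_le_reg_r with la; [lra|]; rewrite Rmult_assoc, E; exact H4. }
assert (HCN : C * N <= C * ((1 + M * tau) * k)) by now apply Rmult_le_compat_l.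
assert (k * ((1 + tau) * lb + C * (1 + M * tau)) < k * (tau * la / 2)) by now apply Rmult_lt_compat_l.
assert (k * (tau * la / 2) = tau * lH / 2) by (rewrite <- E; field).
lra.
Qed.

(** The left side is the logarithm of the bound for [|A|] without the factors that involve the
    [ell_j]; the right side is [(c8 + 2) * N] written out. The terms [N * (m + lV)] go into
    [c7 * N], the terms without a factor [N] are below [N] thanks to [c1 + c5 <= N], the term
    [2 * (al0 + N)] goes into [2 * theta * s0 * N], and the constant [3 + 2] leaves room for the
    logarithms of [N + 1] and [m + 1]. *)
Lemma exponent_budget (m N r0 s0 al0 R' S' U V theta ls0 le0 lev les ld lV ldt : R) :
  1 <= m -> 2 * (m + 1) <= N -> 1 < theta -> 1 <= s0 -> 0 <= r0 -> al0 <= r0 ->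
  0 <= R' -> 0 <= S' -> 0 <= U -> 1 <= V -> lV <= V - 1 -> 0 <= lev ->
  theta * (m * (R' + S') + U) + theta * (2 * (r0 - s0) + m * U) <= N ->
  N * (ls0 + le0 + (ld + lV + les) + (ldt + les)) + theta * (U + V * N) + 3 * ln (N + 1)
    + (2 * (al0 + N) + m * (R' + N)) + ln (m + 1)
  <= (2 * ls0 + le0 + lev + (theta * V + (ldt + les)) + (2 * theta * s0 + (ld + les - ls0))
       + m * theta * V + 3 + 2) * N.
Proof.
intros Hm HN Ht Hs Hr Ha HR HS HU HV HlV Hlev Hc.
assert (L1 := ln_le_half (N + 1)); assert (L2 := ln_le_half (m + 1)).
assert (A1 : 0 <= N * lev) by (apply Rmult_le_pos; lra).
assert (A2 : N * (m + lV) <= N * (m * theta * V)).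
{ apply Rmult_le_compat_l; [lra|].
  assert (0 <= (m - 1) * (V - 1)) by (apply Rmult_le_pos; lra).
  assert (m * V <= m * theta * V).
  { assert (0 <= (theta - 1) * (m * V)) by (repeat apply Rmult_le_pos; lra); lra. }
  lra. }
assert (A3 : m * R' + theta * U + 2 * theta * (r0 - s0) <= N).
{ assert (0 <= (theta - 1) * (m * R')) by (repeat apply Rmult_le_pos; lra).
  assert (0 <= theta * (m * S')) by (repeat apply Rmult_le_pos; lra).
  assert (0 <= theta * (m * U)) by (repeat apply Rmult_le_pos; lra).
  lra. }
(* Written with [N - 1] so that the right side exceeds [2 * theta * s0 * N] by
   [2 * theta * (r0 - s0)], which is a term of [c5]. *)
assert (A4 : 2 * (N - 1) + 2 * al0 <= 2 * theta * (s0 * (N - 1) + r0)).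
{ assert (0 <= (s0 - 1) * (N - 1)) by (apply Rmult_le_pos; lra).
  assert (0 <= (theta - 1) * (s0 * (N - 1) + r0)).
  { apply Rmult_le_pos; [lra|]. assert (0 <= s0 * (N - 1)) by (apply Rmult_le_pos; lra); lra. }
  lra. }
lra.
Qed.

(** * Approximation polynomials *)

Module Pade.
Import all_boot all_order all_fingroup all_algebra mathcomp.algebra_tactics.ring mathcomp.algebra_tactics.lra zify.
Set Implicit Arguments. Unset Strict Implicit. Unset Printing Implicit Defensive.
Import Order.TTheory GRing.Theory Num.Theory.
Local Open Scope ring_scope.

(** * Rising factorials and Vandermonde's identity *)

Section RisingFactorial.
Variable F : numFieldType.
Implicit Types (x y : F) (i k l n : nat).

Definition rfact x n : F := \prod_(t < n) (x + t%:R).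
(** The coefficient of [z^n] in [(1 - z)^(-x)]. *)
Definition rbin x n : F := rfact x n / n`!%:R.

Lemma rfact0 x : rfact x 0 = 1. Proof. by rewrite /rfact big_ord0. Qed.
Lemma rfactS x n : rfact x n.+1 = rfact x n * (x + n%:R).
Proof. by rewrite /rfact big_ord_recr. Qed.

Lemma rfactD x i k : rfact x (i + k) = rfact x i * rfact (x + i%:R) k.
Proof.
elim: k => [|k IH]; first by rewrite addn0 rfact0 mulr1.
by rewrite addnS !rfactS IH natrD mulrA addrA.
Qed.

Lemma rfactSl x n : rfact x n.+1 = x * rfact (x + 1) n.
Proof. by rewrite -add1n rfactD rfactS rfact0 mul1r addr0. Qed.

Lemma rfact_rev x n : rfact (x - n%:R) n = (-1) ^+ n * rfact (1 - x) n.
Proof.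
elim: n x => [|n IH] x; first by rewrite !rfact0 mulr1.
rewrite rfactSl rfactS -[in X in _ * X = _]natr1.
have -> : x - (n%:R + 1) + 1 = x - n%:R by ring.
by rewrite IH exprS -natr1; ring.
Qed.

Lemma rfact_natN k l : (l <= k)%N ->
  rfact (- k%:R) l * (k - l)`!%:R = (-1) ^+ l * k`!%:R.
Proof.
elim: l => [|l IH] lk; first by rewrite rfact0 subn0 expr0.
rewrite rfactS exprS mulN1r mulNr -IH ?(ltnW lk) //.
have -> : (k - l = (k - l.+1).+1)%N by lia.
rewrite factS natrM.
have -> : (k - l.+1).+1%:R = k%:R - l%:R :> F.
  by rewrite -natrB ?(ltnW lk) //; congr (_%:R); lia.
ring.
Qed.

Lemma rfact_natN0 k l : (k < l)%N -> rfact (- k%:R) l = 0.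
Proof.
by move=> kl; rewrite /rfact (bigD1 (Ordinal kl)) //= addNr mul0r.
Qed.

Lemma rbin0l n : rbin 0 n = (n == 0%N)%:R.
Proof.
case: n => [|n]; first by rewrite /rbin rfact0 divr1.
by rewrite /rbin rfactSl !mul0r.
Qed.

Lemma rbinS x n : n.+1%:R * rbin x n.+1 = (x + n%:R) * rbin x n.
Proof.
rewrite /rbin rfactS factS natrM.
have h1 : n.+1%:R != 0 :> F by rewrite pnatr_eq0.
have h2 : n`!%:R != 0 :> F by rewrite pnatr_eq0 -lt0n fact_gt0.
by move: (n.+1%:R) h1 (n`!%:R) h2 => c h1 d h2; field; rewrite h1 h2.
Qed.

(** Multiply by [n + 1 = i + (n + 1 - i)] and lower, by [rbinS], the index that goes with each
    summand; the halves recombine because [(x + i) + (y + n - i) = x + y + n]. *)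
Lemma rbin_vandermonde x y n :
  rbin (x + y) n = \sum_(i < n.+1) rbin x i * rbin y (n - i).
Proof.
elim: n => [|n IH]; first by rewrite big_ord1 /rbin !rfact0 !divr1 mulr1.
have h1 : n.+1%:R != 0 :> F by rewrite pnatr_eq0.
apply: (mulfI h1); rewrite rbinS IH mulr_sumr mulr_sumr.
pose u i := i%:R * rbin x i * rbin y (n.+1 - i).
pose w i := (n.+1 - i)%:R * rbin x i * rbin y (n.+1 - i).
have -> : \sum_(i < n.+2) n.+1%:R * (rbin x i * rbin y (n.+1 - i)) =
  \sum_(i < n.+2) u i + \sum_(i < n.+2) w i.
  rewrite -big_split /=; apply: eq_bigr => i _; rewrite /u /w.
  have hi : (i <= n.+1)%N by rewrite -ltnS.
  have -> : n.+1%:R = i%:R + (n.+1 - i)%:R :> F by rewrite -natrD subnKC.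
  by move: (n.+1 - i)%:R => z; ring.
rewrite [X in _ = X + _]big_ord_recl [X in _ = _ + X]big_ord_recr /=.
rewrite {1}/u {2}/w subnn !mul0r add0r addr0.
rewrite -big_split /=; apply: eq_bigr => i _.
have hi : (i <= n)%N by rewrite -ltnS.
rewrite /u /w /bump /= add1n subSS rbinS subSn //.
have -> z : (n - i).+1%:R * z * rbin y (n - i).+1 = z * ((y + (n - i)%:R) * rbin y (n - i)).
  by rewrite -rbinS; ring.
have -> : (n - i)%:R = n%:R - i%:R :> F by rewrite natrB.
ring.
Qed.

Lemma sum_triangle k (f : nat -> nat -> F) :
  \sum_(l < k.+1) \sum_(i < l.+1) f l i =
  \sum_(i < k.+1) \sum_(t < (k - i).+1) f (i + t)%N i.
Proof.
elim: k => [|k IH]; first by rewrite !big_ord1.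
rewrite big_ord_recr /= IH [RHS]big_ord_recr /= subnn big_ord1 addn0.
rewrite [\sum_(i < k.+2) _]big_ord_recr /= addrA -big_split /=; congr (_ + _).
apply: eq_bigr => i _; have hi : (i <= k)%N by rewrite -ltnS.
by rewrite subSn // [RHS]big_ord_recr /= addnS subnKC.
Qed.

End RisingFactorial.

(** * Interpolation at the points 0, -1, ..., -n *)

Section Interpolation.
Variables (F : numFieldType) (a0 : F) (n : nat) (G : nat -> F).

(** The solution of the triangular system in [qcoef_interp]. At [x = -k] only the terms with
    [l <= k] survive, and up to a factor [c] depending on [k] the matrix is [rbin (1 - a0) (k - l)].
    Its inverse is [rbin (a0 - 1) (l - i)], because [(1 - z)^(a0 - 1)] and [(1 - z)^(1 - a0)] are
    inverse to each other. The weight [rbin (1 - a0 - n) i] turns [c] into [rfact a0 n], which is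
    the same for all [k]. *)
Definition qcoef l : F :=
  \sum_(i < l.+1) rbin (a0 - 1) (l - i) * rbin (1 - a0 - n%:R) i * G i.

Lemma qcoef_interp k : (k <= n)%N ->
  \sum_(l < n.+1) qcoef l * (rfact (- k%:R) l * rfact (- k%:R + a0 + l%:R) (n - l))
  = rfact a0 n * G k.
Proof.
move=> kn.
pose c := (-1) ^+ k * k`!%:R * rfact a0 (n - k).
rewrite -(big_mkord xpredT (fun l => qcoef l * (rfact (- k%:R) l * rfact (- k%:R + a0 + l%:R) (n - l)))).
rewrite (big_cat_nat (n := k.+1)) // [X in _ + X = _]big1_seq ?addr0; last first.
  move=> i; rewrite mem_index_iota => /andP[_ /andP[ki _]].
  by rewrite rfact_natN0 // mul0r mulr0.
rewrite big_mkord.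
have E l : (l < k.+1)%N ->
    rfact (- k%:R) l * rfact (- k%:R + a0 + l%:R) (n - l) = c * rbin (1 - a0) (k - l).
  rewrite ltnS => lk.
  have -> : (n - l = (k - l) + (n - k))%N by lia.
  have -> : - k%:R + a0 + l%:R = a0 - (k - l)%:R by rewrite natrB //; ring.
  rewrite rfactD subrK rfact_rev /c /rbin.
  have h2 : (k - l)`!%:R != 0 :> F by rewrite pnatr_eq0 -lt0n fact_gt0.
  apply: (mulIf h2); rewrite mulrAC (rfact_natN F lk) -[in (-1) ^+ k](subnKC lk) exprD.
  by field; rewrite h2.
transitivity (\sum_(l < k.+1) \sum_(i < l.+1)
   (c * rbin (1 - a0) (k - l) * (rbin (a0 - 1) (l - i) * rbin (1 - a0 - n%:R) i * G i))).
  by apply: eq_bigr => l _; rewrite E // mulrC mulr_sumr.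
rewrite (@sum_triangle _ _ (fun l i => c * rbin (1 - a0) (k - l) *
   (rbin (a0 - 1) (l - i) * rbin (1 - a0 - n%:R) i * G i))).
have V i : (i <= k)%N -> \sum_(t < (k - i).+1)
   (c * rbin (1 - a0) (k - (i + t)) * (rbin (a0 - 1) (i + t - i) * rbin (1 - a0 - n%:R) i * G i)) =
   c * rbin (1 - a0 - n%:R) i * G i * (i == k)%:R.
  move=> ik.
  have -> : (i == k)%:R = rbin (0 : F) (k - i).
    by rewrite rbin0l; congr (_%:R); rewrite subn_eq0; lia.
  have -> : rbin 0 (k - i) = rbin ((a0 - 1) + (1 - a0)) (k - i) by congr rbin; ring.
  rewrite rbin_vandermonde mulr_sumr; apply: eq_bigr => t _.
  by rewrite addnC addnK subnDA [(k - t - i)%N]subnAC; ring.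
rewrite (bigD1 (Ordinal (ltnSn k))) //= V // eqxx big1 ?addr0; last first.
  move=> i ik; rewrite V; last by rewrite -ltnS.
  by rewrite (_ : (nat_of_ord i == k) = false) ?mulr0 //; apply/negbTE.
rewrite mulr1 /c /rbin.
have h2 : k`!%:R != 0 :> F by rewrite pnatr_eq0 -lt0n fact_gt0.
have -> : rfact (1 - a0 - n%:R) k = (-1) ^+ k * rfact (a0 + (n - k)%:R) k.
  have -> : 1 - a0 - n%:R = (1 - a0 - (n - k)%:R) - k%:R by rewrite natrB //; ring.
  by rewrite rfact_rev; congr (_ * rfact _ _); ring.
rewrite -[n in RHS](subnK kn) rfactD.
have -> : (-1) ^+ k * k`!%:R * rfact a0 (n - k) *
    ((-1) ^+ k * rfact (a0 + (n - k)%:R) k / k`!%:R) * G k =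
  ((-1) ^+ k * (-1) ^+ k) * (rfact a0 (n - k) * rfact (a0 + (n - k)%:R) k * G k).
  by field; rewrite h2.
by rewrite -exprMn mulrNN mulr1 expr1n mul1r.
Qed.

(** Both sides are polynomials in [x] of degree at most [n], and they agree at the [n + 1] points
    [0, -1, ..., -n]. *)
Lemma qcoef_horner (H : {poly F}) x : (size H <= n.+1)%N ->
  (forall k, (k <= n)%N -> H.[- k%:R] = G k) ->
  \sum_(l < n.+1) qcoef l * (rfact x l * rfact (x + a0 + l%:R) (n - l)) = rfact a0 n * H.[x].
Proof.
move=> sH HG.
pose rp (c : F) l : {poly F} := \prod_(t < l) ('X + (c + t%:R)%:P).
have rpE c l y : (rp c l).[y] = rfact (y + c) l.
  by rewrite horner_prod; apply: eq_bigr => t _; rewrite hornerD hornerX hornerC addrA.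
have srp c l : size (rp c l) = l.+1.
  rewrite /rp (eq_bigr (fun t : 'I_l => 'X - (- (c + t%:R))%:P)); last first.
    by move=> t _; rewrite polyCN opprK.
  by rewrite size_prod_XsubC /index_enum -enumT size_enum_ord.
pose P := \sum_(l < n.+1) qcoef l *: (rp 0 l * rp (a0 + l%:R) (n - l)%N) - rfact a0 n *: H.
have PE y : P.[y] = \sum_(l < n.+1) qcoef l * (rfact y l * rfact (y + a0 + l%:R) (n - l))
      - rfact a0 n * H.[y].
  rewrite /P hornerD hornerN horner_sum hornerZ; congr (_ - _).
  by apply: eq_bigr => l _; rewrite hornerZ hornerM !rpE addr0 addrA.
suff P0 : P = 0 by apply/eqP; rewrite -subr_eq0 -PE P0 horner0.
apply/eqP/negPn/negP => P0.
have sP : (size P <= n.+1)%N.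
  rewrite /P (leq_trans (size_polyD _ _)) // size_polyN geq_max; apply/andP; split.
    rewrite (leq_trans (size_sum _ _ _)) //; apply/bigmax_leqP => l _.
    rewrite (leq_trans (size_scale_leq _ _)) // (leq_trans (size_polyMleq _ _)) // !srp.
    by have := ltn_ord l; lia.
  by rewrite (leq_trans (size_scale_leq _ _)).
have := @max_poly_roots _ P [seq - (k%:R : F) | k <- iota 0 n.+1] P0.
rewrite size_map size_iota map_inj_uniq ?iota_uniq; last first.
  by move=> i j /= /oppr_inj/eqP; rewrite eqr_nat => /eqP.
have -> : all (root P) [seq - (k%:R : F) | k <- iota 0 n.+1].
  apply/allP => z /mapP[k]; rewrite mem_iota ltnS => kn ->.
  by rewrite rootE PE qcoef_interp // HG // subrr.
by move=> /(_ isT isT); rewrite ltnNge sP.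
Qed.

End Interpolation.

(** * One system of simultaneous approximations *)

Lemma size_prod_leq1 (R : comNzRingType) (I : Type) (r : seq I) (P : I -> {poly R}) (d : I -> nat) :
  (forall i, size (P i) <= (d i).+1)%N -> (size (\prod_(i <- r) P i)%R <= (\sum_(i <- r) d i).+1)%N.
Proof.
move=> h; elim: r => [|i r IH]; first by rewrite !big_nil size_poly1.
rewrite !big_cons (leq_trans (size_polyMleq _ _)) //.
by have := h i; move: IH; lia.
Qed.

Section PadeRow.
Variables (F : numFieldType) (m : nat) (a : nat -> F).
Hypothesis a_gt0 : forall j, (j <= m)%N -> 0 < a j.
Variable nn : nat -> nat.
Hypothesis nnP : forall j, (1 <= j <= m)%N -> (nn j <= (nn 0).+1)%N.

Definition fcoef j k : F := rfact (a j) k / rfact (a j + a 0) k.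
Definition qdeg : nat := \sum_(1 <= j < m.+1) nn j.
(* [Q * phi_j] has no term of degree [qdeg + K] for [shift j <= K <= nn 0]; the subtraction is not
   truncated because of [nnP]. *)
Definition shift j : nat := (nn 0).+1 - nn j.
(** The value of [Hpoly] at [-k], from which [qcoef] recovers the coefficients. *)
Definition Gval k : F := \prod_(1 <= j < m.+1) rbin (a j + (shift j)%:R + k%:R) (nn j).
Definition qc l : F := qcoef (a 0) qdeg Gval l.
Definition Qpoly : {poly F} := \poly_(i < qdeg.+1) qc (qdeg - i).
Definition Ppoly j : {poly F} :=
  \poly_(k < qdeg + shift j) \sum_(i < k.+1) Qpoly`_i * fcoef j (k - i).
(** The length [B] stays free: the p-adic argument is run on the partial sums themselves, with one
    and the same [Q] and [P_j] for all of them. *)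
Definition Phi j B : {poly F} := \poly_(k < B) fcoef j k.

Lemma rfact_gt0 (x : F) n : 0 < x -> 0 < rfact x n.
Proof. by move=> x0; apply: prodr_gt0 => i _; rewrite ltr_wpDr. Qed.

(** Its zeros are the [a j + K] with [shift j <= K <= nn 0]. The scaling makes its values products
    of [rbin], whose denominators and sizes can be estimated. *)
Definition Hpoly : {poly F} := \prod_(1 <= j < m.+1)
  ((nn j)`!%:R^-1 *: \prod_(t < nn j) ((a j + (shift j)%:R + t%:R)%:P - 'X)).

Lemma HpolyE x : Hpoly.[x] =
  \prod_(1 <= j < m.+1) rbin (a j + (shift j)%:R - x) (nn j).
Proof.
rewrite horner_prod; apply: eq_bigr => j _.
rewrite hornerZ horner_prod /rbin mulrC; congr (_ / _); apply: eq_bigr => t _.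
by rewrite hornerD hornerN hornerC hornerX; ring.
Qed.

Lemma size_Hpoly : (size Hpoly <= qdeg.+1)%N.
Proof.
apply: size_prod_leq1 => j; rewrite (leq_trans (size_scale_leq _ _)) //.
have := @size_prod_leq1 _ _ (index_enum 'I_(nn j))
   (fun t => (a j + (shift j)%:R + t%:R)%:P - 'X) (fun=> 1%N).
rewrite sum1_card card_ord; apply => t.
rewrite (leq_trans (size_polyD _ _)) // size_polyN size_polyX geq_max andbT.
by rewrite (leq_trans (size_polyC_leq1 _)).
Qed.

(** The shift [K] moves into the argument [x = a j + K], so that a coefficient of [Q * phi_j]
    becomes a value of the polynomial in [qcoef_horner]. *)
Lemma fcoefD j K l : (1 <= j <= m)%N -> (l <= qdeg)%N ->
  fcoef j (K + l) = fcoef j K / rfact (a j + K%:R + a 0) qdeg *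
    (rfact (a j + K%:R) l * rfact (a j + K%:R + a 0 + l%:R) (qdeg - l)).
Proof.
move=> /andP[j0 jm] lq.
have p0 := a_gt0 (leq0n m); have pj := a_gt0 jm.
have K0 : 0 <= K%:R :> F by [].
have n1 : rfact (a j + a 0) K != 0 by rewrite gt_eqF // rfact_gt0 // addr_gt0.
have n2 : rfact (a j + K%:R + a 0) l != 0.
  by rewrite gt_eqF // rfact_gt0 // ltr_wpDl // ?addr_ge0 // ltW.
have n3 : rfact (a j + K%:R + a 0 + l%:R) (qdeg - l) != 0.
  by rewrite gt_eqF // rfact_gt0 // ltr_wpDr // ltr_wpDl // ?addr_ge0 // ltW.
have E : rfact (a j + K%:R + a 0) qdeg =
    rfact (a j + K%:R + a 0) l * rfact (a j + K%:R + a 0 + l%:R) (qdeg - l).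
  by rewrite -rfactD subnKC.
rewrite E /fcoef !rfactD.
have -> : a j + a 0 + K%:R = a j + K%:R + a 0 by ring.
by field; rewrite n1 n2 n3.
Qed.

Lemma conv_fcoef j K : (1 <= j <= m)%N ->
  \sum_(l < qdeg.+1) qc l * fcoef j (K + l) =
  fcoef j K / rfact (a j + K%:R + a 0) qdeg * rfact (a 0) qdeg * Hpoly.[a j + K%:R].
Proof.
move=> jP; rewrite -mulrA -(@qcoef_horner _ _ _ Gval) ?size_Hpoly //; last first.
  by move=> k _; rewrite HpolyE; apply: eq_bigr => i _; rewrite opprK.
rewrite mulr_sumr; apply: eq_bigr => l _.
have lq : (l <= qdeg)%N by rewrite -ltnS.
by rewrite fcoefD // mulrCA.
Qed.

Lemma conv_fcoef_eq0 j K : (1 <= j <= m)%N -> (shift j <= K <= nn 0)%N ->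
  \sum_(l < qdeg.+1) qc l * fcoef j (K + l) = 0.
Proof.
move=> jP /andP[sK Kn]; rewrite conv_fcoef //.
suff -> : Hpoly.[a j + K%:R] = 0 by rewrite mulr0.
have Kt : (K - shift j < nn j)%N by rewrite /shift in sK *; have := nnP jP; lia.
rewrite HpolyE (bigD1_seq j) ?mem_index_iota ?iota_uniq //=.
rewrite /rbin /rfact (bigD1 (Ordinal Kt)) //=.
have -> : a j + (shift j)%:R - (a j + K%:R) + (K - shift j)%:R = 0.
  by rewrite (natrB _ sK); ring.
by rewrite !mul0r.
Qed.

Lemma coef_QPhi j B k : (k < B)%N ->
  (Qpoly * Phi j B)`_k = \sum_(i < k.+1) Qpoly`_i * fcoef j (k - i).
Proof.
move=> kB; rewrite coefM; apply: eq_bigr => i _; congr (_ * _); rewrite coef_poly.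
by rewrite (leq_ltn_trans (leq_subr _ _)).
Qed.

Lemma conv_Qpoly j K :
  \sum_(i < (qdeg + K).+1) Qpoly`_i * fcoef j (qdeg + K - i) =
  \sum_(l < qdeg.+1) qc l * fcoef j (K + l).
Proof.
rewrite -(big_mkord xpredT (fun i => Qpoly`_i * fcoef j (qdeg + K - i))).
rewrite (big_cat_nat (n := qdeg.+1)) ?ltnS ?leq_addr // [X in _ + X = _]big1_seq ?addr0; last first.
  move=> i; rewrite mem_index_iota => /andP[_ /andP[ki _]].
  by rewrite coef_poly ltnNge ki mul0r.
rewrite big_rev_mkord subn0; apply: eq_bigr => l _.
have lq : (l <= qdeg)%N by rewrite -ltnS.
rewrite subSS coef_poly ltnS leq_subr; congr (qc _ * fcoef _ _); lia.
Qed.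

(** Coefficients of degree below [B] do not see the truncation of the series. Those of degree
    [qdeg + K] with [shift j <= K <= nn 0] vanish, and they fill the gap between [Ppoly] and the
    tail. *)
Lemma Ppoly_approx j B : (1 <= j <= m)%N -> (qdeg + (nn 0).+1 <= B)%N ->
  Qpoly * Phi j B = Ppoly j +
    \sum_(qdeg + (nn 0).+1 <= k < qdeg + B) (Qpoly * Phi j B)`_k *: 'X^k.
Proof.
move=> jP hB; apply/polyP => k; rewrite coefD coef_sum coef_poly.
have -> : \sum_(qdeg + (nn 0).+1 <= i < qdeg + B) ((Qpoly * Phi j B)`_i *: 'X^i)`_k =
   if (qdeg + (nn 0).+1 <= k < qdeg + B)%N then (Qpoly * Phi j B)`_k else 0.
  case: ifP => kr.
    rewrite (bigD1_seq k) ?mem_index_iota ?iota_uniq //= coefZ coefXn eqxx mulr1.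
    rewrite big1 ?addr0 // => i ik; rewrite coefZ coefXn.
    by rewrite eq_sym (negbTE ik) mulr0.
  rewrite big1_seq // => i; rewrite mem_index_iota coefZ coefXn /= => ir.
  by case: eqP => [ki|]; rewrite ?mulr0 //; move: ir; rewrite -ki kr.
have sh1 : (shift j <= (nn 0).+1)%N by rewrite /shift leq_subr.
case: ltnP => k1.
  rewrite ifF; last by apply/negbTE; rewrite negb_and -ltnNge; apply/orP; left; lia.
  by rewrite addr0 coef_QPhi //; lia.
case: ifP => [_|/negbT k2]; first by rewrite add0r.
rewrite addr0.
have [k3|k3] := ltnP k (qdeg + (nn 0).+1).
  rewrite coef_QPhi; last by lia.
  have -> : k = (qdeg + (k - qdeg))%N by lia.
  by rewrite conv_Qpoly conv_fcoef_eq0 //; lia.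
have k4 : (qdeg + B <= k)%N by lia.
apply: nth_default; rewrite (leq_trans (size_polyMleq _ _)) //.
have := size_poly qdeg.+1 (fun i => qc (qdeg - i)).
have := size_poly B (fcoef j); rewrite -/Qpoly -/(Phi j B); lia.
Qed.

Lemma lead_Qpoly : Qpoly`_qdeg != 0.
Proof.
rewrite coef_poly ltnSn subnn /qc /qcoef big_ord1 /rbin !rfact0 !divr1 !mul1r.
rewrite gt_eqF // /Gval big_seq prodr_gt0 // => j; rewrite mem_index_iota => jP.
rewrite /rbin divr_gt0 ?ltr0n ?fact_gt0 // rfact_gt0 // !ltr_wpDr // a_gt0 //; lia.
Qed.

Hypothesis a_nint : forall i j, (1 <= i <= m)%N -> (1 <= j <= m)%N -> i != j ->
  forall x y : nat, a i + x%:R != a j + y%:R.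

(** The top coefficient belongs to [K = shift j - 1], just before the zeros of [Hpoly] that come
    from [a j]; the zeros that come from another [a i] are avoided by [a_nint]. *)
Lemma lead_Ppoly j : (1 <= j <= m)%N -> (0 < shift j)%N ->
  (Ppoly j)`_(qdeg + (shift j).-1) != 0.
Proof.
move=> jP s0; rewrite coef_poly ifT; last by lia.
have p0 := a_gt0 (leq0n m); have pj : 0 < a j by apply: a_gt0; lia.
rewrite conv_Qpoly conv_fcoef // !mulf_neq0 ?invr_neq0 //.
- by rewrite gt_eqF // rfact_gt0.
- by rewrite gt_eqF // rfact_gt0 // addr_gt0.
- by rewrite gt_eqF // rfact_gt0 // addr_gt0 // ltr_wpDr.
- by rewrite gt_eqF // rfact_gt0.
rewrite HpolyE prodf_seq_neq0; apply/allP => i; rewrite mem_index_iota /= => iP.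
rewrite /rbin mulf_neq0 ?invr_neq0 ?pnatr_eq0 -?lt0n ?fact_gt0 //.
rewrite /rfact prodf_seq_neq0; apply/allP => -[t tn] _ /= {tn}.
have [->|ij] := eqVneq i j.
  have -> : a j + (shift j)%:R - (a j + (shift j).-1%:R) + t%:R = t.+1%:R.
    by rewrite -(prednK s0) -!natr1 /= ; ring.
  by rewrite pnatr_eq0.
have -> : a i + (shift i)%:R - (a j + (shift j).-1%:R) + t%:R =
  (a i + (shift i + t)%:R) - (a j + (shift j).-1%:R) by rewrite natrD; ring.
by rewrite subr_eq0; apply: a_nint => //; lia.
Qed.

End PadeRow.

(** * The determinant of the approximations *)

Lemma coef_prod_top (R : comNzRingType) (I : Type) (r : seq I) (P : I -> {poly R}) (d : I -> nat) :
  (forall i, size (P i) <= (d i).+1)%N ->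
  (\prod_(i <- r) P i)`_(\sum_(i <- r) d i) = \prod_(i <- r) (P i)`_(d i).
Proof.
move=> h; elim: r => [|i r IH]; first by rewrite !big_nil coef1.
rewrite !big_cons; have := size_prod_leq1 r h.
set Q := \prod_(j <- r) P j in IH *; set e := (\sum_(j <- r) d j)%N in IH * => sQ.
rewrite coefM (bigD1 (Ordinal (leq_addr e (d i) : (d i < (d i + e).+1)%N))) //=.
rewrite [(d i + e - d i)%N]addKn IH [X in _ + X = _]big1 ?addr0 // => k /eqP kd.
have {}kd : nat_of_ord k <> d i by move=> E; apply: kd; apply: val_inj.
have [kl|kl] := ltnP k (d i); last by rewrite nth_default ?mul0r // (leq_trans (h i)) //; lia.
by rewrite [X in _ * X]nth_default ?mulr0 // (leq_trans sQ) //; lia.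
Qed.

(** Column [j] can reach degree [d j] on the diagonal only, so the matrix of the coefficients of
    degree [d j] is diagonal. *)
Lemma det_top (F : idomainType) n (A : 'M[{poly F}]_n) (d : 'I_n -> nat) :
  (forall i j, size (A i j) <= d j + (i == j))%N ->
  (\det A)`_(\sum_j d j) = \prod_i (A i i)`_(d i) /\ (size (\det A) <= (\sum_j d j).+1)%N.
Proof.
move=> h.
have hs (s : 'S_n) : (\sum_i d (s i) = \sum_j d j)%N.
  by rewrite [RHS](reindex_inj (@perm_inj _ s)).
have hA (s : 'S_n) i : (size (A i (s i)) <= (d (s i)).+1)%N.
  by rewrite (leq_trans (h i (s i))) // -addn1 leq_add2l leq_b1.
have hc (s : 'S_n) : (\prod_i A i (s i))`_(\sum_j d j) = \prod_i (A i (s i))`_(d (s i)).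
  by rewrite -(hs s) (coef_prod_top _ (hA s)).
have hz (s : 'S_n) : (size (\prod_i A i (s i))%R <= (\sum_j d j).+1)%N.
  by rewrite -(hs s) size_prod_leq1.
split.
  transitivity (\det (\matrix_(i, j) (A i j)`_(d j))).
    rewrite coef_sum; apply: eq_bigr => s _.
    rewrite !mulr_sign.
    have <- : \prod_i (A i (s i))`_(d (s i)) = \prod_i (\matrix_(i, j) (A i j)`_(d j)) i (s i).
      by apply: eq_bigr => i _; rewrite mxE.
    by rewrite -hc; case: (s : bool) => //; rewrite coefN.
  have -> : \matrix_(i, j) (A i j)`_(d j) = diag_mx (\row_i (A i i)`_(d i)).
    apply/matrixP => i j; rewrite !mxE; case: eqVneq => [->|ij]; first by [].
    by rewrite nth_default // (leq_trans (h i j)) // (negbTE ij) addn0.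
  by rewrite det_diag; apply: eq_bigr => i _; rewrite mxE.
rewrite (leq_trans (size_sum _ _ _)) //; apply/bigmax_leqP => s _.
rewrite mulr_sign; case: (s : bool); rewrite ?size_polyN; exact: hz.
Qed.

Section Determinant.
Variables (F : numFieldType) (m : nat) (a : nat -> F).
Hypothesis a_gt0 : forall j, (j <= m)%N -> 0 < a j.
Hypothesis a_nint : forall i j, (1 <= i <= m)%N -> (1 <= j <= m)%N -> i != j ->
  forall x y : nat, a i + x%:R != a j + y%:R.
Variable nn : nat -> nat.
Hypothesis nn_gt0 : forall j, (j <= m)%N -> (0 < nn j)%N.
Hypothesis nn_le : forall j, (j <= m)%N -> (nn j <= nn 0)%N.

Definition nrow i j : nat := nn j - (j == i).
Definition Ntot : nat := \sum_(0 <= j < m.+1) nn j.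

(** The slack of one, which is also that of [nnP], is for the row [i = 0], where the largest degree
    is the one lowered. *)
Lemma nrowP i j : (1 <= j <= m)%N -> (nrow i j <= (nrow i 0).+1)%N.
Proof.
by case/andP=> j0 jm; rewrite /nrow; have := nn_le jm; case: (0 == i); case: (j == i) => /=; lia.
Qed.

(** Every row loses exactly one unit of degree, so all rows have the same order of approximation;
    this is why one triangular factor [Tmx] serves all of them. *)
Lemma Ntot_row i : (i <= m)%N -> (qdeg m (nrow i) + (nrow i 0).+1)%N = Ntot.
Proof.
move=> im; rewrite addnS addnC /qdeg.
have -> : (nrow i 0 + \sum_(1 <= j < m.+1) nrow i j = \sum_(0 <= j < m.+1) nrow i j)%N.
  by rewrite [RHS]big_nat_recl // big_add1.
have -> : Ntot = (\sum_(0 <= j < m.+1) (nrow i j + (j == i)))%N.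
  rewrite /Ntot !big_nat; apply: eq_bigr => j /andP[_ jm].
  by rewrite /nrow; have := nn_gt0 (jm : (j <= m)%N); case: (j == i); lia.
have S1 : (\sum_(0 <= j < m.+1) (j == i) = 1)%N.
  rewrite (bigD1_seq i) ?mem_index_iota ?iota_uniq //=.
  by rewrite eqxx big1 // => j /negbTE ->.
by rewrite big_split /= S1 addn1.
Qed.

Lemma Ntot_shift i j : (i <= m)%N -> (1 <= j <= m)%N ->
  (qdeg m (nrow i) + shift (nrow i) j + nrow i j)%N = Ntot.
Proof.
by move=> im jm; rewrite -(Ntot_row im) /shift; have := nrowP i jm; lia.
Qed.

Definition Mrow i j : {poly F} :=
  if j is 0%N then Qpoly m a (nrow i) else Ppoly m a (nrow i) j.

Lemma nn_le_Ntot j : (j <= m)%N -> (nn j <= Ntot)%N.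
Proof.
move=> jm; rewrite /Ntot (bigD1_seq j) ?mem_index_iota ?iota_uniq //=.
by rewrite leq_addr.
Qed.

Lemma size_Mrow i j : (i <= m)%N -> (j <= m)%N -> (size (Mrow i j) <= Ntot - nn j + (i == j))%N.
Proof.
move=> im jm; have := nn_gt0 jm; have := nn_le_Ntot jm; case: j jm => [|j] jm h1 h2 /=.
  rewrite (leq_trans (size_poly _ _)) //; have := Ntot_row im.
  by rewrite {2}/nrow [0 == i]eq_sym; case: (i == 0); lia.
rewrite (leq_trans (size_poly _ _)) //; have := @Ntot_shift i j.+1 im jm.
by rewrite {3}/nrow [j.+1 == i]eq_sym; case: (i == _); lia.
Qed.

Lemma nrow_id i : nrow i i = (nn i).-1.
Proof. by rewrite /nrow eqxx subn1. Qed.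

Lemma lead_Mrow i : (i <= m)%N -> (Mrow i i)`_(Ntot - nn i) != 0.
Proof.
move=> im; case: i im => [|i] im /=.
  have -> : (Ntot - nn 0 = qdeg m (nrow 0))%N.
    by have := Ntot_row im; have := nn_gt0 im; rewrite nrow_id; lia.
  by apply: lead_Qpoly.
have s0 : (0 < shift (nrow i.+1) i.+1)%N.
  by rewrite /shift nrow_id /nrow /=; have := nn_le im; have := nn_gt0 im; lia.
have -> : (Ntot - nn i.+1)%N = (qdeg m (nrow i.+1) + (shift (nrow i.+1) i.+1).-1)%N.
  by have := @Ntot_shift i.+1 i.+1 im im; have := nn_gt0 im; rewrite nrow_id; lia.
by apply: lead_Ppoly => // j; apply: nrowP.
Qed.

Definition Mmx : 'M[{poly F}]_m.+1 := \matrix_(i, j) Mrow i j.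
Definition Mrem i j : {poly F} :=
  if j is 0%N then Qpoly m a (nrow i) else
  - \sum_(Ntot <= k < qdeg m (nrow i) + Ntot) (Qpoly m a (nrow i) * Phi a j Ntot)`_k *: 'X^(k - Ntot).
(** It encodes the relations [P_j = Q * Phi_j + Mrem_j * 'X^Ntot] as a matrix product; its diagonal
    is [1, 'X^Ntot, ..., 'X^Ntot]. *)
Definition Tmx : 'M[{poly F}]_m.+1 := \matrix_(i, j)
  (if i == j then (if (j : nat) is 0%N then 1 else 'X^Ntot)
   else if (i : nat) is 0%N then Phi a j Ntot else 0).

Lemma Mmx_factor : Mmx = (\matrix_(i, j) Mrem i j) *m Tmx.
Proof.
apply/matrixP => i j; rewrite !mxE.
have im : (i <= m)%N by rewrite -ltnS.
have jm : (j <= m)%N by rewrite -ltnS.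
rewrite big_ord_recl !mxE /=; case: (unliftP ord0 j) => [j'|] jE; last first.
  rewrite jE eqxx /= mulr1 big1 ?addr0 // => k _.
  by rewrite !mxE /= mulr0.
have j0 : (ord0 == j) = false by rewrite jE.
rewrite j0 /= (bigD1 j') //= !mxE -jE eqxx big1 ?addr0; last first.
  move=> k kj; rewrite !mxE jE (inj_eq lift_inj) (negbTE kj) /= mulr0 //.
have jv : nat_of_ord j = (j').+1 by rewrite jE.
rewrite jv -{3}jv /=.
have jP : (1 <= j'.+1 <= m)%N by rewrite -jv jm jv.
have nP k : (1 <= k <= m)%N -> (nrow i k <= (nrow i 0).+1)%N by apply: nrowP.
rewrite (Ppoly_approx a_gt0 nP jP (_ : (_ <= Ntot)%N)) ?Ntot_row // /Mrem jv mulNr mulr_suml.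
have -> : \sum_(Ntot <= k < qdeg m (nrow i) + Ntot)
    (Qpoly m a (nrow i) * Phi a j'.+1 Ntot)`_k *: 'X^(k - Ntot) * 'X^Ntot =
  \sum_(Ntot <= k < qdeg m (nrow i) + Ntot) (Qpoly m a (nrow i) * Phi a j'.+1 Ntot)`_k *: 'X^k.
  rewrite !big_nat; apply: eq_bigr => k /andP[k1 _].
  by rewrite -scalerAl -exprD subnK.
by rewrite addrK.
Qed.

Lemma det_Tmx : \det Tmx = 'X^(m * Ntot).
Proof.
rewrite -det_tr det_trig; last first.
  apply/is_trig_mxP => i j ij; rewrite !mxE.
  rewrite [j == i]eq_sym -val_eqE /= (ltn_eqF ij).
  by case: (nat_of_ord j) ij.
rewrite big_ord_recl !mxE eqxx mul1r.
rewrite (eq_bigr (fun=> 'X^Ntot)); last by move=> i _; rewrite !mxE eqxx.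
by rewrite prodr_const card_ord -exprM mulnC.
Qed.

(* The determinant has degree at most [m * Ntot], with nonzero coefficient there, and is divisible
   by ['X^(m * Ntot)]: it is a nonzero monomial. *)
Lemma det_Mmx : exists2 c : F, c != 0 & \det Mmx = c *: 'X^(m * Ntot).
Proof.
have [] := @det_top F m.+1 Mmx (fun j : 'I_m.+1 => (Ntot - nn j)%N).
  by move=> i j; rewrite mxE; apply: size_Mrow; rewrite -ltnS.
have -> : (\sum_(j < m.+1) (Ntot - nn j) = m * Ntot)%N.
  have H : (\sum_(j < m.+1) (Ntot - nn j) + \sum_(j < m.+1) nn j = m.+1 * Ntot)%N.
    rewrite -big_split /= (eq_bigr (fun=> Ntot)); last first.
      by move=> j _; rewrite subnK // nn_le_Ntot // -ltnS.
    by rewrite sum_nat_const card_ord.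
  have : (\sum_(j < m.+1) nn j = Ntot)%N by rewrite /Ntot big_mkord.
  by lia.
move=> lead sz.
have lead0 : (\det Mmx)`_(m * Ntot) != 0.
  rewrite lead prodf_seq_neq0; apply/allP => i _ /=; rewrite mxE.
  by apply: lead_Mrow; rewrite -ltnS.
move: lead0 sz; rewrite Mmx_factor det_mulmx det_Tmx; set D := \det _.
rewrite coefMXn ltnn subnn => D0 sz; exists D`_0 => //.
have Dn0 : D != 0 by apply: contraNneq D0 => ->; rewrite coef0.
rewrite -mul_polyC -size1_polyC //; move: sz.
by rewrite size_mulXn // -addn1 leq_add2l.
Qed.

(** A nonzero monomial does not vanish at [x != 0], so the matrix is invertible there and maps the
    nonzero vector [ell] to a nonzero vector. *)
Lemma Mrow_neq0 (x : F) (ell : nat -> F) : x != 0 -> (exists2 i, (i <= m)%N & ell i != 0) ->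
  exists2 i, (i <= m)%N & \sum_(0 <= j < m.+1) (Mrow i j).[x] * ell j != 0.
Proof.
move=> x0 [k km lk]; have [c c0 dE] := det_Mmx.
pose A := map_mx (horner_eval x) Mmx.
have A1 : A \in unitmx.
  rewrite unitmxE unitfE det_map_mx dE /= horner_evalE hornerZ hornerXn.
  by rewrite mulf_neq0 // expf_neq0.
pose v := \col_(j < m.+1) ell j.
have v0 : v != 0.
  by apply: contraNneq lk => /matrixP/(_ (Ordinal (km : (k < m.+1)%N)) ord0); rewrite !mxE => /= ->.
have Av : A *m v != 0.
  by apply: contraNneq v0 => Av; rewrite -[v](mulKmx A1) Av mulmx0.
have [i iP] : exists i, (A *m v) i ord0 != 0.
  apply/existsP; apply: contraNT Av; rewrite negb_exists => /forallP h.
  apply/eqP/matrixP => i j; rewrite ord1 [RHS]mxE; apply/eqP.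
  by have := h i; rewrite negbK.
exists (nat_of_ord i); first by rewrite -ltnS.
rewrite big_mkord; move: iP; rewrite mxE; congr (_ != _).
by apply: eq_bigr => j _; rewrite !mxE.
Qed.

End Determinant.

(** * Factorials and products along arithmetic progressions *)

Lemma logn_fact_leq p n : prime p -> (logn p n`! <= n %/ p.-1)%N.
Proof.
move=> pp; have p1 : (1 < p)%N := prime_gt1 pp.
rewrite leq_divRL; last by lia.
rewrite logn_fact //.
(* The partial sums of Legendre's formula, times [p - 1], telescope against the last quotient,
   because [p * (n %/ p ^ K.+1) <= n %/ p ^ K]. *)
suff H K : ((\sum_(1 <= k < K.+1) n %/ p ^ k) * p.-1 + n %/ p ^ K <= n)%N.
  by apply: leq_trans (H n); rewrite leq_addr.
elim: K => [|K IH]; first by rewrite big_geq // expn0 divn1.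
rewrite big_nat_recr //= mulnDl.
have : (n %/ p ^ K.+1 * p <= n %/ p ^ K)%N by rewrite expnSr divnMA leq_trunc_div.
have E x : (x * p = x * p.-1 + x)%N by case: (p) p1 => // q _; rewrite mulnS addnC.
rewrite E.
by move: IH; lia.
Qed.

Lemma logn_prod (I : eqType) (r : seq I) (f : I -> nat) p : {in r, forall i, 0 < f i}%N ->
  logn p (\prod_(i <- r) f i) = (\sum_(i <- r) logn p (f i))%N.
Proof.
elim: r => [|i r IH] h; first by rewrite !big_nil logn1.
have hr : {in r, forall i, 0 < f i}%N by move=> j jr; apply: h; rewrite inE jr orbT.
rewrite !big_cons lognM ?IH //; first by apply: h; rewrite inE eqxx.
by rewrite big_seq prodn_cond_gt0.
Qed.

(* [epsilon s ^ n] with every prime power rounded down to an integer one *)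
Definition Epart s n : nat := \prod_(q <- primes s) q ^ (n %/ q.-1).

Lemma Epart_gt0 s n : (0 < Epart s n)%N.
Proof.
rewrite /Epart big_seq prodn_cond_gt0 // => q; rewrite mem_primes => /andP[qp _].
by rewrite expn_gt0 prime_gt0.
Qed.

Lemma logn_Epart p s n : prime p ->
  logn p (Epart s n) = (if p \in primes s then n %/ p.-1 else 0)%N.
Proof.
move=> pp; rewrite /Epart logn_prod; last first.
  by move=> q; rewrite mem_primes => /andP[qp _]; rewrite expn_gt0 prime_gt0.
have E q : q \in primes s -> logn p (q ^ (n %/ q.-1)) = ((q == p) * (n %/ p.-1))%N.
  rewrite mem_primes => /andP[qp _]; rewrite lognX logn_prime // eq_sym.
  by case: eqP => [->|_]; rewrite ?muln1 ?mul1n ?muln0.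
case: ifP => ps.
  rewrite (bigD1_seq p) ?primes_uniq //= E // eqxx mul1n big_seq_cond big1 ?addn0 //.
  by move=> q /andP[qs /negbTE qp]; rewrite E // qp.
rewrite big_seq big1 // => q qs; rewrite E //.
by case: eqP => // qp; rewrite qp ps in qs.
Qed.

Lemma Epart_dvdD s i k n : (i + k <= n)%N -> (Epart s i * Epart s k %| Epart s n)%N.
Proof.
move=> ikn; rewrite /Epart -big_split /=; apply: (big_ind2 (fun x y => x %| y)%N) => //.
  by move=> *; apply: dvdn_mul.
move=> q _; rewrite -expnD; apply: dvdn_exp2l.
case: (posnP q.-1) => [->|q0]; first by rewrite !divn0.
rewrite leq_divRL // mulnDl (leq_trans _ ikn) // leq_add ?leq_trunc_div //.
Qed.

Lemma fact_dvd_prod w n : (n`! %| \prod_(t < n) (w + t))%N.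
Proof.
have -> : (\prod_(t < n) (w + t) = (w + n).-1 ^_ n)%N; last first.
  by rewrite -bin_ffact dvdn_mull.
rewrite ffact_prod (reindex_inj rev_ord_inj) /=; apply: eq_bigr => i _; have := ltn_ord i; lia.
Qed.

(** Modulo [c] the step [s] has an inverse [u]. So the product is congruent to [s ^ n] times a
    product of [n] consecutive integers, which is divisible by [n!]; they start at the residue [w]
    of [u * x], taken natural so that binomial coefficients apply. *)
Lemma dvdz_prod_shift (c s : nat) (x : int) n : coprime s c -> (0 < c)%N -> (c %| n`!)%N ->
  (c%:Z %| \prod_(t < n) (x + (s * t)%:Z))%Z.
Proof.
move=> cop c0 cn; have [u [v uv]] := Bezoutz s c.
have {}uv : u * s%:Z + v * c%:Z = 1 by rewrite uv /gcdz !absz_nat (eqP cop).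
pose w := `|((u * x) %% c)%Z|%N.
have wE : w%:Z = u * x - ((u * x) %/ c)%Z * c.
  by rewrite /w gez0_abs ?modz_ge0 // -?lt0n // {2}(divz_eq (u * x) c) addrC addKr.
pose k := v * x + s%:Z * ((u * x) %/ c)%Z.
have kE t : x + (s * t)%:Z = s%:Z * (w + t)%:Z + c%:Z * k.
  rewrite PoszD PoszM mulrDr wE /k -[x in LHS]mul1r -uv; ring.
have H : (c%:Z %| \prod_(t < n) (x + (s * t)%:Z) - \prod_(t < n) (s%:Z * (w + t)%:Z))%Z.
  elim: n {cn} => [|n IH]; first by rewrite !big_ord0 subrr.
  rewrite !big_ord_recr /= kE.
  move: IH; set A := \prod_(_ < _) _; set B := \prod_(_ < _) _ => IH.
  have -> : A * (s%:Z * (w + n)%:Z + c%:Z * k) - B * (s%:Z * (w + n)%:Z) =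
     (A - B) * (s%:Z * (w + n)%:Z) + c%:Z * (A * k) by ring.
  by apply: rpredD; rewrite dvdz_mulr.
have B0 : (c%:Z %| \prod_(t < n) (s%:Z * (w + t)%:Z))%Z.
  rewrite big_split /= dvdz_mull // -(big_morph _ PoszM (erefl _)).
  by rewrite dvdzE !absz_nat (dvdn_trans cn) // fact_dvd_prod.
by rewrite -[X in (_ %| X)%Z](subrK (\prod_(t < n) (s%:Z * (w + t)%:Z))); apply: rpredD.
Qed.

(** Prime by prime: if [p] divides [sl], then [Epart] alone contains enough factors [p]; any other
    [p] is prime to [s], and the product contains enough of them. *)
Lemma fact_dvd_Epart (s sl : nat) (x : int) n : (0 < sl)%N -> (s %| sl)%N ->
  (n`!%:Z %| (Epart sl n)%:Z * \prod_(t < n) (x + (s * t)%:Z))%Z.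
Proof.
move=> sl0 ssl; set Z := \prod_(_ < _) _.
rewrite dvdzE abszM !absz_nat; apply/dvdn_partP => [|p]; first exact: fact_gt0.
rewrite mem_primes => /andP[pp _]; rewrite p_part.
have [psl|psl] := boolP (p \in primes sl).
  apply: dvdn_mulr; rewrite pfactor_dvdn ?Epart_gt0 // logn_Epart // psl.
  exact: logn_fact_leq.
apply: dvdn_mull.
have := @dvdz_prod_shift (p ^ logn p n`!) s x n; rewrite dvdzE absz_nat; apply.
- rewrite coprimeXr // coprime_sym prime_coprime //; apply: contra psl => ps.
  by rewrite mem_primes pp sl0 (dvdn_trans ps).
- by rewrite expn_gt0 prime_gt0.
- by rewrite pfactor_dvdnn.
Qed.

(** The least common multiple of [1, ..., X], written as a product over primes because its size is
    estimated through the number of these primes. *)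
Definition Llcm X : nat := \prod_(q < X.+1 | prime q) q ^ trunc_log q X.

Lemma Llcm_gt0 X : (0 < Llcm X)%N.
Proof. by rewrite prodn_cond_gt0 // => q qp; rewrite expn_gt0 prime_gt0. Qed.

Lemma logn_Llcm p X : prime p -> logn p (Llcm X) = trunc_log p X.
Proof.
move=> pp; rewrite /Llcm -big_filter.
rewrite logn_prod; last by move=> q; rewrite mem_filter => /andP[qp _]; rewrite expn_gt0 prime_gt0.
have E (q : 'I_X.+1) : prime q ->
    logn p (q ^ trunc_log q X) = (((q : nat) == p) * trunc_log p X)%N.
  move=> qp; rewrite lognX logn_prime // eq_sym.
  by case: eqP => [->|_]; rewrite ?muln1 ?mul1n ?muln0.
rewrite big_filter (eq_bigr _ E) -big_distrl /=.
have [pX|pX] := ltnP p X.+1.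
  rewrite (bigD1 (Ordinal pX)) //= eqxx big1 ?addn0 ?mul1n //.
  by move=> q /andP[_ /negbTE qp]; rewrite -val_eqE /= in qp; rewrite qp.
have -> : trunc_log p X = 0%N; last by rewrite muln0.
case: (posnP X) => [->|X0]; first by rewrite trunc_log0.
by apply: trunc_log_eq (prime_gt1 pp) _; rewrite expn0 expn1 X0 pX.
Qed.

Lemma dvdn_Llcm i X : (0 < i <= X)%N -> (i %| Llcm X)%N.
Proof.
move=> /andP[i0 iX]; apply/dvdn_partP => // p; rewrite mem_primes => /andP[pp _].
rewrite p_part pfactor_dvdn ?Llcm_gt0 // logn_Llcm //; apply: trunc_log_max (prime_gt1 pp) _.
by rewrite (leq_trans _ iX) // dvdn_leq // pfactor_dvdnn.
Qed.

(* Over the rationals this is the partial fraction expansion of [1 / \prod_(t <= n) (u + v * t)]. *)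
Lemma prod_dvd_fact_lcm (u v L n : nat) : (0 < u)%N -> (forall t, (t <= n)%N -> u + v * t %| L)%N ->
  ((\prod_(t < n.+1) (u + v * t))%N%:Z %| (n`! * v ^ n * L)%:Z)%Z.
Proof.
elim: n u => [|n IH] u u0 h.
  by rewrite big_ord1 muln0 addn0 !mul1n; have := h 0 (leqnn 0); rewrite muln0 addn0 dvdzE.
have /dvdzP[k1 E1] := IH u u0 (fun t tn => h t (leqW tn)).
have /dvdzP[k2 E2] : ((\prod_(t < n.+1) (u + v + v * t))%N%:Z %| (n`! * v ^ n * L)%:Z)%Z.
  by apply: IH => [|t tn]; rewrite ?addn_gt0 ?u0 // -addnA -mulnS; apply: h.
(* Difference of the results for the first and for the last [n + 1] factors: the two end factors
   differ by [v * n.+1], the quotient of the new multiplier by the old one. *)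
apply/dvdzP; exists (k1 - k2).
have E3 : (\prod_(t < n.+2) (u + v * t) = \prod_(t < n.+1) (u + v * t) * (u + v * n.+1))%N.
  by rewrite big_ord_recr.
have E4 : (\prod_(t < n.+2) (u + v * t) = u * \prod_(t < n.+1) (u + v + v * t))%N.
  rewrite big_ord_recl muln0 addn0; congr (_ * _)%N; apply: eq_bigr => t _.
  by rewrite -addnA -mulnS.
have F1 : k1 * (\prod_(t < n.+2) (u + v * t))%N%:Z = (n`! * v ^ n * L)%:Z * (u + v * n.+1)%:Z.
  by rewrite E3 PoszM mulrA -E1.
have F2 : k2 * (\prod_(t < n.+2) (u + v * t))%N%:Z = u%:Z * (n`! * v ^ n * L)%:Z.
  by rewrite E4 PoszM mulrCA -E2.
rewrite mulrBl F1 F2 factS expnS !(PoszM, PoszD); ring.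
Qed.

(** * Common denominators of the coefficients *)

Section IntegralCoefficients.
Variables (F : archiRealFieldType) (m : nat) (r s u v : nat -> nat) (sl dt U V : nat).

Lemma rfact_frac (x : int) (d n : nat) : (0 < d)%N ->
  d%:R ^+ n * rfact (x%:~R / d%:R : F) n = (\prod_(t < n) (x + (d * t)%:Z))%:~R.
Proof.
move=> d0; have dn : d%:R != 0 :> F by rewrite pnatr_eq0 -lt0n.
elim: n => [|n IH]; first by rewrite rfact0 !big_ord0 expr0 mulr1.
rewrite rfactS exprS big_ord_recr /= intrM -IH.
have -> : (x + (d * n)%:Z)%:~R = d%:R * (x%:~R / d%:R + n%:R) :> F.
  by rewrite intrD PoszM intrM -!pmulrn mulrDr mulrCA divff // mulr1.
ring.
Qed.

Lemma int_dvdz_div (c : nat) (z : int) : (0 < c)%N -> (c%:Z %| z)%Z ->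
  (z%:~R / c%:R : F) \is a Num.int.
Proof.
move=> c0 /dvdzP[k ->]; rewrite intrM -[c%:~R]pmulrn mulfK ?intr_int //.
by rewrite pnatr_eq0 -lt0n.
Qed.

Lemma rbin_int (t : nat) (x : int) (d n : nat) : (0 < t)%N -> (0 < d)%N -> (d %| t)%N ->
  ((d ^ n * Epart t n)%N%:R * rbin (x%:~R / d%:R) n : F) \is a Num.int.
Proof.
move=> t0 d0 dt'.
have -> : (d ^ n * Epart t n)%N%:R * rbin (x%:~R / d%:R) n =
   ((Epart t n)%:Z * \prod_(t < n) (x + (d * t)%:Z))%:~R / n`!%:R :> F.
  rewrite /rbin natrM natrX intrM -rfact_frac // -[(Epart t n)%:~R]pmulrn; ring.
by apply: int_dvdz_div; rewrite ?fact_gt0 // fact_dvd_Epart.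
Qed.

Hypothesis sl_gt0 : (0 < sl)%N.

Definition nat_frac (j : nat) : F := (r j)%:R / (s j)%:R.
Notation alpha := nat_frac.
(** Common denominator of the series coefficients of degree at most [k]: [dt] is for the ratios
    [v_j / s_j], [Llcm] for the factors [u_j + v_j t], and [Epart] for the factorial that the
    partial fractions leave behind. *)
Definition Wden k : nat := dt ^ k * Epart sl k * Llcm (U + V * k).

Hypothesis s_gt0 : forall j, (j <= m)%N -> (0 < s j)%N.
Hypothesis u_gt0 : forall j, (1 <= j <= m)%N -> (0 < u j)%N.
Hypothesis v_gt0 : forall j, (1 <= j <= m)%N -> (0 < v j)%N.
Hypothesis uvE : forall j, (1 <= j <= m)%N -> alpha j + alpha 0 = (u j)%:R / (v j)%:R.
Hypothesis uv_coprime : forall j, (1 <= j <= m)%N -> coprime (u j) (v j).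
Hypothesis s_dt : forall j, (1 <= j <= m)%N -> (s j %| dt * v j)%N.
Hypothesis s_sl : forall j, (1 <= j <= m)%N -> (s j %| sl)%N.
Hypothesis u_le : forall j, (1 <= j <= m)%N -> (u j <= U)%N.
Hypothesis v_le : forall j, (1 <= j <= m)%N -> (v j <= V)%N.

(** Partial fractions bound the denominator by a factorial, a power of [v j] and the lcm. The power
    of [v j] drops out, since [u j] is prime to [v j]; the factorial divides the numerator times
    [Epart]. *)
Lemma prod_uv_dvd j k X : (1 <= j <= m)%N -> (U + V * k <= X)%N ->
  (\prod_(t < k) (u j + v j * t) %| Epart sl k * Llcm X * \prod_(t < k) (r j + s j * t))%N.
Proof.
move=> jP kX; case: k kX => [|k] kX; first by rewrite big_ord0 dvd1n.
set P := (\prod_(t < _) (u j + _))%N; set Q := (\prod_(t < _) (r j + _))%N.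
have h1 : (P %| k`! * v j ^ k * Llcm X)%N.
  have := @prod_dvd_fact_lcm (u j) (v j) (Llcm X) k (u_gt0 jP).
  rewrite dvdzE !absz_nat; apply => t tk; apply: dvdn_Llcm.
  have := u_gt0 jP; have := u_le jP; have := v_le jP => h1 h2 h3.
  have : (v j * t <= V * k)%N by apply: leq_mul.
  by move: kX; rewrite mulnS; lia.
have cop : coprime P (v j ^ k).
  apply: coprimeXr; rewrite coprime_sym; apply: (big_ind (fun x => coprime (v j) x)).
  - exact: coprimen1.
  - by move=> x y cx cy; rewrite coprimeMr cx.
  by move=> t _; rewrite /coprime addnC mulnC gcdnMDl gcdnC; apply: uv_coprime.
have h2 : (P %| k.+1`! * Llcm X)%N.
  have : (P %| v j ^ k * (k`! * Llcm X))%N by rewrite mulnCA mulnA in h1 *.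
  by rewrite Gauss_dvdr // => h2; rewrite factS -mulnA dvdn_mull.
have h3 : (k.+1`! %| Epart sl k.+1 * Q)%N.
  have := @fact_dvd_Epart (s j) sl (r j)%:Z k.+1 sl_gt0 (s_sl jP).
  rewrite dvdzE abszM !absz_nat (_ : \prod_(t < k.+1) _ = Q%:Z) ?absz_nat //.
  by rewrite /Q (big_morph _ PoszM (erefl _)); apply: eq_bigr => t _; rewrite PoszD.
by rewrite mulnAC (dvdn_trans h2) // dvdn_mul.
Qed.

Lemma fcoef_int j k n : (1 <= j <= m)%N -> (k <= n)%N ->
  ((Wden n)%:R * fcoef alpha j k) \is a Num.int.
Proof.
move=> jP kn.
have jm : (j <= m)%N by case/andP: jP.
have sn0 : (s j)%:R != 0 :> F by rewrite pnatr_eq0 -lt0n s_gt0.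
have vn0 : (v j)%:R != 0 :> F by rewrite pnatr_eq0 -lt0n v_gt0.
have [e eE] := dvdnP (s_dt jP).
have [f fE] : exists f, (Epart sl n = f * Epart sl k)%N.
  by apply/dvdnP; have := @Epart_dvdD sl 0 k n; rewrite add0n => /(_ kn); apply: dvdn_trans; rewrite dvdn_mull.
set P := (\prod_(t < k) (u j + v j * t))%N; set Q := (\prod_(t < k) (r j + s j * t))%N.
have [g gE] : exists g, (Epart sl k * Llcm (U + V * n) * Q = g * P)%N.
  by apply/dvdnP; apply: prod_uv_dvd; rewrite // leq_add2l leq_mul2l kn orbT.
have PN : P%:R != 0 :> F.
  by rewrite pnatr_eq0 -lt0n prodn_gt0 // => t; rewrite addn_gt0 u_gt0.
have nat_frac (x d : nat) : (0 < d)%N ->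
    rfact (x%:R / d%:R : F) k = (\prod_(t < k) (x + d * t))%N%:R / d%:R ^+ k.
  move=> d0; have dn : d%:R ^+ k != 0 :> F by rewrite expf_neq0 // pnatr_eq0 -lt0n.
  apply: (mulfI dn); rewrite [x%:R]pmulrn rfact_frac // mulrCA divff // mulr1.
  by rewrite [RHS]pmulrn (big_morph _ PoszM (erefl _)).
suff -> : (Wden n)%:R * fcoef alpha j k = (dt ^ (n - k) * e ^ k * f * g)%N%:R :> F by exact: natr_int.
rewrite /fcoef uvE // /alpha !nat_frac ?s_gt0 ?v_gt0 // -/P -/Q /Wden fE.
have -> : (dt ^ n = dt ^ (n - k) * dt ^ k)%N by rewrite -expnD subnK.
have E1 : dt%:R ^+ k * (v j)%:R ^+ k = e%:R ^+ k * (s j)%:R ^+ k :> F.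
  by rewrite -!exprMn -!natrM eE.
have E2 : (Epart sl k)%:R * (Llcm (U + V * n))%:R * Q%:R = g%:R * P%:R :> F.
  by rewrite -!natrM gE.
have sk0 : (s j)%:R ^+ k != 0 :> F by rewrite expf_neq0.
have vk0 : (v j)%:R ^+ k != 0 :> F by rewrite expf_neq0.
rewrite !natrM !natrX.
transitivity (dt%:R ^+ (n - k) * (dt%:R ^+ k * (v j)%:R ^+ k) * f%:R *
   ((Epart sl k)%:R * (Llcm (U + V * n))%:R * Q%:R) / ((s j)%:R ^+ k * P%:R) : F).
  by field; rewrite sk0 vk0 PN.
rewrite E1 E2; field; by rewrite sk0 PN.
Qed.

Variable nn : nat -> nat.
(** The factors with [s 0] serve both [rbin] of [qcoef] at once: their indices add up to at most
    [qdeg], so one [Epart] covers both by [Epart_dvdD]. The product serves [Gval]. *)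
Definition qden : nat := s 0 ^ qdeg m nn * Epart (s 0) (qdeg m nn) *
  \prod_(1 <= j < m.+1) (s j ^ nn j * Epart sl (nn j)).

Hypothesis s0_gt0 : (0 < s 0)%N.

Lemma qc_int l : (l <= qdeg m nn)%N -> ((qden)%:R * qc m alpha nn l) \is a Num.int.
Proof.
move=> lq; rewrite /qc /qcoef mulr_sumr rpred_sum // => i _.
have il : (i <= l)%N by rewrite -ltnS.
have s0n : (s 0)%:R != 0 :> F by rewrite pnatr_eq0 -lt0n.
set q := qdeg m nn in lq *.
have [e eE] : exists e, (Epart (s 0) q = e * (Epart (s 0) (l - i) * Epart (s 0) i))%N.
  by apply/dvdnP/Epart_dvdD; rewrite subnK.
have sE : (s 0 ^ q = s 0 ^ (q - l) * (s 0 ^ (l - i) * s 0 ^ i))%N.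
  by rewrite -!expnD; congr (_ ^ _)%N; lia.
(* The numerators, over [s 0], of the two arguments of [rbin] in [qcoef]. *)
pose x1 := (r 0)%:Z - (s 0)%:Z; pose x2 := (s 0)%:Z - (r 0)%:Z - (q * s 0)%:Z.
have x1E : alpha 0 - 1 = x1%:~R / (s 0)%:R.
  by rewrite /x1 intrB mulrBl divff.
have x2E : 1 - alpha 0 - q%:R = x2%:~R / (s 0)%:R.
  by rewrite /x2 !intrB !mulrBl divff // PoszM intrM -!pmulrn mulfK.
have I1 : ((s 0 ^ q * Epart (s 0) q)%N%:R * (rbin (alpha 0 - 1) (l - i) * rbin (1 - alpha 0 - q%:R) i))
    \is a Num.int.
  rewrite eE sE x1E x2E.
  have -> (y z : F) : (s 0 ^ (q - l) * (s 0 ^ (l - i) * s 0 ^ i) *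
     (e * (Epart (s 0) (l - i) * Epart (s 0) i)))%N%:R * (y * z) =
    (s 0 ^ (q - l) * e)%N%:R * ((s 0 ^ (l - i) * Epart (s 0) (l - i))%N%:R * y *
      ((s 0 ^ i * Epart (s 0) i)%N%:R * z)) by rewrite !natrM; ring.
  rewrite rpredM ?natr_int // rpredM //.
    exact: rbin_int.
  exact: rbin_int.
have I2 : ((\prod_(1 <= j < m.+1) (s j ^ nn j * Epart sl (nn j)))%N%:R * Gval m alpha nn i)
    \is a Num.int.
  rewrite natr_prod /Gval -big_split /= big_seq rpred_prod // => j.
  rewrite mem_index_iota => jP.
  have sn : (s j)%:R != 0 :> F by rewrite pnatr_eq0 -lt0n s_gt0 //; case/andP: jP.
  have -> : alpha j + (shift nn j)%:R + i%:R =
     ((r j)%:Z + (s j * (shift nn j + i))%:Z)%:~R / (s j)%:R.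
    by rewrite intrD PoszM intrM -!pmulrn natrD /alpha; field.
  by apply: rbin_int; rewrite ?s_sl ?s_gt0 //; case/andP: jP.
rewrite /qden -/q natrM.
set A := (_ * _)%N%:R; set B := (\prod_(_ <= _ < _) _)%N%:R; set y := rbin _ _; set z := rbin _ _.
have -> : A * B * (y * z * Gval m alpha nn i) = (A * (y * z)) * (B * Gval m alpha nn i) by ring.
by rewrite rpredM.
Qed.

End IntegralCoefficients.

(** * Divisibility by powers of p, and the growth of the denominators *)

Section PadicDivisibility.
Variables (F : archiRealFieldType) (p : nat).
Hypothesis p_prime : prime p.

(** Membership in [p ^ e] times the localization of the integers at [p], expressed through a
    cofactor [c] prime to [p] because [F] carries no p-adic valuation. *)
Definition padic_dvd e (x : F) :=
  exists2 c : nat, ~~ (p %| c)%N & (c%:R * x / p%:R ^+ e) \is a Num.int.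

Lemma padic_dvd0 e : padic_dvd e 0.
Proof. by exists 1%N; rewrite ?mulr0 ?mul0r // dvdn1 neq_ltn prime_gt1 // orbT. Qed.

Lemma padic_dvdD e x y : padic_dvd e x -> padic_dvd e y -> padic_dvd e (x + y).
Proof.
move=> [c pc cx] [d pd dy]; exists (c * d)%N; first by rewrite Euclid_dvdM // negb_or pc.
have -> : (c * d)%N%:R * (x + y) / p%:R ^+ e =
  d%:R * (c%:R * x / p%:R ^+ e) + c%:R * (d%:R * y / p%:R ^+ e) by rewrite natrM; ring.
by rewrite rpredD // rpredM // natr_int.
Qed.

Lemma padic_dvd_sum e (I : eqType) (t : seq I) (f : I -> F) :
  {in t, forall i, padic_dvd e (f i)} -> padic_dvd e (\sum_(i <- t) f i).
Proof.
move=> h; rewrite big_seq; apply: (big_ind (padic_dvd e)) => //; first exact: padic_dvd0.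
exact: padic_dvdD.
Qed.

Lemma padic_dvdMl e x y : x \is a Num.int -> padic_dvd e y -> padic_dvd e (x * y).
Proof.
move=> xi [c pc cy]; exists c => //.
have -> : c%:R * (x * y) / p%:R ^+ e = x * (c%:R * y / p%:R ^+ e) by rewrite !mulrA [c%:R * x]mulrC.
by rewrite rpredM.
Qed.

Lemma padic_dvd_div e x (b : nat) k : ~~ (p %| b)%N -> padic_dvd e x -> padic_dvd e (x / b%:R ^+ k).
Proof.
move=> pb [c pc cx]; exists (c * b ^ k)%N; first by rewrite Euclid_dvdM // Euclid_dvdX // (negbTE pc) (negbTE pb).
have b0 : b%:R ^+ k != 0 :> F.
  by rewrite expf_neq0 // pnatr_eq0; apply: contraNneq pb => ->; rewrite dvdn0.
have p0 : p%:R ^+ e != 0 :> F by rewrite expf_neq0 // pnatr_eq0 -lt0n prime_gt0.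
rewrite (_ : _ / p%:R ^+ e = c%:R * x / p%:R ^+ e) // natrM natrX.
by move: p0 b0; move: (p%:R ^+ e) (b%:R ^+ k) => y z p0 b0; field; rewrite p0 b0.
Qed.

Lemma padic_dvd_logn e (W : nat) (y : int) (f : F) : (0 < W)%N -> W%:R * f \is a Num.int ->
  y != 0 -> (logn p W + e <= logn p `|y|%N)%N -> padic_dvd e (y%:~R * f).
Proof.
move=> W0 Wf y0 h.
have [c pc WE] := pfactor_coprime p_prime W0.
exists c; first by rewrite -prime_coprime.
have : (p ^ (logn p W + e) %| `|y|)%N by rewrite pfactor_dvdn // absz_gt0.
rewrite -[X in (X %| _)%N]absz_nat -dvdzE => /dvdzP[z ->].
have p0 : p%:R ^+ e != 0 :> F by rewrite expf_neq0 // pnatr_eq0 -lt0n prime_gt0.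
have -> : c%:R * ((z * (p ^ (logn p W + e))%N%:Z)%:~R * f) / p%:R ^+ e = z%:~R * (W%:R * f).
  rewrite [W in RHS]WE intrM -pmulrn expnD !natrM !natrX.
  by move: (p%:R ^+ e) p0 => P p0; field.
by rewrite rpredM ?intr_int.
Qed.

Lemma trunc_log_mul (X X' i : nat) : (0 < X)%N -> (X' <= X * p ^ i)%N ->
  (trunc_log p X' <= trunc_log p X + i)%N.
Proof.
move=> X0 h; have p1 := prime_gt1 p_prime.
have [->|X'0] := posnP X'; first by rewrite trunc_log0.
rewrite -ltnS -(ltn_exp2l _ _ p1) (leq_ltn_trans (trunc_logP p1 X'0)) //.
rewrite (leq_ltn_trans h) // -addSn expnD ltn_pmul2r ?expn_gt0 ?prime_gt0 //.
exact: trunc_log_ltn.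
Qed.

Variables (sl dt U V : nat).

Lemma Wden_gt0 k : (0 < dt)%N -> (0 < Wden sl dt U V k)%N.
Proof. by move=> h; rewrite /Wden !muln_gt0 expn_gt0 h Epart_gt0 Llcm_gt0. Qed.

Lemma logn_Wden k : (0 < dt)%N -> logn p (Wden sl dt U V k) =
  (k * logn p dt + (if p \in primes sl then k %/ p.-1 else 0) + trunc_log p (U + V * k))%N.
Proof.
move=> dt0; rewrite /Wden !lognM ?muln_gt0 ?expn_gt0 ?dt0 ?Epart_gt0 ?Llcm_gt0 //.
by rewrite lognX logn_Epart // logn_Llcm.
Qed.

(** Let [k = N + j]. The powers of [dt] use at most [j * logn p sl] of [j * va]. If [p] divides
    [sl], the rest has to pay for [Epart] and for the logarithmic term. For [p >= 3] these grow by
    about [j / 2] each, and one unit per degree is enough; for [p = 2] they can grow by [j] each,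
    which is why two units are assumed there. If [p] does not divide [sl], only the logarithmic term
    grows. The final [1] is the rounding of [(N + j) / (p - 1)]. *)
Lemma logn_Wden_leq N k va : (0 < dt)%N -> (0 < sl)%N -> (0 < V)%N -> (0 < N)%N -> (N <= k)%N ->
  (logn p dt <= logn p sl)%N -> (logn p sl < va)%N ->
  (p = 2%N -> 2 %| sl -> logn p sl + 2 <= va)%N ->
  (logn p (Wden sl dt U V k) + N * va <= logn p (Wden sl dt U V N) + k * va + 1)%N.
Proof.
move=> dt0 sl0 V0 N0 Nk h1 h2 h3; rewrite !logn_Wden //.
have p1 := prime_gt1 p_prime.
have [j kE] : exists j, k = (N + j)%N by exists (k - N)%N; rewrite subnKC.
rewrite {}kE {Nk k}.
(* From [U + V * (N + j) <= (U + V * N) * (j + 1)]. *)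
have TL i : (j.+1 <= p ^ i)%N ->
    (trunc_log p (U + V * (N + j)) <= trunc_log p (U + V * N) + i)%N.
  move=> hi; apply: trunc_log_mul; first by rewrite addn_gt0 muln_gt0 V0 N0 orbT.
  rewrite (@leq_trans ((U + V * N) * j.+1)) ?leq_mul2l ?hi ?orbT //.
  by rewrite mulnDr mulnS addnA leq_add2l leq_mul2r (leq_trans _ (leq_addl _ _)) ?orbT // leq_pmulr.
have J2 : (j.+1 <= p ^ j)%N := ltn_expl j p1.
have [psl|psl] := boolP (p \in primes sl).
  have [p2|p2] := eqVneq p 2%N.
    have d2 : (2 %| sl)%N by move: psl; rewrite p2 mem_primes => /and3P[].
    have := h3 p2 d2; have := TL _ J2; rewrite p2 /= !divn1 => A B.
    rewrite p2 in h1 h2; nia.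
  have p3 : (2 <= p.-1)%N by move: p1 p2; lia.
  have T3 i : (i.*2.+1 <= 3 ^ i)%N.
    by elim: i => // i IH; rewrite expnS doubleS; lia.
  have J3 : (j.+1 <= p ^ uphalf j)%N.
    rewrite (@leq_trans (3 ^ uphalf j)) //; last first.
      by case: (uphalf j) => // i; rewrite leq_exp2r //; lia.
    by rewrite (leq_trans _ (T3 _)) // ltnS -[X in (X <= _)%N]odd_double_half uphalf_half doubleD leq_add2r; case: (odd j).
  have D3 : ((N + j) %/ p.-1 <= N %/ p.-1 + j./2 + 1)%N.
    rewrite -ltnS ltn_divLR; last by lia.
    have := ltn_ceil N (ltnW p3); have : (j < (j./2 + 1).*2)%N.
      by rewrite -[X in (X < _)%N]odd_double_half doubleD; case: (odd j); lia.
    move: (N %/ p.-1)%N (j./2) => x y hj hN; nia.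
  have UH : (uphalf j + j./2 = j)%N by rewrite uphalf_half -{4}(odd_double_half j) -addnn addnA.
  have : (j * (logn p dt).+1 <= j * va)%N by rewrite leq_mul2l; lia.
  by have := TL _ J3; rewrite !mulnDl mulnS; lia.
have := TL _ J2.
have l0 : logn p sl = 0%N.
  by apply/eqP; rewrite -leqn0 leqNgt logn_gt0.
rewrite l0 in h1 h2; have -> : logn p dt = 0%N by lia.
nia.
Qed.

End PadicDivisibility.

(** * The integral linear form and its p-adic remainder *)

Section LinearForm.
Variables (F : archiRealFieldType) (m : nat) (r s u v : nat -> nat) (sl dt U V : nat).
Notation alpha := (nat_frac F r s).
Notation W := (Wden sl dt U V).
Hypothesis sl_gt0 : (0 < sl)%N.
Hypothesis dt_gt0 : (0 < dt)%N.
Hypothesis V_gt0 : (0 < V)%N.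
Hypothesis r_gt0 : forall j, (j <= m)%N -> (0 < r j)%N.
Hypothesis s_gt0 : forall j, (j <= m)%N -> (0 < s j)%N.
Hypothesis u_gt0 : forall j, (1 <= j <= m)%N -> (0 < u j)%N.
Hypothesis v_gt0 : forall j, (1 <= j <= m)%N -> (0 < v j)%N.
Hypothesis uvE : forall j, (1 <= j <= m)%N -> alpha j + alpha 0 = (u j)%:R / (v j)%:R.
Hypothesis uv_coprime : forall j, (1 <= j <= m)%N -> coprime (u j) (v j).
Hypothesis s_dt : forall j, (1 <= j <= m)%N -> (s j %| dt * v j)%N.
Hypothesis s_sl : forall j, (1 <= j <= m)%N -> (s j %| sl)%N.
Hypothesis u_le : forall j, (1 <= j <= m)%N -> (u j <= U)%N.
Hypothesis v_le : forall j, (1 <= j <= m)%N -> (v j <= V)%N.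
Hypothesis alpha_nint : forall i j, (1 <= i <= m)%N -> (1 <= j <= m)%N -> i != j ->
  forall x y : nat, alpha i + x%:R != alpha j + y%:R.

Lemma alpha_gt0 j : (j <= m)%N -> 0 < alpha j.
Proof. by move=> jm; rewrite /alpha divr_gt0 // ltr0n ?r_gt0 ?s_gt0. Qed.

Variable nn : nat -> nat.
Hypothesis nn_gt0 : forall j, (j <= m)%N -> (0 < nn j)%N.
Hypothesis nn_le : forall j, (j <= m)%N -> (nn j <= nn 0)%N.
Variable i : nat.
Hypothesis im : (i <= m)%N.
Notation N := (Ntot m nn).
Notation row := (nrow nn i).
Notation Q := (Qpoly m alpha row).
Notation P := (Ppoly m alpha row).
Notation qd := (qden m s sl row).

Lemma Qpoly_coef_int k : (qd%:R * Q`_k) \is a Num.int.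
Proof.
rewrite coef_poly; case: ifP => _; last by rewrite mulr0 rpred0.
by apply: qc_int; rewrite ?leq_subr // s_gt0.
Qed.

Lemma Ppoly_coef_int j k : (1 <= j <= m)%N -> ((qd * W N)%:R * (P j)`_k) \is a Num.int.
Proof.
move=> jP; rewrite coef_poly; case: ifP => hk; last by rewrite mulr0 rpred0.
rewrite mulr_sumr rpred_sum // => l _.
have kN : (k - l <= N)%N.
  rewrite -(Ntot_shift nn_gt0 nn_le im jP); rewrite (leq_trans (leq_subr _ _)) //.
  by rewrite (leq_trans (ltnW hk)) // leq_addr.
rewrite natrM mulrACA rpredM ?Qpoly_coef_int //.
exact: (fcoef_int sl_gt0 s_gt0 u_gt0 v_gt0 uvE uv_coprime s_dt s_sl u_le v_le).
Qed.

Variables (a : int) (b : nat).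
Hypothesis b_gt0 : (0 < b)%N.
Notation beta := (a%:~R / b%:R : F).

Lemma horner_int (K M : nat) (R : {poly F}) : (size R <= M.+1)%N ->
  (forall k, (K%:R * R`_k) \is a Num.int) -> ((K * b ^ M)%N%:R * R.[beta]) \is a Num.int.
Proof.
move=> sR h; rewrite horner_coef mulr_sumr rpred_sum // => k _.
have kM : (k <= M)%N by rewrite -ltnS (leq_trans (ltn_ord k)).
have b0 : b%:R ^+ k != 0 :> F by rewrite expf_neq0 // pnatr_eq0 -lt0n.
have -> : (K * b ^ M)%N%:R * (R`_k * beta ^+ k) =
   (K%:R * R`_k) * (b ^ (M - k))%N%:R * a%:~R ^+ k.
  rewrite -{1}(subnK kM) expnD !natrM !natrX expr_div_n.
  by move: (b%:R ^+ k) b0 (b%:R ^+ (M - k)) (a%:~R ^+ k) => x x0 y z; field.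
by rewrite rpredM ?rpredX ?intr_int // rpredM ?natr_int.
Qed.

Variable ell : nat -> int.
Definition den : nat := qd * W N * b ^ N.
Definition formA : F := den%:R * \sum_(0 <= j < m.+1) (Mrow m alpha nn i j).[beta] * (ell j)%:~R.
Definition formB : F := den%:R * Q.[beta].
Definition Lam T : F := (ell 0)%:~R + \sum_(1 <= j < m.+1) (ell j)%:~R * (Phi alpha j T).[beta].

Lemma size_Mrow_Ntot j : (j <= m)%N -> (size (Mrow m alpha nn i j) <= N.+1)%N.
Proof.
move=> jm; rewrite (leq_trans (size_Mrow alpha nn_gt0 nn_le im jm)) //.
by rewrite -addn1 leq_add ?leq_subr ?leq_b1.
Qed.

Lemma formB_int : formB \is a Num.int.
Proof.
rewrite /formB /den horner_int //; first exact: (@size_Mrow_Ntot 0).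
by move=> k; rewrite natrM mulrAC rpredM ?natr_int ?Qpoly_coef_int.
Qed.

Lemma formA_int : formA \is a Num.int.
Proof.
rewrite /formA mulr_sumr big_seq rpred_sum // => j; rewrite mem_index_iota => jm.
rewrite mulrA rpredM ?intr_int // horner_int ?size_Mrow_Ntot // => k.
case: j jm => [|j] jm /=; last exact: Ppoly_coef_int.
by rewrite natrM mulrAC rpredM ?natr_int ?Qpoly_coef_int.
Qed.

Variable p : nat.
Hypothesis p_prime : prime p.
Hypothesis a_neq0 : a != 0.
Hypothesis pb : ~~ (p %| b)%N.
Hypothesis dt_sl : (dt %| sl)%N.
Hypothesis sl_a : (logn p sl < logn p `|a|)%N.
Hypothesis sl_a2 : p = 2%N -> (2 %| sl)%N -> (logn p sl + 2 <= logn p `|a|)%N.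
Notation e := (N * logn p `|a| - 1)%N.

Lemma padic_term j k k' : (1 <= j <= m)%N -> (N <= k)%N -> (k' <= k)%N ->
  padic_dvd p e ((W N)%:R * a%:~R ^+ k * fcoef alpha j k' : F).
Proof.
move=> jP Nk k'k.
have N0 : (0 < N)%N := leq_trans (nn_gt0 (leq0n m)) (nn_le_Ntot nn (leq0n m)).
have fint l l' := @fcoef_int F m r s u v sl dt U V sl_gt0 s_gt0 u_gt0 v_gt0 uvE uv_coprime
  s_dt s_sl u_le v_le j l l' jP.
(* [logn_Wden_leq] only compares [N] with larger indices, so a coefficient of lower degree is
   treated as one of degree [N]. *)
pose k1 := maxn N k'.
have Wk : (logn p (W k1) + e <= logn p `|((W N)%:Z * a ^+ k)%R|)%N.
  rewrite abszM abszX absz_nat lognM ?expn_gt0 ?absz_gt0 ?a_neq0 ?Wden_gt0 // lognX.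
  have L := @logn_Wden_leq p p_prime sl dt U V N k1 (logn p `|a|) dt_gt0 sl_gt0 V_gt0 N0
    (leq_maxl _ _) (dvdn_leq_log p sl_gt0 dt_sl) sl_a sl_a2.
  have : (k1 * logn p `|a| <= k * logn p `|a|)%N by rewrite leq_mul2r geq_max Nk k'k orbT.
  (* Makes the truncated subtraction in [e] a true one. *)
  have : (0 < N * logn p `|a|)%N by rewrite muln_gt0 N0 (leq_ltn_trans _ sl_a).
  by move: L; move: (logn p (W k1)) (logn p (W N)) (k1 * _)%N (k * _)%N (N * _)%N => /= x1 x2 x3 x4 x5; clear; lia.
have := padic_dvd_logn p_prime (Wden_gt0 sl U V k1 dt_gt0) (fint k' k1 (leq_maxr _ _)) _ Wk.
rewrite intrM -pmulrn rmorphXn /=; apply.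
by rewrite mulf_neq0 ?expf_neq0 // -lt0n Wden_gt0.
Qed.

(** By [Ppoly_approx] the difference is a sum over degrees [k >= N]. In each term [a ^ k] makes up
    for the denominator of the coefficient, and [b ^ k] is prime to [p]; the exponent does not
    depend on [T]. *)
Lemma padic_form T : (N <= T)%N -> padic_dvd p e (formB * Lam T - formA).
Proof.
move=> NT.
have denE : den%:R = qd%:R * (W N)%:R * b%:R ^+ N :> F by rewrite /den natrM natrX natrM.
have nP k : (1 <= k <= m)%N -> (row k <= (row 0).+1)%N by apply: nrowP.
have a0 := alpha_gt0.
have qN : (qdeg m row + (row 0).+1)%N = N by apply: Ntot_row.
have -> : formB * Lam T - formA = \sum_(1 <= j < m.+1) \sum_(N <= k < qdeg m row + T)
    \sum_(l < k.+1) ((ell j)%:~R * (qd%:R * Q`_l)) *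
      (b%:R ^+ N * ((W N)%:R * a%:~R ^+ k * (Phi alpha j T)`_(k - l) / b%:R ^+ k)).
  rewrite /formB /formA /Lam.
  rewrite [X in _ - _ * X]big_ltn //.
  rewrite -mulrA -mulrBr.
  have E0 (x y S S' : F) : x * (y + S) - (x * y + S') = x * S - S' by ring.
  rewrite E0 mulr_sumr -sumrB mulr_sumr.
  rewrite !big_nat; apply: eq_bigr => j jP.
  have -> : Mrow m alpha nn i j = P j by case: j jP.
  have -> : Q.[beta] * ((ell j)%:~R * (Phi alpha j T).[beta]) - (P j).[beta] * (ell j)%:~R =
     (ell j)%:~R * (Q * Phi alpha j T - P j).[beta].
    by rewrite hornerD hornerN hornerM; ring.
  rewrite (Ppoly_approx a0 nP jP) ?qN // addrAC subrr add0r horner_sum !mulr_sumr.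
  apply: eq_bigr => k _; rewrite hornerZ hornerXn coefM mulr_suml !mulr_sumr.
  apply: eq_bigr => l _; rewrite denE expr_div_n.
  by move: (a%:~R ^+ k) (b%:R ^+ N) ((b%:R ^+ k)^-1) => x y z; ring.
apply: padic_dvd_sum => // j; rewrite mem_index_iota => jP.
apply: padic_dvd_sum => // k; rewrite mem_index_iota => /andP[Nk _].
apply: padic_dvd_sum => // l _.
apply: padic_dvdMl; first by rewrite rpredM ?intr_int ?Qpoly_coef_int.
apply: padic_dvdMl; first by rewrite rpredX // natr_int.
apply: padic_dvd_div => //; rewrite coef_poly; case: ifP => _; last by rewrite mulr0; apply: padic_dvd0.
by apply: padic_term => //; rewrite leq_subr.
Qed.

End LinearForm.

(** * The archimedean size of the linear form *)

Section ArchimedeanBound.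
Variables (F : archiRealFieldType) (ex : F -> F).
(* [ex] stands for the exponential, of which only these two properties matter. *)
Hypothesis ex_ge : forall (x : F) n, 0 <= x -> x ^+ n / n`!%:R <= ex x.
Hypothesis ex_mono : forall x y : F, x <= y -> ex x <= ex y.

Lemma ex_ge1 x : 0 <= x -> 1 <= ex x.
Proof. by move=> x0; have := ex_ge 0 x0; rewrite expr0 fact0 divr1. Qed.

(** With every factor at most [y], the quotient is at most [y ^ n / n!], a term of the exponential
    series: this keeps the coefficients of exponential size in [N]. *)
Lemma rbin_le (x y z : F) n : 0 <= y -> y <= z -> (forall t, (t < n)%N -> `|x + t%:R| <= y) ->
  `|rbin x n| <= ex z.
Proof.
move=> y0 yz h; apply: le_trans (ex_mono yz); apply: le_trans (ex_ge n y0).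
rewrite /rbin normrM normfV normr_nat ler_pM2r ?invr_gt0 ?ltr0n ?fact_gt0 //.
rewrite /rfact normr_prod -[n in y ^+ n]card_ord -prodr_const.
by apply: ler_prod => t _; rewrite normr_ge0 h.
Qed.

Variables (m : nat) (r s : nat -> nat) (sl dt U V : nat).
Notation alpha := (nat_frac F r s).
Notation W := (Wden sl dt U V).
Hypothesis alpha_gt0 : forall j, (j <= m)%N -> 0 < alpha j.
Variable nn : nat -> nat.
Hypothesis nn_gt0 : forall j, (j <= m)%N -> (0 < nn j)%N.
Hypothesis nn_le : forall j, (j <= m)%N -> (nn j <= nn 0)%N.
Variable i : nat.
Hypothesis im : (i <= m)%N.
Notation N := (Ntot m nn).
Notation row := (nrow nn i).
Notation Q := (Qpoly m alpha row).
Notation P := (Ppoly m alpha row).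
Notation qd := (qden m s sl row).

Definition Cq : F := ex (alpha 0 + N%:R) ^+ 2 * \prod_(1 <= j < m.+1) ex (alpha j + N%:R).

Lemma alpha0_ge0 : 0 <= alpha 0. Proof. by rewrite ltW // alpha_gt0. Qed.

Lemma qdeg_lt_Ntot : (qdeg m row < N)%N.
Proof. by rewrite -(Ntot_row nn_gt0 im) addnS ltnS leq_addr. Qed.

Lemma Cq_ge0 : 0 <= Cq.
Proof.
apply: mulr_ge0.
  by rewrite exprn_ge0 // (le_trans ler01) ?ex_ge1 ?addr_ge0 ?alpha0_ge0.
rewrite big_seq; apply: prodr_ge0 => j; rewrite mem_index_iota => /andP[_ jm].
by rewrite (le_trans ler01) ?ex_ge1 ?addr_ge0 // ltW // alpha_gt0.
Qed.

Lemma qc_bound l : (l <= qdeg m row)%N -> `|qc m alpha row l| <= N%:R * Cq.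
Proof.
move=> lq; have qN := qdeg_lt_Ntot; have a00 := alpha0_ge0.
set q := qdeg m row in lq qN *.
apply: le_trans (_ : \sum_(k < l.+1) Cq <= _); last first.
  rewrite sumr_const card_ord -[X in X <= _]mulr_natl ler_wpM2r ?Cq_ge0 // ler_nat.
  exact: leq_ltn_trans lq qN.
rewrite /qc /qcoef (le_trans (ler_norm_sum _ _ _)) //; apply: ler_sum => k _.
have kl : (k <= l)%N by rewrite -ltnS.
have n0 (x : nat) : 0 <= x%:R :> F by [].
(* It is used for [x = alpha 0 - 1] and [x = 1 - alpha 0 - q]: in both cases [x + t] stays within
   [alpha 0 + q] in absolute value for [t < q]. *)
have B x : (forall t, (t < q)%N -> `|x + t%:R| <= alpha 0 + q%:R) ->
   forall n, (n <= q)%N -> `|rbin x n| <= ex (alpha 0 + N%:R).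
  move=> h n nq; apply: (@rbin_le _ (alpha 0 + q%:R)); rewrite ?addr_ge0 //.
    by rewrite lerD2l ler_nat ltnW.
  by move=> t tn; apply: h; apply: leq_trans tn nq.
rewrite normrM [X in X * _]normrM /Cq ler_pM ?mulr_ge0 ?normr_ge0 //.
  rewrite expr2 ler_pM ?normr_ge0 //.
  - apply: B => [t tq|]; last by rewrite (leq_trans (leq_subr _ _)).
    rewrite ler_norml; have t0 := n0 t.
    have : t.+1%:R <= q%:R :> F by rewrite ler_nat.
    by rewrite -natr1 => ?; apply/andP; split; lra.
  - apply: B => [t tq|]; last by rewrite (leq_trans kl).
    rewrite ler_norml; have t0 := n0 t.
    have : t.+1%:R <= q%:R :> F by rewrite ler_nat.
    by rewrite -natr1 -/q => ?; apply/andP; split; lra.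
rewrite /Gval normr_prod !big_seq; apply: ler_prod => j; rewrite mem_index_iota => jP.
have aj0 : 0 <= alpha j by rewrite ltW // alpha_gt0 //; case/andP: jP.
rewrite normr_ge0; apply: (@rbin_le _ (alpha j + N%:R)) => //; first by rewrite addr_ge0.
move=> t tn; rewrite -!addrA -!natrD ger0_norm ?addr_ge0 // lerD2l ler_nat.
by have := Ntot_shift nn_gt0 nn_le im jP; move: kl lq tn; rewrite -/q; lia.
Qed.

Lemma Qpoly_bound k : `|Q`_k| <= N%:R * Cq.
Proof.
rewrite coef_poly; case: ifP => _; first by rewrite qc_bound // leq_subr.
by rewrite normr0 mulr_ge0 ?Cq_ge0.
Qed.

Lemma fcoef_le1 j k : (j <= m)%N -> 0 <= fcoef alpha j k <= 1.
Proof.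
move=> jm; have aj := alpha_gt0 jm; have a00 := alpha0_ge0.
have h : 0 < rfact (alpha j + alpha 0) k by rewrite rfact_gt0 // ltr_wpDr.
rewrite /fcoef; apply/andP; split.
  by apply: divr_ge0; apply: ltW => //; apply: rfact_gt0.
rewrite ler_pdivrMr // mul1r.
apply: ler_prod => t _; apply/andP; split; first by rewrite addr_ge0 // ltW.
by rewrite lerD2r lerDl.
Qed.

(** One factor [N] counts the terms of [qcoef], the other those of the convolution with the series
    coefficients, which lie between 0 and 1. *)
Lemma Mrow_bound j k : (j <= m)%N -> `|(Mrow m alpha nn i j)`_k| <= N%:R ^+ 2 * Cq.
Proof.
have C0 := Cq_ge0.
have N1 : 1 <= N%:R :> F by rewrite ler1n (leq_ltn_trans _ qdeg_lt_Ntot).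
case: j => [|j] jm /=.
  by rewrite (le_trans (Qpoly_bound k)) // expr2 -mulrA ler_peMl // mulr_ge0.
rewrite coef_poly; case: ifP => hk; last by rewrite normr0 mulr_ge0 ?exprn_ge0.
have kN : (k < N)%N.
  apply: leq_trans hk _; rewrite -(@Ntot_shift m nn nn_gt0 nn_le i j.+1 im jm).
  by rewrite leq_addr.
apply: le_trans (_ : \sum_(l < k.+1) N%:R * Cq <= _); last first.
  rewrite sumr_const card_ord -[X in X <= _]mulr_natl expr2 -mulrA.
  by apply: ler_wpM2r; [rewrite mulr_ge0 | rewrite ler_nat].
rewrite (le_trans (ler_norm_sum _ _ _)) //; apply: ler_sum => l _.
have /andP[f0 f1] := @fcoef_le1 j.+1 (k - l) jm.
by rewrite normrM (ger0_norm f0) (le_trans _ (Qpoly_bound l)) // ler_piMr ?normr_ge0.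
Qed.

Variables (a : int) (b : nat).
Hypothesis b_gt0 : (0 < b)%N.
Hypothesis ab : (b <= `|a|)%N.
Notation beta := (a%:~R / b%:R : F).

(** The term of degree [k] contributes [|a|^k b^(N - k)], which is largest at [k = N - d] because
    [b <= |a|]. *)
Lemma horner_bound (R : {poly F}) (C : F) (d : nat) : (d <= N)%N ->
  (size R <= (N - d).+1)%N -> (forall k, `|R`_k| <= C) ->
  `|b%:R ^+ N * R.[beta]| <= N.+1%:R * C * (`|a|%N%:R ^+ (N - d) * b%:R ^+ d).
Proof.
move=> dN sR hC; have b0 : b%:R != 0 :> F by rewrite pnatr_eq0 -lt0n.
have C0 : 0 <= C := le_trans (normr_ge0 _) (hC 0%N).
rewrite horner_coef mulr_sumr (le_trans (ler_norm_sum _ _ _)) //.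
apply: le_trans (_ : \sum_(k < size R) C * (`|a|%N%:R ^+ (N - d) * b%:R ^+ d) <= _); last first.
  rewrite sumr_const card_ord -[X in X <= _]mulr_natl -mulrA ler_wpM2r //.
    by rewrite !mulr_ge0 ?exprn_ge0.
  by rewrite ler_nat (leq_trans sR) // ltnS leq_subr.
apply: ler_sum => k _; have kd : (k <= N - d)%N by rewrite -ltnS (leq_trans (ltn_ord k)).
have kN : (k <= N)%N by rewrite (leq_trans kd) ?leq_subr.
rewrite mulrCA normrM ler_pM ?normr_ge0 // normrM !normrX normrM normfV normr_nat.
rewrite -[in X in X <= _](subnK kN) exprD expr_div_n -mulrA.
have E (y z w : F) : y != 0 -> z * (y * (w / y)) = z * w by move=> y0; field.
rewrite E ?expf_neq0 //.
have -> : `|a%:~R| = `|a|%N%:R :> F by rewrite -intr_norm -abszE pmulrn.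
have -> : `|a|%N%:R ^+ (N - d) = `|a|%N%:R ^+ (N - d - k) * `|a|%N%:R ^+ k :> F.
  by rewrite -exprD subnK.
have -> : (N - k = (N - d - k) + d)%N by lia.
rewrite exprD [X in _ <= X]mulrAC !ler_wpM2r ?exprn_ge0 //.
by rewrite lerXn2r ?nnegrE // ler_nat.
Qed.

Variables (ell : nat -> int) (S : nat) (e0 es Lb : F).
Hypothesis e0_ge1 : 1 <= e0.
Hypothesis es_ge1 : 1 <= es.
Hypothesis s0_gt0 : (0 < s 0)%N.
Hypothesis S_gt0 : (0 < S)%N.
Hypothesis E0 : forall n, (Epart (s 0) n)%:R <= e0 ^+ n.
Hypothesis Es : forall n, (Epart sl n)%:R <= es ^+ n.
Hypothesis s_le : forall j, (1 <= j <= m)%N -> (s j <= S)%N.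
Hypothesis LbP : (Llcm (U + V * N))%:R <= Lb.

Lemma den_bound : (qd * W N)%:R <=
  ((s 0)%:R * e0 * (S%:R * es) * (dt%:R * es)) ^+ N * Lb.
Proof.
have qN := ltnW qdeg_lt_Ntot.
have s01 : 1 <= (s 0)%:R :> F by rewrite ler1n.
have S1 : 1 <= S%:R :> F by rewrite ler1n.
have e00 : 0 <= e0 := le_trans ler01 e0_ge1.
have es0 : 0 <= es := le_trans ler01 es_ge1.
rewrite /qden /Wden !natrM !natrX !exprMn -[X in _ <= X]mulrA.
apply: ler_pM; rewrite ?mulr_ge0 ?exprn_ge0 //; last first.
  by rewrite ler_pM ?mulr_ge0 ?exprn_ge0 // ler_pM ?exprn_ge0.
apply: ler_pM; rewrite ?mulr_ge0 ?exprn_ge0 //.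
  apply: ler_pM; rewrite ?exprn_ge0 //; first by rewrite ler_weXn2l.
  by rewrite (le_trans (E0 _)) // ler_weXn2l.
rewrite -exprMn.
have Ses : 1 <= S%:R * es by rewrite mulr_ege1.
apply: le_trans (_ : (S%:R * es) ^+ qdeg m row <= _); last by rewrite ler_weXn2l.
rewrite natr_prod /qdeg.
have -> : (S%:R * es) ^+ (\sum_(1 <= j < m.+1) row j) =
    \prod_(1 <= j < m.+1) (S%:R * es) ^+ row j.
  by elim/big_rec2: _ => [|j x y _ <-]; rewrite ?expr0 // exprD.
rewrite !big_seq; apply: ler_prod => j; rewrite mem_index_iota => jP.
rewrite ler0n natrM natrX exprMn ler_pM ?exprn_ge0 //.
by rewrite lerXn2r ?nnegrE // ler_nat s_le.
Qed.

Lemma formA_bound :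
  `|formA F m r s sl dt U V nn i a b ell| <=
  ((s 0)%:R * e0 * (S%:R * es) * (dt%:R * es)) ^+ N * Lb * (N.+1%:R ^+ 3 * Cq) *
  \sum_(0 <= j < m.+1) `|ell j|%N%:R * (`|a|%N%:R ^+ (N - nn j) * b%:R ^+ nn j).
Proof.
have C0 := Cq_ge0.
have X0 := le_trans (ler0n F (qd * W N)) den_bound.
rewrite /formA /den natrM natrX -mulrA normrM -[X in _ <= X]mulrA.
rewrite ler_pM ?normr_ge0 //; first by rewrite normr_nat den_bound.
rewrite mulr_sumr (le_trans (ler_norm_sum _ _ _)) // mulr_sumr !big_seq.
apply: ler_sum => j; rewrite mem_index_iota ltnS => jm.
have -> : `|ell j|%N%:R = `|(ell j)%:~R| :> F by rewrite -intr_norm -abszE pmulrn.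
rewrite mulrA normrM [X in X <= _]mulrC [X in _ <= X]mulrCA ler_wpM2l ?normr_ge0 //.
have hN := nn_le_Ntot nn jm.
apply: (le_trans (@horner_bound (Mrow m alpha nn i j) (N%:R ^+ 2 * Cq) (nn j) hN _ _)).
- by rewrite (leq_trans (size_Mrow alpha nn_gt0 nn_le im jm)) // -addn1 leq_add2l leq_b1.
- by move=> k; apply: Mrow_bound.
have hsq : N%:R ^+ 2 <= N.+1%:R ^+ 2 :> F by rewrite lerXn2r ?nnegrE // ler_nat.
rewrite ler_wpM2r ?mulr_ge0 ?exprn_ge0 // mulrA ler_wpM2r // [N.+1%:R ^+ 3]exprS.
by rewrite ler_wpM2l.
Qed.

End ArchimedeanBound.

End Pade.

(** * Integral linear forms *)

Module Forms.
Import all_boot all_order all_algebra zify Rstruct.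
Set Implicit Arguments. Unset Strict Implicit. Unset Printing Implicit Defensive.
Import Order.TTheory GRing.Theory Num.Theory.
Import Qpower Pade.
Local Open Scope R_scope.

(** * Primes, [epsilon] and the exponential function *)

Lemma Nat_moduloE (n d : nat) : (0 < d)%N -> Nat.modulo n d = (n %% d)%N.
Proof.
move=> d0; symmetry; apply: (Nat.mod_unique _ _ (n %/ d)%N); last first.
  by rewrite {1}(divn_eq n d) mulnC.
by apply/ssrnat.ltP; rewrite ltn_pmod.
Qed.

Lemma list_seqE k n : List.seq k n = iota k n.
Proof. by elim: n k => //= n IH k; rewrite IH. Qed.

Lemma list_filterE (T : Type) (f : T -> bool) l : List.filter f l = [seq x <- l | f x].
Proof. by elim: l => //= x l ->. Qed.

Lemma list_forallbE (T : Type) (f : T -> bool) l : List.forallb f l = all f l.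
Proof. by elim: l => //= x l ->. Qed.

Lemma list_foldE (T U : Type) (f : T -> U -> U) z l : List.fold_right f z l = foldr f z l.
Proof. by elim: l => //= x l ->. Qed.

Lemma list_mapE (T U : Type) (f : T -> U) l : List.map f l = [seq f x | x <- l].
Proof. by elim: l => //= x l ->. Qed.

Lemma list_lengthE (T : Type) (l : list T) : List.length l = size l.
Proof. by elim: l => //= x l ->. Qed.

Definition list_E := (list_seqE, list_filterE, list_forallbE, list_foldE, list_mapE, list_lengthE).

Lemma isprimebE k : isprimeb k = prime.prime k.
Proof.
rewrite /isprimeb !list_E; have -> : Nat.ltb 1 k = (1 < k)%N.
  by apply/idP/idP => h; [apply/ssrnat.ltP/Nat.ltb_lt | apply/Nat.ltb_lt/ssrnat.ltP].
case: (ltnP 1 k) => k1 /=; last by apply/esym/negbTE; apply/negP => /prime_gt1; lia.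
apply/idP/idP.
  move=> /allP h; apply/primeP; split=> // d dk.
  have d0 : (0 < d)%N by apply: dvdn_gt0 dk; lia.
  have dlk : (d <= k)%N by apply: dvdn_leq dk; lia.
  apply/orP; have [d1|d1] := eqVneq d 1%N; first by left.
  have [dk'|dk'] := eqVneq d k; first by right.
  have := h d; rewrite mem_iota Nat_moduloE // (eqP dk) => H.
  by have : false by apply: H; lia.
move=> pk; apply/allP => d; rewrite mem_iota => hd.
rewrite Nat_moduloE; last by lia.
apply/negP => /Nat.eqb_eq h0.
have /primeP[_ /(_ d)] := pk; rewrite /dvdn h0 eqxx => /(_ isT) /orP[] /eqP; lia.
Qed.

Lemma primes_filter (s : nat) : (0 < s)%N ->
  primes s = [seq q <- iota 0 s.+1 | prime.prime q && (q %| s)%N].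
Proof.
move=> s0; apply: (irr_sorted_eq ltn_trans ltnn (sorted_primes s)).
  by rewrite (sorted_filter ltn_trans) // iota_ltn_sorted.
move=> q; rewrite mem_filter mem_primes s0 mem_iota add0n ltnS.
case qp : (prime.prime q) => //=; case qs : (q %| s)%N => //=.
by rewrite dvdn_leq.
Qed.

Lemma epsilonE (s : nat) : (0 < s)%N ->
  epsilon (Z.of_nat s) = foldr Rmult 1 [seq Rpower (INR q) (1 / (INR q - 1)) | q <- primes s].
Proof.
move=> s0; rewrite /epsilon Nat2Z.id !list_E primes_filter //; congr (foldr _ _ (map _ _)).
apply: eq_filter => q; rewrite isprimebE; case qp: (prime.prime q) => //=.
have q0 := prime_gt0 qp.
by rewrite Nat_moduloE // /dvdn; apply/idP/idP => [/Nat.eqb_eq ->|/eqP ->].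
Qed.

Lemma prime_INR q : prime.prime q -> 2 <= INR q.
Proof. by move=> /prime_gt1 h; apply: (le_INR 2); apply/ssrnat.leP. Qed.

Lemma Rpower_prime_gt0 q : 0 < Rpower (INR q) (1 / (INR q - 1)).
Proof. exact: exp_pos. Qed.

Lemma Rpower_prime_ge1 q : prime.prime q -> 1 <= Rpower (INR q) (1 / (INR q - 1)).
Proof.
move=> /prime_INR q2; apply: Rle_trans (_ : Rpower (INR q) 0 <= _); first by rewrite Rpower_O; lra.
apply: Rle_Rpower; first by lra.
by apply: Rlt_le; apply: Rdiv_lt_0_compat; lra.
Qed.

Lemma foldr_ge1 (f : nat -> R) l : (forall q, q \in l -> 1 <= f q) -> 1 <= foldr Rmult 1 [seq f q | q <- l].
Proof.
elim: l => [|q l IH] h /=; first by lra.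
have h1 : 1 <= f q by apply: h; rewrite inE eqxx.
have h2 : 1 <= foldr Rmult 1 [seq f q | q <- l].
  by apply: IH => x xl; apply: h; rewrite inE xl orbT.
by nra.
Qed.

Lemma epsilon_ge1 (s : nat) : (0 < s)%N -> 1 <= epsilon (Z.of_nat s).
Proof.
move=> s0; rewrite epsilonE //; apply: foldr_ge1 => q.
by rewrite mem_primes => /andP[qp _]; apply: Rpower_prime_ge1.
Qed.

Lemma Epart_epsilon (s n : nat) : (0 < s)%N -> INR (Epart s n) <= epsilon (Z.of_nat s) ^ n.
Proof.
move=> s0; rewrite epsilonE // /Epart.
have : forall q, q \in primes s -> prime.prime q by move=> q; rewrite mem_primes => /andP[].
elim: (primes s) => [|q l IH] h; first by rewrite big_nil /= pow1; lra.
rewrite big_cons mult_INR /= Rpow_mult_distr.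
have qp : prime.prime q by apply: h; rewrite inE eqxx.
have q2 := prime_INR qp.
apply: Rmult_le_compat; [exact: pos_INR | exact: pos_INR | | ]; last first.
  by apply: IH => x xl; apply: h; rewrite inE xl orbT.
have -> : INR (q ^ (n %/ q.-1)) = INR q ^ (n %/ q.-1).
  by elim: (n %/ q.-1)%N => [|k IHk] //=; rewrite expnS mult_INR IHk.
rewrite -!Rpower_pow; [|exact: Rpower_prime_gt0|lra].
rewrite Rpower_mult; apply: Rle_Rpower; first by lra.
have q1 : INR q - 1 = INR q.-1.
  by rewrite -[in LHS](prednK (prime_gt0 qp)) S_INR; lra.
rewrite q1; have q10 : 0 < INR q.-1 by lra.
apply: (Rmult_le_reg_r (INR q.-1)) => //.
have -> : 1 / INR q.-1 * INR n * INR q.-1 = INR n by field; lra.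
by rewrite -mult_INR; apply: le_INR; apply/ssrnat.leP; apply: leq_trunc_div.
Qed.

Lemma prime_pi_INR X : prime_pi (INR X) = (\sum_(q < X.+1 | prime.prime q) 1)%N.
Proof.
rewrite /prime_pi !list_E.
have -> : Z.to_nat (Int_part (INR X)) = X.
  rewrite INR_IZR_INZ.
  suff -> : Int_part (IZR (Z.of_nat X)) = Z.of_nat X by rewrite Nat2Z.id.
  have [h1 h2] := base_Int_part (IZR (Z.of_nat X)).
  have h3 := le_IZR _ _ h1.
  have : Z.lt (Z.of_nat X) (Z.succ (Int_part (IZR (Z.of_nat X)))).
    by apply: lt_IZR; rewrite succ_IZR; lra.
  by lia.
rewrite (eq_filter isprimebE) size_filter -sum1_count.
by rewrite -(big_mkord prime.prime (fun=> 1%N)) /index_iota subn0.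
Qed.

(** Each of the prime powers is at most [X], so their product is at most [X ^ prime_pi X]. *)
Lemma Llcm_bound X theta : (2 <= X)%N ->
  INR (prime_pi (INR X)) <= theta * INR X / ln (INR X) ->
  INR (Llcm X) <= exp (theta * INR X).
Proof.
move=> X2; have X2' : 2 <= INR X by apply: (le_INR 2); apply/ssrnat.leP.
have lnX : 0 < ln (INR X) by rewrite -ln_1; apply: ln_increasing; lra.
rewrite prime_pi_INR => h.
have {}h : INR (\sum_(q < X.+1 | prime.prime q) 1)%N * ln (INR X) <= theta * INR X.
  have := Rmult_le_compat_r _ _ _ (Rlt_le _ _ lnX) h.
  by rewrite /Rdiv Rmult_assoc Rinv_l; lra.
apply: Rle_trans (_ : exp (INR (\sum_(q < X.+1 | prime.prime q) 1)%N * ln (INR X)) <= _); last first.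
  by case: h => [h|->]; [left; apply: exp_increasing | right].
have -> : exp (INR (\sum_(q < X.+1 | prime.prime q) 1)%N * ln (INR X)) =
    INR X ^ (\sum_(q < X.+1 | prime.prime q) 1)%N.
  by rewrite -Rpower_pow //; lra.
rewrite /Llcm; elim/big_rec2: _ => [|q k x qp IH] /=; first by lra.
rewrite mult_INR; apply: Rmult_le_compat => //; try exact: pos_INR.
apply: le_INR; apply/ssrnat.leP; apply: trunc_logP; [exact: prime_gt1 | lia].
Qed.

Lemma pow_fact_le_exp (x : R) n : 0 <= x -> x ^ n / INR (fact n) <= exp x.
Proof.
move=> x0; rewrite /exp; case: (exist_exp x) => l hl /=.
have pos k : 0 <= / INR (fact k) * x ^ k.
  apply: Rmult_le_pos; last exact: pow_le.
  by apply: Rlt_le; apply: Rinv_0_lt_compat; exact: INR_fact_lt_0.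
apply: Rle_trans (sum_incr _ n l hl pos).
case: n => [|n] /=; first by rewrite /Rdiv; lra.
have := cond_pos_sum (fun k => / INR (fact k) * x ^ k) n pos; rewrite /Rdiv Rmult_comm /=.
by lra.
Qed.

Definition intZ (z : Z) : int :=
  match z with Z0 => Posz 0 | Zpos p => Posz (Pos.to_nat p) | Zneg p => (- Posz (Pos.to_nat p))%R end.

Lemma natr_INR n : (n%:R)%R = INR n. Proof. by rewrite INRE. Qed.

Lemma intZE (z : Z) : ((intZ z)%:~R)%R = IZR z.
Proof.
case: z => [|q|q] //=.
  by rewrite -[IZR _]/(IZR (Zpos q)) -positive_nat_Z -INR_IZR_INZ -natr_INR.
rewrite -Pos2Z.opp_pos opp_IZR -positive_nat_Z -INR_IZR_INZ -natr_INR.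
by rewrite rmorphN.
Qed.

Lemma absz_intZ (z : Z) : absz (intZ z) = Z.abs_nat z.
Proof. by case: z => //= q; rewrite abszN absz_nat. Qed.

Lemma intZ_eq0 (z : Z) : (intZ z == 0)%R = (Z.eqb z 0).
Proof.
rewrite -absz_eq0 absz_intZ; case: (Z.eqb_spec z 0) => [->|] //= h.
by apply/eqP; lia.
Qed.

Lemma int_Z (x : R) : (x \is a Num.int)%R -> exists z : Z, x = IZR z.
Proof.
move/intrP => [[n|n] ->]; first by exists (Z.of_nat n); rewrite -INR_IZR_INZ -natr_INR.
by exists (Z.opp (Z.of_nat n.+1)); rewrite opp_IZR -INR_IZR_INZ -natr_INR NegzE rmorphN.
Qed.

Lemma dvdn_Zdivide (k n : nat) : (k %| n)%N <-> Z.divide (Z.of_nat k) (Z.of_nat n).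
Proof.
split=> [/dvdnP[q ->]|[q hq]]; first by exists (Z.of_nat q); rewrite -Nat2Z.inj_mul.
case: (posnP k) => [k0|k0].
  by rewrite k0 in hq *; rewrite dvd0n; apply/eqP; lia.
apply/dvdnP; exists (Z.to_nat q); nia.
Qed.

(** * The linear forms over the reals *)

Section Forms.
Variables (m : nat) (r s u v nn : nat -> nat) (sl dt U V S : nat).
Notation al := (nat_frac R r s).
Hypothesis sl_gt0 : (0 < sl)%N.
Hypothesis dt_gt0 : (0 < dt)%N.
Hypothesis V_gt0 : (0 < V)%N.
Hypothesis S_gt0 : (0 < S)%N.
Hypothesis r_gt0 : forall j, (j <= m)%N -> (0 < r j)%N.
Hypothesis s_gt0 : forall j, (j <= m)%N -> (0 < s j)%N.
Hypothesis u_gt0 : forall j, (1 <= j <= m)%N -> (0 < u j)%N.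
Hypothesis v_gt0 : forall j, (1 <= j <= m)%N -> (0 < v j)%N.
Hypothesis uvE : forall j, (1 <= j <= m)%N -> al j + al 0%N = INR (u j) / INR (v j).
Hypothesis uv_coprime : forall j, (1 <= j <= m)%N -> coprime (u j) (v j).
Hypothesis s_dt : forall j, (1 <= j <= m)%N -> (s j %| dt * v j)%N.
Hypothesis s_sl : forall j, (1 <= j <= m)%N -> (s j %| sl)%N.
Hypothesis s_le : forall j, (1 <= j <= m)%N -> (s j <= S)%N.
Hypothesis u_le : forall j, (1 <= j <= m)%N -> (u j <= U)%N.
Hypothesis v_le : forall j, (1 <= j <= m)%N -> (v j <= V)%N.
Hypothesis al_nint : forall i j, (1 <= i <= m)%N -> (1 <= j <= m)%N -> i <> j ->
  forall x y : nat, al i + INR x <> al j + INR y.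
Hypothesis nn_gt0 : forall j, (j <= m)%N -> (0 < nn j)%N.
Hypothesis nn_le : forall j, (j <= m)%N -> (nn j <= nn 0)%N.
Notation N := (Ntot m nn).
Variables (a : Z) (b p : nat).
Hypothesis b_gt0 : (0 < b)%N.
Hypothesis ab : (b <= Z.abs_nat a)%N.
Hypothesis p_prime : prime.prime p.
Hypothesis a_neq0 : a <> Z0.
Hypothesis pb : ~~ (p %| b)%N.
Hypothesis dt_sl : (dt %| sl)%N.
Hypothesis sl_a : (logn p sl < logn p (Z.abs_nat a))%N.
Hypothesis sl_a2 : p = 2%N -> (2 %| sl)%N -> (logn p sl + 2 <= logn p (Z.abs_nat a))%N.
Variables (ell : nat -> Z) (Rm theta Mx : R).
Hypothesis ell_neq0 : exists2 i, (i <= m)%N & ell i <> Z0.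
Hypothesis al_le : forall j, (1 <= j <= m)%N -> al j <= Rm.
Hypothesis LbP : INR (Llcm (U + V * N)) <= exp (theta * INR (U + V * N)).
Hypothesis MxP : forall j, (j <= m)%N ->
  IZR (Z.abs (ell j)) * (IZR (Z.abs a) ^ (N - nn j) * INR b ^ nn j) <= Mx.

Notation elz := (fun j => intZ (ell j)).
Definition lfun T : R := Lam R m r s (intZ a) b elz T.
Notation e0 := (epsilon (Z.of_nat (s 0))).
Notation es := (epsilon (Z.of_nat sl)).

(** [A] and [B] are chosen before [T]. The last clause states divisibility at [p] by an equation
    with the cofactor [c], the form in which [padicQ_close] uses it. *)
Lemma linear_forms : exists A B : Z, [/\ A <> Z0,
  Rabs (IZR A) <= (INR (s 0) * e0 * (INR S * es) * (INR dt * es)) ^ N *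
     exp (theta * INR (U + V * N)) *
     (INR N.+1 ^ 3 * exp (2 * (al 0%N + INR N) + INR m * (Rm + INR N))) * (INR m.+1 * Mx) &
  forall T, (N <= T)%N -> exists c z : Z, ~ Z.divide (Z.of_nat p) c /\
    IZR c * (IZR B * lfun T - IZR A) = INR p ^ (N * logn p (Z.abs_nat a) - 1) * IZR z].
Proof.
have uvE' j : (1 <= j <= m)%N -> (al j + al 0%N = (u j)%:R / (v j)%:R)%R.
  by move=> jP; rewrite !natr_INR -RdivE; apply: uvE.
have al_nint' i j : (1 <= i <= m)%N -> (1 <= j <= m)%N -> i != j ->
    forall x y : nat, (al i + x%:R != al j + y%:R)%R.
  move=> iP jP ij x y; rewrite !natr_INR; apply/eqP; apply: al_nint => //; exact/eqP.
have al_gt0 j : (j <= m)%N -> (0 < al j)%R by move=> jm; apply: (alpha_gt0 _ r_gt0 s_gt0 jm).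
have b0 : ((intZ a)%:~R / b%:R != 0 :> R)%R.
  rewrite mulf_neq0 ?invr_neq0 ?pnatr_eq0 -?lt0n // intr_eq0 intZ_eq0.
  by apply/negP => /Z.eqb_eq.
have [i im neq0] : exists2 i, (i <= m)%N &
    (\sum_(0 <= j < m.+1) (Mrow m al nn i j).[(intZ a)%:~R / b%:R] * (elz j)%:~R != 0)%R.
  apply: (@Mrow_neq0 _ m al al_gt0 al_nint' nn nn_gt0 nn_le _ (fun j => (elz j)%:~R)%R) => //.
  have [k km lk] := ell_neq0; exists k => //; rewrite intr_eq0 intZ_eq0.
  by apply/negP => /Z.eqb_eq.
have [A AE] := int_Z (formA_int sl_gt0 s_gt0 u_gt0 v_gt0 uvE' uv_coprime s_dt s_sl u_le v_le
  nn_gt0 nn_le im (intZ a) b_gt0 elz).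
have [B BE] := int_Z (formB_int R r dt U V sl_gt0 s_gt0 s_sl nn_gt0 nn_le im (intZ a) b_gt0).
have s00 : (0 < s 0)%N by apply: s_gt0.
exists A, B; split.
- move=> A0; move: AE; rewrite A0 /formA => /eqP; apply/negP.
  rewrite mulf_neq0 // pnatr_eq0 -lt0n /den /qden.
  have W0 := Wden_gt0 sl U V N dt_gt0.
  apply: leq_trans (_ : 1 * 1 * 1 <= _)%N => //.
  rewrite leq_mul ?expn_gt0 ?b_gt0 // leq_mul // muln_gt0 muln_gt0 expn_gt0 s00 Epart_gt0 /=.
  rewrite big_seq prodn_cond_gt0 // => j; rewrite mem_index_iota => /andP[j1 jm].
  by rewrite muln_gt0 expn_gt0 s_gt0 // Epart_gt0.
- have ex_ge (x : R) n : (0 <= x)%R -> (x ^+ n / n`!%:R <= exp x)%R.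
    move=> /RleP x0; apply/RleP; rewrite natr_INR -factE -RpowE -RdivE.
    by apply: pow_fact_le_exp.
  have ex_mono (x y : R) : (x <= y)%R -> (exp x <= exp y)%R.
    move=> /RleP xy; apply/RleP; case: (Rle_lt_or_eq_dec _ _ xy) => [h|->]; last by lra.
    by left; apply: exp_increasing.
  have e01 : (1 <= e0 :> R)%R by apply/RleP; apply: epsilon_ge1.
  have es1 : (1 <= es :> R)%R by apply/RleP; apply: epsilon_ge1.
  have E0 n : ((Epart (s 0) n)%:R <= e0 ^+ n)%R.
    by apply/RleP; rewrite natr_INR -RpowE; apply: Epart_epsilon.
  have Es n : ((Epart sl n)%:R <= es ^+ n)%R.
    by apply/RleP; rewrite natr_INR -RpowE; apply: Epart_epsilon.
  have Lb' : ((Llcm (U + V * N))%:R <= exp (theta * INR (U + V * N)) :> R)%R.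
    by apply/RleP; rewrite natr_INR.
  have ab' : (b <= absz (intZ a))%N by rewrite absz_intZ.
  have := formA_bound ex_ge ex_mono dt al_gt0 nn_gt0 nn_le im b_gt0 ab' elz e01 es1 s00 S_gt0 E0 Es s_le Lb'.
  rewrite AE -RabsE => /RleP HA; apply: (Rle_trans _ _ _ HA).
  have C1 : Cq exp m r s nn <= exp (2 * (al 0%N + INR N) + INR m * (Rm + INR N)).
    rewrite /Cq exp_plus -RpowE -natr_INR; apply: Rmult_le_compat.
    + by apply: pow_le; apply: Rlt_le; exact: exp_pos.
    + apply/RleP; rewrite big_seq; apply: prodr_ge0 => j _.
      by apply/RleP; apply: Rlt_le; exact: exp_pos.
    + change (exp (al 0%N + (N%:R)%R) ^ 2 <= exp (2 * (al 0%N + (N%:R)%R))).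
      by right; rewrite /= Rmult_1_r -exp_plus; congr exp; lra.
    have -> : exp (INR m * (Rm + (N%:R)%R)) = (\prod_(1 <= j < m.+1) exp (Rm + N%:R))%R.
      rewrite prodr_const_nat subn1 /= -RpowE.
      change (exp (INR m * (Rm + (N%:R)%R)) = exp (Rm + (N%:R)%R) ^ m).
      move: (Rm + _) => y.
      elim: (m) => [|k IH]; first by rewrite /= Rmult_0_l exp_0.
      by rewrite S_INR Rmult_plus_distr_r Rmult_1_l exp_plus IH /= Rmult_comm.
    apply/RleP; rewrite !big_seq; apply: ler_prod => j; rewrite mem_index_iota => jP.
    apply/andP; split; first by apply/RleP; apply: Rlt_le; exact: exp_pos.
    apply: ex_mono; apply/RleP; rewrite -!RplusE; apply: Rplus_le_compat_r; exact: al_le.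
  have S1 : (\sum_(0 <= j < m.+1) `|elz j|%N%:R * (`|intZ a|%N%:R ^+ (N - nn j) * b%:R ^+ nn j))%R
      <= INR m.+1 * Mx.
    have -> : INR m.+1 * Mx = (\sum_(0 <= j < m.+1) Mx)%R.
      by rewrite sumr_const_nat subn0 -mulr_natl natr_INR.
    apply/RleP; rewrite !big_seq; apply: ler_sum => j; rewrite mem_index_iota => /andP[_ jm].
    apply/RleP; rewrite !natr_INR !absz_intZ -!RpowE -!RmultE.
    by have := MxP jm; rewrite !INR_IZR_INZ !Zabs2Nat.id_abs.
  have Sm0 : 0 <= (\sum_(0 <= j < m.+1) `|elz j|%N%:R * (`|intZ a|%N%:R ^+ (N - nn j) * b%:R ^+ nn j))%R.
    apply/RleP; apply: sumr_ge0 => j _; apply: mulr_ge0; first exact: ler0n.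
    by apply: mulr_ge0; apply: exprn_ge0; exact: ler0n.
  move: S1 Sm0; set Sm := (\sum_(_ <= _ < _) _)%R => S1 Sm0.
  have K0 : 0 <= INR (s 0) * e0 * (INR S * es) * (INR dt * es).
    by move/RleP: e01 => e01; move/RleP: es1 => es1; repeat apply: Rmult_le_pos; try exact: pos_INR; apply: Rle_trans Rle_0_1 _.
  rewrite !natr_INR -!RpowE -!RmultE.
  have P1 : 0 <= (INR (s 0) * e0 * (INR S * es) * (INR dt * es)) ^ N * exp (theta * INR (U + V * N)).
    by apply: Rmult_le_pos; [apply: pow_le | apply: Rlt_le; exact: exp_pos].
  have Cq0 : 0 <= Cq exp m r s nn by apply/RleP; apply: (Cq_ge0 ex_ge al_gt0 nn).
  have N3 : 0 <= INR N.+1 ^ 3 by apply: pow_le; exact: pos_INR.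
  apply: Rmult_le_compat => //.
  + by apply: Rmult_le_pos => //; apply: Rmult_le_pos.
  + by apply: Rmult_le_compat_l => //; apply: Rmult_le_compat_l.
- move=> T NT.
  have a0' : (intZ a != 0)%R by rewrite intZ_eq0; apply/negP => /Z.eqb_eq.
  have sl_a' : (logn p sl < logn p (absz (intZ a)))%N by rewrite absz_intZ.
  have sl_a2' : p = 2%N -> (2 %| sl)%N -> (logn p sl + 2 <= logn p (absz (intZ a)))%N.
    by rewrite absz_intZ.
  have := padic_form sl_gt0 dt_gt0 V_gt0 r_gt0 s_gt0 u_gt0 v_gt0 uvE' uv_coprime s_dt s_sl u_le v_le
    nn_gt0 nn_le im elz p_prime a0' pb dt_sl sl_a' sl_a2' NT.
  rewrite absz_intZ AE BE => -[c pc /int_Z[z zE]].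
  exists (Z.of_nat c), z; split; first by move=> /dvdn_Zdivide; apply/negP.
  have p0 : INR p <> 0 by apply: not_0_INR; have := prime_gt0 p_prime; lia.
  rewrite -zE -RdivE -RpowE natr_INR -RmultE -RminusE -RmultE natr_INR -!INR_IZR_INZ /lfun.
  by field; apply: pow_nonzero.
Qed.
End Forms.

(** * Rational partial sums as values of truncated series *)

Lemma Q2R_poch (x : Q) n : Q2R (poch x n) = rfact (Q2R x : R) n.
Proof.
elim: n => [|n IH]; first by rewrite rfact0 [LHS]RMicromega.Q2R_1.
rewrite rfactS /= Q2R_mult Q2R_plus IH Q2R_inject_Z natr_INR INR_IZR_INZ.
by [].
Qed.

Lemma Q2R_sum (f : nat -> Q) (l : seq nat) :
  Q2R (List.fold_right Qplus (Qmake Z0 xH) (List.map f l)) = (\sum_(i <- l) (Q2R (f i) : R))%R.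
Proof.
elim: l => [|i l IH] /=; first by rewrite big_nil RMicromega.Q2R_0.
by rewrite big_cons Q2R_plus IH.
Qed.

Lemma Q2R_Qpower (x : Q) (n : nat) : Q2R (Qpower x (Z.of_nat n)) = Q2R x ^ n.
Proof.
elim: n => [|n IH]; first by rewrite [LHS]RMicromega.Q2R_1.
have E : Qeq (Qpower x (Z.of_nat n.+1)) (Qmult (Qpower x (Z.of_nat n)) x).
  by rewrite Nat2Z.inj_succ -Z.add_1_r Qpower_plus' //; lia.
by rewrite (Qeq_eqR _ _ E) Q2R_mult IH /= Rmult_comm.
Qed.

Section LinearFormValue.
Variables (m : nat) (alpha : nat -> Q) (r s : nat -> nat).
Hypothesis alpha_pos : forall j, (j <= m)%N -> Qlt (Qmake Z0 xH) (alpha j).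
Hypothesis alphaE : forall j, (j <= m)%N -> Q2R (alpha j) = nat_frac R r s j.

Lemma Q2R_pos (x : Q) : Qlt (Qmake Z0 xH) x -> 0 < Q2R x.
Proof. by move=> /Qlt_Rlt; rewrite RMicromega.Q2R_0. Qed.

Lemma Q2R_coef j k : (j <= m)%N -> Q2R (coef alpha j k) = fcoef (nat_frac R r s) j k.
Proof.
move=> jm; have aj := Q2R_pos (alpha_pos jm); have a0 := Q2R_pos (alpha_pos (leq0n m)).
have E := Q2R_plus (alpha j) (alpha 0%N).
have sum0 : 0 < Q2R (Qplus (alpha j) (alpha 0%N)) by rewrite E; lra.
have pos : 0 < Q2R (poch (Qplus (alpha j) (alpha 0%N)) k).
  by rewrite Q2R_poch; apply/RltP; apply: rfact_gt0; exact/RltP.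
rewrite /coef Q2R_div; last first.
  by move=> h; move: pos; rewrite (Qeq_eqR _ _ h) RMicromega.Q2R_0; lra.
by rewrite !Q2R_poch E !alphaE // /fcoef RdivE.
Qed.

Lemma Q2R_phi_partial j (beta : Q) T : (j <= m)%N ->
  Q2R (phi_partial alpha j beta T) = (Phi (nat_frac R r s) j T).[Q2R beta]%R.
Proof.
move=> jm; rewrite /phi_partial Q2R_sum list_seqE /Phi horner_poly -(big_mkord xpredT
   (fun k => fcoef (nat_frac R r s) j k * Q2R beta ^+ k)%R) /index_iota subn0.
by apply: eq_bigr => k _; rewrite Q2R_mult Q2R_Qpower Q2R_coef // RpowE.
Qed.

Lemma Q2R_Lpart (ell : nat -> Z) (a : Z) (b : nat) T : (0 < b)%N ->
  Q2R (Lpart m alpha ell (Qmake a (Z.to_pos (Z.of_nat b))) T) = lfun m r s a b ell T.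
Proof.
move=> b0; rewrite /Lpart /lfun /Lam Q2R_plus Q2R_inject_Z Q2R_sum list_seqE intZE.
have bE : Q2R (Qmake a (Z.to_pos (Z.of_nat b))) = ((intZ a)%:~R / b%:R)%R.
  rewrite intZE natr_INR -RdivE /Q2R /= Z2Pos.id; last by lia.
  by rewrite -INR_IZR_INZ.
rewrite RplusE; congr (_ + _)%R.
rewrite /index_iota subSS subn0 !big_seq; apply: eq_bigr => j; rewrite mem_iota => jP.
rewrite Q2R_mult Q2R_inject_Z Q2R_phi_partial; last by lia.
by rewrite bE (intZE (ell j)).
Qed.

End LinearFormValue.

Lemma prime_nat_Z (p : nat) : Znumtheory.prime (Z.of_nat p) -> prime.prime p.
Proof.
move=> pp; have p2 := prime_ge_2 _ pp.
apply/primeP; split; first by lia.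
move=> d dp; have d0 : (0 < d)%N by apply: dvdn_gt0 dp; lia.
have := prime_divisors _ pp _ (proj1 (dvdn_Zdivide d p) dp).
by move=> H; apply/orP; case: H => [|[|[|]]] h; [lia | left; apply/eqP; lia | right; apply/eqP; lia | lia].
Qed.

Lemma pval_logn (p n : nat) : prime.prime p -> (0 < n)%N -> pval (Z.of_nat p) (Z.of_nat n) = logn p n.
Proof.
move=> pp n0; have [c pc nE] := pfactor_coprime pp n0.
apply: (@pval_unique _ _ (Z.of_nat c)).
- by have := prime_gt1 pp; lia.
- by lia.
- rewrite {1}nE Nat2Z.inj_mul Z.mul_comm -Nat2Z.inj_pow; congr (Z.mul (Z.of_nat _) _).
  by elim: (logn p n) => //= k IH; rewrite expnS IH.
by move=> /dvdn_Zdivide; apply/negP; rewrite -prime_coprime.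
Qed.

Lemma INR_to_nat (z : Z) : Z.le Z0 z -> INR (Z.to_nat z) = IZR z.
Proof. by move=> z0; rewrite INR_IZR_INZ Z2Nat.id. Qed.

Lemma dvdn_to_nat (x y : Z) : Z.le Z0 x -> Z.le Z0 y -> Z.divide x y -> (Z.to_nat x %| Z.to_nat y)%N.
Proof. by move=> x0 y0 h; apply/dvdn_Zdivide; rewrite !Z2Nat.id. Qed.

Lemma coprime_to_nat (x y : Z) : Z.le Z0 x -> Z.le Z0 y -> Z.gcd x y = Zpos xH ->
  coprime (Z.to_nat x) (Z.to_nat y).
Proof.
move=> x0 y0 h; rewrite /coprime.
have h1 : Z.divide (Z.of_nat (gcdn (Z.to_nat x) (Z.to_nat y))) (Z.gcd x y).
  apply: Z.gcd_greatest; [rewrite -{2}(Z2Nat.id x) // | rewrite -{2}(Z2Nat.id y) //];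
    apply/dvdn_Zdivide; [exact: dvdn_gcdl | exact: dvdn_gcdr].
rewrite h in h1; have {}h1 := Z.divide_1_r_nonneg _ (Nat2Z.is_nonneg _) h1.
by apply/eqP; apply: Nat2Z.inj; rewrite h1.
Qed.

(** * The linear forms for the data of the theorem *)

Section Interface.
Variables (m : nat) (alpha : nat -> Q) (p a b : Z) (ell : nat -> Z) (nn : nat -> nat).
Variables (theta Rm Mx : R).
Notation N := (Ntot m nn).
Hypothesis m_gt0 : (1 <= m)%coq_nat.
Hypothesis alpha_pos : forall j, (j <= m)%coq_nat -> Qlt (Qmake Z0 xH) (alpha j).
Hypothesis alpha_nint : forall i j, (1 <= i)%coq_nat -> (i < j)%coq_nat -> (j <= m)%coq_nat ->
  ~ (exists z : Z, Qeq (Qminus (alpha i) (alpha j)) (inject_Z z)).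
Hypothesis p_prime : Znumtheory.prime p.
Hypothesis a_neq0 : a <> Z0.
Hypothesis b_ge1 : Z.le (Zpos xH) b.
Hypothesis ab_coprime : Z.gcd a b = Zpos xH.
Hypothesis b_le_a : Z.le b (Z.abs a).
Hypothesis sl_a : (pval p (s_l m alpha) < pval p a)%coq_nat.
Hypothesis sl_a2 : p = Zpos (xO xH) -> Z.even (s_l m alpha) = true ->
  (pval p (s_l m alpha) + 2 <= pval p a)%coq_nat.
Hypothesis ell_neq0 : exists i, (i <= m)%coq_nat /\ ell i <> Z0.
Hypothesis nn_gt0 : forall j, (j <= m)%coq_nat -> (0 < nn j)%coq_nat.
Hypothesis nn_le : forall j, (j <= m)%coq_nat -> (nn j <= nn 0%N)%coq_nat.
Notation X := (IZR (UU m alpha) + IZR (VV m alpha) * INR N).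
Hypothesis pi_le : INR (prime_pi X) <= theta * X / ln X.
Hypothesis X_ge2 : 2 <= X.
Hypothesis al_le : forall j, (1 <= j)%coq_nat /\ (j <= m)%coq_nat -> Q2R (alpha j) <= Rm.
Hypothesis MxP : forall j, (j <= m)%coq_nat ->
  IZR (Z.abs (ell j)) * (IZR (Z.abs a) ^ Nat.sub N (nn j) * IZR b ^ nn j) <= Mx.

Let r j := Z.to_nat (rZ alpha j).
Let s j := Z.to_nat (sZ alpha j).
Let u j := Z.to_nat (uZ alpha j).
Let v j := Z.to_nat (vZ alpha j).

Lemma padic_forms : exists A B : Z, A <> Z0 /\
  Rabs (IZR A) <= (IZR (sZ alpha 0%N) * epsilon (sZ alpha 0%N) *
      (IZR (d_l m alpha) * IZR (VV m alpha) * epsilon (s_l m alpha)) *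
      (IZR (dtilde m alpha) * epsilon (s_l m alpha))) ^ N *
     exp (theta * X) *
     ((INR N + 1) ^ 3 * exp (2 * (Q2R (alpha 0%N) + INR N) + INR m * (Rm + INR N))) *
     ((INR m + 1) * Mx) /\
  forall T, (N <= T)%coq_nat -> exists c z : Z, ~ Z.divide p c /\
    IZR c * (IZR B * Q2R (Lpart m alpha ell (Qmake a (Z.to_pos b)) T) - IZR A)
      = IZR p ^ Nat.sub (Nat.mul N (pval p a)) 1 * IZR z.
Proof.
have m0 : (0 < m)%N by lia.
have ap j : (j <= m)%N -> Qlt (Qmake Z0 xH) (alpha j) by move=> jm; apply: alpha_pos; lia.
have rpos j : (j <= m)%N -> Z.lt Z0 (rZ alpha j) by move=> jm; apply: Qred_num_pos; apply: ap.
have upos j : (j <= m)%N -> Z.lt Z0 (uZ alpha j).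
  move=> jm; apply: Qred_num_pos.
  have h1 := ap j jm; have h2 := ap 0%N (leq0n m).
  apply: (Qlt_le_trans _ (alpha j)) => //.
  rewrite -{1}(Qplus_0_r (alpha j)); apply: Qplus_le_compat; [exact: Qle_refl | exact: Qlt_le_weak].
have spos j : Z.lt Z0 (sZ alpha j) by [].
have vpos j : Z.lt Z0 (vZ alpha j) by [].
have slpos := sl_pos m alpha; have dlpos := dl_pos m alpha; have dtpos := dtilde_pos m alpha.
have V1 : Z.le (vZ alpha 1%N) (VV m alpha) by apply: (maxZ_ge m (vZ alpha)); lia.
have Vpos : Z.lt Z0 (VV m alpha) by have := vpos 1%N; lia.
have U1 : Z.le (uZ alpha 1%N) (UU m alpha) by apply: (maxZ_ge m (uZ alpha)); lia.
have Upos : Z.lt Z0 (UU m alpha) by have := upos 1%N m0; lia.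
have alE j : (j <= m)%N -> Q2R (alpha j) = nat_frac R r s j.
  move=> jm; rewrite Q2R_Qred /nat_frac !natr_INR -RdivE /r /s !INR_to_nat //.
  by have := rpos j jm; lia.
pose sl := Z.to_nat (s_l m alpha); pose dt := Z.to_nat (dtilde m alpha).
pose U := Z.to_nat (UU m alpha); pose V := Z.to_nat (VV m alpha).
(* A bound for the [s_j] by [s_le_dV]. *)
pose S := Z.to_nat (Z.mul (d_l m alpha) (VV m alpha)).
pose pn := Z.to_nat p; pose bn := Z.to_nat b.
have p2 := prime_ge_2 p p_prime.
have pE : p = Z.of_nat pn by rewrite /pn Z2Nat.id; lia.
have bE : b = Z.of_nat bn by rewrite /bn Z2Nat.id; lia.
have pp : prime.prime pn by apply: prime_nat_Z; rewrite -pE.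
have XE : INR (U + V * N) = X.
  by rewrite plus_INR mult_INR /U /V !INR_to_nat //; lia.
have slE : pval p (s_l m alpha) = logn pn sl.
  by rewrite -pval_logn // -?pE /sl ?Z2Nat.id //; lia.
have aE : pval p a = logn pn (Z.abs_nat a).
  rewrite -pval_logn // -?pE; last by lia.
  rewrite Zabs2Nat.id_abs.
  have [c [ac pc]] := pval_spec p a (ltac:(lia)) a_neq0.
  symmetry; apply: (@pval_unique _ _ (Z.abs c)); [lia | lia | | ].
    by rewrite {1}ac Z.abs_mul Z.abs_pow (Z.abs_eq p) //; lia.
  by rewrite Z.divide_abs_r.
have sl0 : (0 < sl)%N by rewrite /sl; lia.
have dt0 : (0 < dt)%N by rewrite /dt; lia.
have V0 : (0 < V)%N by rewrite /V; lia.
have S0 : (0 < S)%N by rewrite /S; nia.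
have r0 j : (j <= m)%N -> (0 < r j)%N by move=> jm; rewrite /r; have := rpos j jm; lia.
have s0 j : (j <= m)%N -> (0 < s j)%N by move=> jm; rewrite /s; have := spos j; lia.
have u0 j : (1 <= j <= m)%N -> (0 < u j)%N.
  by move=> jm; rewrite /u; have := upos j; move=> /(_ (ltac:(lia))); lia.
have v0 j : (1 <= j <= m)%N -> (0 < v j)%N by move=> jm; rewrite /v; have := vpos j; lia.
have uvE j : (1 <= j <= m)%N -> nat_frac R r s j + nat_frac R r s 0%N = INR (u j) / INR (v j).
  move=> jm; have jm' : (j <= m)%N by lia.
  rewrite -!alE // -Q2R_plus Q2R_Qred /u /v !INR_to_nat //.
  by have := upos j jm'; lia.
have uv j : (1 <= j <= m)%N -> coprime (u j) (v j).
  move=> jm; apply: coprime_to_nat; [have := upos j; move=> /(_ (ltac:(lia))); lia | by [] |].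
  exact: Qred_coprime.
have sdt j : (1 <= j <= m)%N -> (s j %| dt * v j)%N.
  move=> jm; have h := s_divide_dtilde m alpha j (ltac:(lia)); have vj := vpos j.
  rewrite /s /dt /v -[(_ * _)%N]Z2Nat.inj_mul; [|lia|lia].
  by apply: dvdn_to_nat => //; nia.
have ssl j : (1 <= j <= m)%N -> (s j %| sl)%N.
  move=> jm; apply: dvdn_to_nat; [by [] | lia | ].
  by apply: (lcmZ_divide m (sZ alpha)); lia.
have sS j : (1 <= j <= m)%N -> (s j <= S)%N.
  by move=> jm; rewrite /s /S; have := s_le_dV m alpha j (ltac:(lia)); lia.
have uU j : (1 <= j <= m)%N -> (u j <= U)%N.
  by move=> jm; rewrite /u /U; have := maxZ_ge m (uZ alpha) j (ltac:(lia)); rewrite -/(UU _ _); lia.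
have vV j : (1 <= j <= m)%N -> (v j <= V)%N.
  by move=> jm; rewrite /v /V; have := maxZ_ge m (vZ alpha) j (ltac:(lia)); rewrite -/(VV _ _); lia.
have nint i j : (1 <= i <= m)%N -> (1 <= j <= m)%N -> i <> j ->
    forall x y : nat, nat_frac R r s i + INR x <> nat_frac R r s j + INR y.
  have H i' j' : (1 <= i')%N -> (i' < j')%N -> (j' <= m)%N ->
      forall x y : nat, nat_frac R r s i' + INR x <> nat_frac R r s j' + INR y.
    move=> i1 ij jm x y E; apply: (alpha_nint (i := i') (j := j')); [lia | lia | lia |].
    exists (Z.sub (Z.of_nat y) (Z.of_nat x)); apply: eqR_Qeq.
    rewrite Q2R_minus Q2R_inject_Z minus_IZR -!INR_IZR_INZ !alE //; first by lra.
    by lia.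
  move=> iP jP ij x y; case: (ltngtP i j) => // h; first by apply: H; lia.
  by move=> E; apply: (H j i) (esym E); lia.
have nn0 j : (j <= m)%N -> (0 < nn j)%N by move=> jm; have := nn_gt0 (j := j); lia.
have nnl j : (j <= m)%N -> (nn j <= nn 0)%N by move=> jm; have := nn_le (j := j); lia.
have b0 : (0 < bn)%N by rewrite /bn; lia.
have ba : (bn <= Z.abs_nat a)%N by rewrite /bn; lia.
(* [p] divides [a], since [pval p a] is positive, and [a] is prime to [b]. *)
have pb : ~~ (pn %| bn)%N.
  apply/negP => /dvdn_Zdivide; rewrite -pE -bE => pb.
  have pa : Z.divide p a.
    have [c [ac _]] := pval_spec p a (ltac:(lia)) a_neq0.
    have [k kE] : exists k, pval p a = k.+1 by exists (pval p a).-1; lia.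
    rewrite ac kE Nat2Z.inj_succ Z.pow_succ_r; last by lia.
    by exists (Z.mul (Z.pow p (Z.of_nat k)) c); lia.
  have := Z.gcd_greatest _ _ _ pa pb; rewrite ab_coprime => /Z.divide_1_r; lia.
have dsl : (dt %| sl)%N.
  by apply: dvdn_to_nat; [lia | lia | exact: dtilde_divide_sl].
have sla : (logn pn sl < logn pn (Z.abs_nat a))%N by rewrite -slE -aE; lia.
have sla2 : pn = 2%N -> (2 %| sl)%N -> (logn pn sl + 2 <= logn pn (Z.abs_nat a))%N.
  move=> pn2 d2; rewrite -slE -aE.
  have := sl_a2; rewrite pE pn2 => /(_ erefl) h; have : Z.even (s_l m alpha) = true; last by move/h; lia.
  apply/Zeven_bool_iff/Zeven_ex_iff; have [k kE] := proj1 (dvdn_Zdivide 2 sl) d2.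
  by exists k; rewrite /sl Z2Nat.id in kE; lia.
have ell0 : exists2 i, (i <= m)%N & ell i <> Z0.
  by have [i [im li]] := ell_neq0; exists i => //; lia.
have alle j : (1 <= j <= m)%N -> nat_frac R r s j <= Rm.
  by move=> jm; rewrite -alE; [apply: al_le; lia | lia].
have Lb : INR (Llcm (U + V * N)) <= exp (theta * INR (U + V * N)).
  apply: Llcm_bound; last by rewrite XE.
  by apply/ssrnat.leP; apply: INR_le; rewrite XE /=; lra.
have MxP' j : (j <= m)%N ->
    IZR (Z.abs (ell j)) * (IZR (Z.abs a) ^ (N - nn j) * INR bn ^ nn j) <= Mx.
  by move=> jm; have := MxP (j := j); rewrite bE -INR_IZR_INZ => h; apply: h; lia.
have [A [B [A0 AB hT]]] := linear_forms sl0 dt0 V0 S0 r0 s0 u0 v0 uvE uv sdt ssl sS uU vV nint nn0 nnl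
  b0 ba pp a_neq0 pb dsl sla sla2 ell0 alle Lb MxP'.
exists A, B; split => //; split.
  apply: Rle_trans AB _; right.
  rewrite XE !S_INR -alE // /s /S /dt /sl !INR_to_nat ?Z2Nat.id ?mult_IZR //; lia.
move=> T NT; have [|c [z [pc cz]]] := hT T; first by lia.
exists c, z; split; first by rewrite pE.
rewrite {1}bE (Q2R_Lpart ap alE) // cz aE pE -INR_IZR_INZ.
by [].
Qed.

End Interface.

Lemma Ntot0 nn : Ntot 0 nn = nn 0%N.
Proof. by rewrite /Ntot big_nat1. Qed.

Lemma NtotS m nn : Ntot m.+1 nn = Nat.add (Ntot m nn) (nn m.+1).
Proof. by rewrite /Ntot big_nat_recr. Qed.

End Forms.

(** * Choice of the degrees *)

Lemma sum_f_R0_Ntot (m : nat) (nn : nat -> nat) :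
  INR (Pade.Ntot m nn) = sum_f_R0 (fun j => INR (nn j)) m.
Proof.
induction m as [|m IH]; [now rewrite Forms.Ntot0|].
rewrite Forms.NtotS, plus_INR, IH; reflexivity.
Qed.

(** The degrees are the floors of [(g j + t) / la]. They are positive because [la <= t], and [nn 0]
    is the largest because [g 0] is: both are needed for lowering one degree. In the last bound
    [INR m + 1] counts the floors. *)
Lemma degrees_exist (m : nat) (g : nat -> R) (la t : R) :
  0 < la -> la <= t -> (forall j, (j <= m)%nat -> 0 <= g j <= g 0%nat) ->
  exists nn : nat -> nat,
    (forall j, (j <= m)%nat -> (0 < nn j)%nat /\ (nn j <= nn 0%nat)%nat /\
       INR (nn j) * la <= g j + t < (INR (nn j) + 1) * la) /\
    INR (Pade.Ntot m nn) * la <= sum_f_R0 g m + (INR m + 1) * t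
      < (INR (Pade.Ntot m nn) + INR m + 1) * la.
Proof.
intros Hla Ht Hg.
exists (fun j => Z.to_nat (Int_part ((g j + t) / la))).
assert (B : forall j, (j <= m)%nat ->
  INR (Z.to_nat (Int_part ((g j + t) / la))) = IZR (Int_part ((g j + t) / la))
  /\ (0 < Int_part ((g j + t) / la))%Z
  /\ IZR (Int_part ((g j + t) / la)) * la <= g j + t < (IZR (Int_part ((g j + t) / la)) + 1) * la).
{ intros j Hj; destruct (Hg j Hj) as [H0 _].
  destruct (base_Int_part ((g j + t) / la)) as [H1 H2].
  set (k := Int_part ((g j + t) / la)) in *.
  assert (Ex : (g j + t) / la * la = g j + t) by (field; lra).
  assert (H3 : 1 <= (g j + t) / la).
  { apply Rmult_le_reg_r with la; [lra|]; rewrite Ex; lra. }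
  assert (Hk : (0 < k)%Z) by (apply lt_IZR; lra).
  split; [rewrite INR_IZR_INZ, Z2Nat.id; [reflexivity | lia]|].
  split; [exact Hk|]; rewrite <- Ex; split.
  - apply Rmult_le_compat_r; lra.
  - apply Rmult_lt_compat_r; lra. }
split.
- intros j Hj; destruct (B j Hj) as [E [P [L1 L2]]]; rewrite E.
  split; [lia|]; split; [|split; assumption].
  apply INR_le; rewrite E; destruct (B 0%nat ltac:(lia)) as [E0 [P0 [L3 L4]]]; rewrite E0.
  apply IZR_le; apply Zlt_succ_le; apply lt_IZR; rewrite succ_IZR.
  apply Rmult_lt_reg_r with la; [lra|]; destruct (Hg j Hj); lra.
- rewrite sum_f_R0_Ntot.
  assert (G : forall k, (k <= m)%nat ->
    sum_f_R0 (fun j => INR (Z.to_nat (Int_part ((g j + t) / la)))) k * la <= sum_f_R0 g k + (INR k + 1) * t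
    < (sum_f_R0 (fun j => INR (Z.to_nat (Int_part ((g j + t) / la)))) k + INR k + 1) * la).
  { induction k as [|k IH]; intros Hk.
    - cbn [sum_f_R0]; destruct (B 0%nat Hk) as [E [_ [L1 L2]]]; rewrite E; cbn [INR]; lra.
    - destruct (B (S k) Hk) as [E [_ [L1 L2]]]; specialize (IH ltac:(lia)).
      rewrite !tech5, E, S_INR; lra. }
  apply G; lia.
Qed.

Definition height (m : nat) (ell : nat -> Z) (j : nat) : Z :=
  match j with O => h0 m ell | S _ => Z.max 1 (Z.abs (ell j)) end.

Lemma h0_ge (m : nat) (ell : nat -> Z) (j : nat) : (j <= m)%nat -> (Z.abs (ell j) <= h0 m ell)%Z.
Proof.
intros Hj; unfold h0.
assert (Hin : In j (seq 0 (S m))) by (apply in_seq; lia).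
revert Hin; generalize (seq 0 (S m)); intros l; induction l as [|i l IH]; [easy|].
intros [->|Hin]; cbn [map fold_right]; [lia | specialize (IH Hin); lia].
Qed.

Lemma ln_Htilde (m : nat) (ell : nat -> Z) : (1 <= h0 m ell)%Z ->
  (1 <= Htilde m ell)%Z /\
  ln (IZR (Htilde m ell)) = sum_f_R0 (fun j => ln (IZR (height m ell j))) m.
Proof.
intros H0.
set (f := fun j => Z.max 1 (Z.abs (ell j))).
assert (A : forall l x, fold_right Z.mul x (map f l) = (fold_right Z.mul 1 (map f l) * x)%Z).
{ induction l as [|i l IH]; intros x; cbn [map fold_right]; [lia | rewrite IH; ring]. }
assert (P : forall k, (1 <= fold_right Z.mul 1 (map f (seq 1 k)))%Z /\
  ln (IZR (h0 m ell * fold_right Z.mul 1%Z (map f (seq 1 k)))) =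
  sum_f_R0 (fun j => ln (IZR (height m ell j))) k).
{ induction k as [|k [IH1 IH2]].
  - cbn [seq map fold_right sum_f_R0]; rewrite Z.mul_1_r; split; [lia | reflexivity].
  - rewrite seq_S, map_app, fold_right_app, A; cbn [map fold_right].
    assert (F : (1 <= f (1 + k)%nat)%Z) by (unfold f; lia).
    rewrite Z.mul_1_r; split; [nia|].
    rewrite Z.mul_assoc, mult_IZR, ln_mult, IH2; [reflexivity | |]; apply (IZR_lt 0); nia. }
destruct (P m) as [P1 P2]; unfold Htilde; fold f; split; [nia | exact P2].
Qed.

Lemma epsilon_ge1_Z (z : Z) : (0 < z)%Z -> 1 <= epsilon z.
Proof.
intros Hz; rewrite <- (Z2Nat.id z) by lia.
apply Forms.epsilon_ge1; assert (0 < Z.to_nat z)%nat by lia.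
destruct (Z.to_nat z); [lia | reflexivity].
Qed.

Lemma nn_le_Ntot_nat (m : nat) (nn : nat -> nat) (j : nat) : (j <= m)%nat -> (nn j <= Pade.Ntot m nn)%nat.
Proof.
induction m as [|m IH]; intros Hj.
- replace j with 0%nat by lia; rewrite Forms.Ntot0; lia.
- rewrite Forms.NtotS; destruct (Nat.eq_dec j (S m)) as [->|E]; [lia | specialize (IH ltac:(lia)); lia].
Qed.

Lemma term_le_sum (g : nat -> R) (m j : nat) : (forall i, (i <= m)%nat -> 0 <= g i) ->
  (j <= m)%nat -> g j <= sum_f_R0 g m.
Proof.
intros Hg; revert j; induction m as [|m IH]; intros j Hj.
- replace j with 0%nat by lia; cbn; lra.
- rewrite tech5; assert (H1 := Hg (S m) ltac:(lia)).
  assert (Hg' : forall i, (i <= m)%nat -> 0 <= g i) by (intros; apply Hg; lia).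
  destruct (Nat.eq_dec j (S m)) as [->|E].
  + assert (0 <= sum_f_R0 g m) by (specialize (IH Hg' 0%nat ltac:(lia)); specialize (Hg' 0%nat ltac:(lia)); lra).
    lra.
  + specialize (IH Hg' j ltac:(lia)); lra.
Qed.

Lemma pow_exp_ln (x : R) (n : nat) : 0 < x -> x ^ n = exp (INR n * ln x).
Proof. intros Hx; rewrite <- Rpower_pow by exact Hx; reflexivity. Qed.

Lemma maxZ_nonneg (m : nat) (f : nat -> Z) : (0 <= maxZ m f)%Z.
Proof. unfold maxZ; induction (seq 1 m); cbn; lia. Qed.

Lemma Q2R_le_num (q : Q) : (0 < q)%Q -> Q2R q <= IZR (Qnum (Qred q)).
Proof.
intros Hq; rewrite Q2R_Qred; assert (H := Qred_num_pos q Hq).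
set (x := Qnum (Qred q)) in *; set (y := Zpos (Qden (Qred q))).
assert (1 <= IZR y) by (apply (IZR_le 1); unfold y; lia).
assert (0 < IZR x) by (apply (IZR_lt 0); lia).
apply Rmult_le_reg_r with (IZR y); [lra|].
unfold Rdiv; rewrite Rmult_assoc, Rinv_l by lra; nra.
Qed.

Lemma eventually_const_cv (u : nat -> R) (l : R) (N : nat) :
  (forall n, (N <= n)%nat -> u n = l) -> Un_cv u l.
Proof.
intros H eps He; exists N; intros n Hn; rewrite (H n) by lia.
unfold Rdist; rewrite Rminus_diag, Rabs_R0; exact He.
Qed.

(** * The constants as sums of logarithms *)

Section Constants.
Variables (m : nat) (alpha : nat -> Q) (theta : R).
Hypothesis theta_gt1 : 1 < theta.

Notation ls0 := (ln (IZR (sZ alpha 0))).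
Notation le0 := (ln (epsilon (sZ alpha 0))).
Notation lev := (ln (epsilon (v_l m alpha))).
Notation les := (ln (epsilon (s_l m alpha))).
Notation ld := (ln (IZR (d_l m alpha))).
Notation ldt := (ln (IZR (dtilde m alpha))).

Lemma IZR_pos_ge1 (z : Z) : (0 < z)%Z -> 1 <= IZR z.
Proof. intros; apply (IZR_le 1); lia. Qed.

Lemma c3_eq : c3 m alpha = 2 * ls0 + le0 + lev.
Proof.
assert (H1 := IZR_pos_ge1 (sZ alpha 0) eq_refl).
assert (H2 := epsilon_ge1_Z (sZ alpha 0) eq_refl).
assert (H3 := epsilon_ge1_Z (v_l m alpha) (vl_pos m alpha)).
unfold c3; assert (0 < IZR (sZ alpha 0) ^ 2) by (apply pow_lt; lra).
rewrite !ln_mult, ln_pow by (try apply Rmult_lt_0_compat; lra); cbn [INR]; lra.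
Qed.

Lemma ldt_eq : ldt = ld - ln (IZR (Z.gcd (d_l m alpha) (sZ alpha 0))).
Proof.
assert (E := dtilde_eq m alpha).
assert (H1 := IZR_pos_ge1 _ (dtilde_pos m alpha)).
assert (H2 := IZR_pos_ge1 _ (gcd_pos m alpha)).
rewrite E at 1; rewrite mult_IZR, ln_mult by lra; lra.
Qed.

Lemma c4_eq : c4 m alpha theta = theta * IZR (VV m alpha) + (ldt + les).
Proof.
assert (H1 := IZR_pos_ge1 _ (dl_pos m alpha)).
assert (H2 := IZR_pos_ge1 _ (gcd_pos m alpha)).
assert (H3 := epsilon_ge1_Z (s_l m alpha) (sl_pos m alpha)).
unfold c4, Rdiv; rewrite !ln_mult, ln_Rinv, ldt_eq; try lra.
- apply Rmult_lt_0_compat; lra.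
- apply Rinv_0_lt_compat; lra.
Qed.

Lemma c6_eq : c6 m alpha theta = 2 * theta * IZR (sZ alpha 0) + (ld + les - ls0).
Proof.
assert (H1 := IZR_pos_ge1 _ (dl_pos m alpha)).
assert (H2 := IZR_pos_ge1 (sZ alpha 0) eq_refl).
assert (H3 := epsilon_ge1_Z (s_l m alpha) (sl_pos m alpha)).
unfold c6, Rdiv; rewrite !ln_mult, ln_Rinv; try lra.
- apply Rmult_lt_0_compat; lra.
- apply Rinv_0_lt_compat; lra.
Qed.

Lemma c8_add2 : c8 m alpha theta + 2 =
  2 * ls0 + le0 + lev + (theta * IZR (VV m alpha) + (ldt + les))
   + (2 * theta * IZR (sZ alpha 0) + (ld + les - ls0)) + INR m * theta * IZR (VV m alpha) + 3 + 2.
Proof. unfold c8, c7; rewrite c3_eq, c4_eq, c6_eq; ring. Qed.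

Lemma c8_ge0 : 0 <= c8 m alpha theta + 2.
Proof.
rewrite c8_add2.
assert (H1 := ln_ge0 _ (IZR_pos_ge1 _ (dl_pos m alpha))).
assert (H2 := ln_ge0 _ (IZR_pos_ge1 (sZ alpha 0) eq_refl)).
assert (H3 := ln_ge0 _ (epsilon_ge1_Z (s_l m alpha) (sl_pos m alpha))).
assert (H4 := ln_ge0 _ (epsilon_ge1_Z (sZ alpha 0) eq_refl)).
assert (H5 := ln_ge0 _ (epsilon_ge1_Z (v_l m alpha) (vl_pos m alpha))).
assert (H6 := ln_ge0 _ (IZR_pos_ge1 _ (dtilde_pos m alpha))).
assert (H7 := IZR_pos_ge1 (sZ alpha 0) eq_refl).
assert (H8 : 0 <= IZR (VV m alpha)) by (apply (IZR_le 0), maxZ_nonneg).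
assert (0 <= theta * IZR (VV m alpha)) by (apply Rmult_le_pos; lra).
assert (0 <= INR m * theta * IZR (VV m alpha)).
{ rewrite Rmult_assoc; apply Rmult_le_pos; [apply pos_INR | lra]. }
assert (0 <= 2 * theta * IZR (sZ alpha 0)) by (apply Rmult_le_pos; lra).
lra.
Qed.

End Constants.

(** The absolute values are powers of [p], so strictness is worth one more factor [p]. The case
    [k = 1] is for [p = 2] and even [s], where [two_factor] is [/ 2]. *)
Lemma padicZ_lt_pval (p x y : Z) (k : nat) : (1 < p)%Z -> x <> 0%Z -> y <> 0%Z ->
  padicZ p x < / (IZR p ^ k) * padicZ p y -> (pval p y + k < pval p x)%nat.
Proof.
intros Hp Hx Hy; unfold padicZ.
destruct (Z.eqb_spec x 0); [contradiction|]; destruct (Z.eqb_spec y 0); [contradiction|].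
rewrite <- Rinv_mult, <- pow_add; intros H.
assert (P : 1 < IZR p) by (apply (IZR_lt 1); lia).
destruct (Nat.lt_ge_cases (pval p y + k) (pval p x)) as [L|L]; [exact L|].
exfalso; apply Rlt_not_le in H; apply H.
apply Rinv_le_contravar; [apply pow_lt; lra|].
apply Rle_pow; [lra | lia].
Qed.

Theorem theorem5 (m : nat) (alpha : nat -> Q) (theta ctheta : R)
  (p : Z) (tau delta : R) (a b : Z) :
  (1 <= m)%nat ->
  (forall j, (j <= m)%nat -> (0 < alpha j)%Q) ->
  (forall i j, (1 <= i)%nat -> (i < j)%nat -> (j <= m)%nat ->
     ~ (exists z : Z, (alpha i - alpha j == inject_Z z)%Q)) ->
  1 < theta -> 2 <= ctheta ->
  (forall x : R, ctheta <= x -> INR (prime_pi x) <= theta * x / ln x) ->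
  prime p ->
  0 < tau -> 0 <= delta ->
  4 * delta * (1 + (INR m + 1) * tau) < tau ->
  a <> 0%Z -> (1 <= b)%Z -> Z.gcd a b = 1%Z ->
  padicZ p a < two_factor p (s_l m alpha) * padicZ p (s_l m alpha) ->
  padicZ p a <= Rpower (IZR (Z.abs a)) (-1 + delta) ->
  Rpower (IZR b) (2 * (1 + 1 / tau))
    * exp (2 * (c2 m alpha theta * (1 + 1 / tau)
                + (c8 m alpha theta + 2) * (INR m + 1 + 1 / tau)))
    < IZR (Z.abs a) ->
  forall ell : nat -> Z,
    (exists i, (i <= m)%nat /\ ell i <> 0%Z) ->
    exp (logH0 m alpha theta ctheta tau p a) <= IZR (Htilde m ell) ->
    exists l : R,
      Un_cv (fun N => padicQ p (Lpart m alpha ell (Qmake a (Z.to_pos b)) N)) l /\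
      Rpower (IZR (Htilde m ell)) (-1 - (INR m + 1) * tau) < l.
Proof.
intros Hm Hpos Hnint Hth Hct Hpi Hp Htau Hdelta Hdt Ha Hb Hgcd Hpa Hpa2 Hbig ell Hell HH.
assert (Hp2 := prime_ge_2 p Hp); assert (Hp1 : (1 < p)%Z) by lia.
assert (Hslpos := sl_pos m alpha); assert (Hdlpos := dl_pos m alpha).
assert (Hdtpos := dtilde_pos m alpha).
assert (M1 : 1 <= INR m) by (apply (le_INR 1); exact Hm).
assert (HC := c8_ge0 m alpha theta Hth).
assert (Hc2 : 0 <= c2 m alpha theta).
{ unfold c2, SS; repeat apply Rmult_le_pos; try lra; apply (IZR_le 0), maxZ_nonneg. }
assert (HV1 : 1 <= IZR (VV m alpha)).
{ apply (IZR_le 1); apply Z.le_trans with (vZ alpha 1); [unfold vZ; lia|].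
  apply (maxZ_ge m (vZ alpha)); lia. }
assert (HU0 : 0 <= IZR (UU m alpha)) by (apply (IZR_le 0), maxZ_nonneg).
assert (HR0 : 0 <= IZR (RR m alpha)) by (apply (IZR_le 0), maxZ_nonneg).
assert (HS0 : 0 <= IZR (SS m alpha)) by (apply (IZR_le 0), maxZ_nonneg).
assert (Habs : (1 <= Z.abs a)%Z) by lia.
assert (Habs' := IZR_le _ _ Habs).
set (la := ln (IZR (Z.abs a))) in *.
assert (Hb' := IZR_le _ _ Hb).
set (lb := ln (IZR b)).
assert (Hlb : 0 <= lb) by now apply ln_ge0.
assert (Hit : 0 < 1 / tau) by (apply Rdiv_lt_0_compat; lra).
assert (Hla2 : 2 * (1 + 1 / tau) * lb + 2 * (c2 m alpha theta * (1 + 1 / tau)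
   + (c8 m alpha theta + 2) * (INR m + 1 + 1 / tau)) < la).
{ unfold Rpower in Hbig; fold lb in Hbig; rewrite <- exp_plus in Hbig.
  apply ln_increasing in Hbig; [rewrite ln_exp in Hbig; exact Hbig | apply exp_pos]. }
assert (Hpos1 : 0 <= 2 * (c2 m alpha theta * (1 + 1 / tau)
   + (c8 m alpha theta + 2) * (INR m + 1 + 1 / tau))).
{ assert (0 <= c2 m alpha theta * (1 + 1 / tau)) by (apply Rmult_le_pos; lra).
  assert (0 <= (c8 m alpha theta + 2) * (INR m + 1 + 1 / tau)) by (apply Rmult_le_pos; lra); lra. }
assert (Hlbt : 2 * lb <= 2 * (1 + 1 / tau) * lb).
{ assert (0 <= 1 / tau * lb) by (apply Rmult_le_pos; lra); lra. }
assert (Hla : 0 < la) by lra.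
assert (Hba : (b <= Z.abs a)%Z).
{ apply le_IZR; left; apply ln_lt_inv; [lra | lra | fold lb la; lra]. }
set (va := pval p a) in *.
assert (Hva : (pval p (s_l m alpha) < va)%nat).
{ enough (pval p (s_l m alpha) + 0 < va)%nat by lia.
  apply padicZ_lt_pval; try lia; cbn [pow]; rewrite Rinv_1, Rmult_1_l.
  apply Rlt_le_trans with (1 := Hpa).
  assert (B := padicZ_bounds p (s_l m alpha) Hp1 ltac:(lia)).
  assert (0 < / IZR (Z.abs (s_l m alpha))) by (apply Rinv_0_lt_compat, (IZR_lt 0); lia).
  unfold two_factor; destruct (_ && _)%bool; lra. }
assert (Hva2 : p = 2%Z -> Z.even (s_l m alpha) = true -> (pval p (s_l m alpha) + 2 <= va)%nat).
{ intros E Hev; enough (pval p (s_l m alpha) + 1 < va)%nat by lia.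
  apply padicZ_lt_pval; try lia; rewrite pow_1.
  apply Rlt_le_trans with (1 := Hpa).
  unfold two_factor; rewrite Hev; rewrite E; cbn; lra. }
set (lp := ln (IZR p)).
assert (Hlp : 0 < lp) by (unfold lp; rewrite <- ln_1; apply ln_increasing; [lra | apply (IZR_lt 1); lia]).
assert (HIp : 0 < IZR p) by (apply (IZR_lt 0); lia).
assert (Hvla : (1 - delta) * la <= INR va * lp).
{ unfold padicZ in Hpa2; destruct (Z.eqb_spec a 0); [contradiction|]; fold va in Hpa2.
  rewrite pow_exp_ln in Hpa2 by lra; fold lp in Hpa2; rewrite <- exp_Ropp in Hpa2.
  unfold Rpower in Hpa2; fold la in Hpa2.
  destruct (Rle_or_lt ((1 - delta) * la) (INR va * lp)) as [L|L]; [exact L|].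
  exfalso; apply Rle_not_lt in Hpa2; apply Hpa2; apply exp_increasing; lra. }
(* [p] divides [a]. Thus one [la] is enough to pay for the factor [p] lost in the exponent
   [N * va - 1]. *)
assert (Hlpla : lp <= la).
{ apply ln_le; [exact HIp|]; apply IZR_le.
  apply Z.le_trans with (p ^ Z.of_nat va)%Z; [|apply pval_pow_le; lia].
  rewrite <- (Z.pow_1_r p) at 1; apply Z.pow_le_mono_r; lia. }
destruct Hell as [i0 [Hi0 Hi0']].
assert (Hh0 : (1 <= h0 m ell)%Z) by (assert (H := h0_ge m ell i0 Hi0); lia).
destruct (ln_Htilde m ell Hh0) as [HHt HlH].
assert (HHt' := IZR_le _ _ HHt).
set (lH := ln (IZR (Htilde m ell))) in *.
assert (HlogH : logH0 m alpha theta ctheta tau p a <= lH).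
{ unfold lH; rewrite <- (ln_exp (logH0 m alpha theta ctheta tau p a)).
  apply ln_le; [apply exp_pos | exact HH]. }
unfold logH0 in HlogH; fold la in HlogH.
assert (HT0 : 0 < 1 + (INR m + 1) * tau).
{ assert (0 < (INR m + 1) * tau) by (apply Rmult_lt_0_compat; lra); lra. }
assert (HA2 : 8 * la <= tau * lH).
{ assert (H : 8 * la / tau <= lH) by (eapply Rle_trans; [apply Rmax_r | exact HlogH]).
  replace (8 * la) with (tau * (8 * la / tau)) by (field; lra); apply Rmult_le_compat_l; lra. }
assert (HA1 : (N1 m alpha theta ctheta p a + INR m + 1) * la <= (1 + (INR m + 1) * tau) * lH).
{ assert (H : (N1 m alpha theta ctheta p a + INR m + 1) * la / (1 + (INR m + 1) * tau) <= lH)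
    by (eapply Rle_trans; [apply Rmax_l | exact HlogH]).
  replace ((N1 m alpha theta ctheta p a + INR m + 1) * la)
    with ((1 + (INR m + 1) * tau) * ((N1 m alpha theta ctheta p a + INR m + 1) * la / (1 + (INR m + 1) * tau)))
    by (field; lra).
  apply Rmult_le_compat_l; lra. }
assert (HlHpos : 0 < lH).
{ apply Rmult_lt_reg_l with tau; lra. }
set (g := fun j => ln (IZR (height m ell j))) in *.
assert (Hhj : forall j, (j <= m)%nat -> (1 <= height m ell j <= h0 m ell)%Z).
{ intros [|j] Hj; cbn [height]; [lia|]; assert (H := h0_ge m ell (S j) Hj); lia. }
assert (Hg : forall j, (j <= m)%nat -> 0 <= g j <= g 0%nat).
{ intros j Hj; destruct (Hhj j Hj) as [H1 H2]; unfold g; split.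
  - apply ln_ge0, (IZR_le 1), H1.
  - apply ln_le; [apply (IZR_lt 0); lia | apply IZR_le; exact H2]. }
destruct (degrees_exist m g la (tau * lH)) as [nn [Hnn HN]]; [exact Hla | lra | exact Hg |].
rewrite <- HlH in HN.
assert (HnnN := fun j => nn_le_Ntot_nat m nn j).
set (N := Pade.Ntot m nn) in *.
replace (lH + (INR m + 1) * (tau * lH)) with ((1 + (INR m + 1) * tau) * lH) in HN by ring.
destruct HN as [HN1 HN2].
(* The [m + 1] that [logH0] adds to [N1] pays for the rounding of the [m + 1] degrees. *)
assert (HNN : N1 m alpha theta ctheta p a <= INR N).
{ assert (H : (N1 m alpha theta ctheta p a + INR m + 1) * la < (INR N + INR m + 1) * la) by lra.
  apply Rmult_lt_reg_r in H; lra. }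
assert (HNc : (INR m + 1) * ctheta <= INR N).
{ eapply Rle_trans; [|exact HNN]; apply Rmax_l. }
assert (HNcc : Defs.c1 m alpha theta + c5 m alpha theta <= INR N).
{ eapply Rle_trans; [|exact HNN]; unfold N1; eapply Rle_trans; [|apply Rmax_r]; apply Rmax_l. }
assert (HNm : 2 * (INR m + 1) <= INR N).
{ eapply Rle_trans; [|exact HNc]; rewrite Rmult_comm; apply Rmult_le_compat_l; lra. }
assert (HNct : ctheta <= INR N).
{ assert (0 <= INR m * ctheta) by (apply Rmult_le_pos; lra); lra. }
(* Rounding down gives [n_j * la > g j + tau * lH - la], hence [g j + (N - n_j) * la < N * la + la -
   tau * lH]. The last summand bounds the powers of [b], by [n_j * la <= g j + tau * lH <= (1 + tau)
   * lH]. *)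
set (lM := INR N * la + la - tau * lH + (1 + tau) * (lH / la) * lb).
set (X := IZR (UU m alpha) + IZR (VV m alpha) * INR N).
(* The estimate of [prime_pi] applies at [X]; this is one use of [(m + 1) * ctheta] in [N1]. *)
assert (HX : ctheta <= X).
{ unfold X; assert (0 <= (IZR (VV m alpha) - 1) * INR N) by (apply Rmult_le_pos; lra); lra. }
assert (HM : forall j, (j <= m)%nat ->
  IZR (Z.abs (ell j)) * (IZR (Z.abs a) ^ (N - nn j) * IZR b ^ nn j) <= exp lM).
{ intros j Hj; destruct (Hnn j Hj) as [_ [_ [L1 L2]]].
  apply Rle_trans with (exp (g j) * (IZR (Z.abs a) ^ (N - nn j) * IZR b ^ nn j)).
  { apply Rmult_le_compat_r.
    - apply Rmult_le_pos; apply pow_le; lra.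
    - unfold g; rewrite exp_ln by (apply (IZR_lt 0); destruct (Hhj j Hj); lia).
      apply IZR_le; destruct j; cbn [height]; [apply h0_ge; lia | lia]. }
  rewrite !pow_exp_ln, <- !exp_plus by lra; fold la lb.
  rewrite minus_INR by (apply HnnN; exact Hj).
  assert (Gl : g j <= lH).
  { rewrite HlH; apply (term_le_sum g); [intros; apply Hg; assumption | exact Hj]. }
  assert (Nb : INR (nn j) * lb <= (1 + tau) * (lH / la) * lb).
  { apply Rmult_le_compat_r; [exact Hlb|].
    apply Rmult_le_reg_r with la; [exact Hla|].
    replace ((1 + tau) * (lH / la) * la) with ((1 + tau) * lH) by (field; lra); lra. }
  destruct (Rle_lt_or_eq_dec (g j + ((INR N - INR (nn j)) * la + INR (nn j) * lb)) lM) as [L|L].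
  - unfold lM; lra.
  - left; apply exp_increasing; exact L.
  - right; f_equal; exact L. }
destruct (@Forms.padic_forms m alpha p a b ell nn theta (IZR (RR m alpha)) (exp lM)) as
  [A [B [HA [HAB HT]]]]; try assumption.
{ exists i0; split; assumption. }
{ intros j Hj; apply Hnn; exact Hj. }
{ intros j Hj; apply Hnn; exact Hj. }
{ apply Hpi; exact HX. }
{ change (2 <= X); lra. }
{ intros j [Hj1 Hj2]; eapply Rle_trans; [apply Q2R_le_num, Hpos; exact Hj2|].
  apply IZR_le; apply (maxZ_ge m (rZ alpha)); lia. }
fold N va X in HAB, HT.
assert (B1 := IZR_pos_ge1 (sZ alpha 0) eq_refl).
assert (B2 := IZR_pos_ge1 _ Hdlpos); assert (B3 := IZR_pos_ge1 _ Hdtpos).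
assert (B4 := epsilon_ge1_Z (sZ alpha 0) eq_refl).
assert (B5 := epsilon_ge1_Z (s_l m alpha) Hslpos).
assert (B6 := epsilon_ge1_Z (v_l m alpha) (vl_pos m alpha)).
set (lK := ln (IZR (sZ alpha 0)) + ln (epsilon (sZ alpha 0))
  + (ln (IZR (d_l m alpha)) + ln (IZR (VV m alpha)) + ln (epsilon (s_l m alpha)))
  + (ln (IZR (dtilde m alpha)) + ln (epsilon (s_l m alpha)))).
set (E := INR N * lK + theta * X + 3 * ln (INR N + 1)
  + (2 * (Q2R (alpha 0%nat) + INR N) + INR m * (IZR (RR m alpha) + INR N)) + ln (INR m + 1)).
assert (HAE : Rabs (IZR A) <= exp (E + lM)).
{ apply Rle_trans with (1 := HAB); right.
  unfold E; rewrite !exp_plus.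
  assert (P1 : IZR (sZ alpha 0) * epsilon (sZ alpha 0)
     * (IZR (d_l m alpha) * IZR (VV m alpha) * epsilon (s_l m alpha))
     * (IZR (dtilde m alpha) * epsilon (s_l m alpha)) = exp lK).
  { unfold lK; rewrite !exp_plus, !exp_ln by lra; reflexivity. }
  rewrite P1, (pow_exp_ln (exp lK)), ln_exp by apply exp_pos.
  rewrite (pow_exp_ln (INR N + 1)) by (assert (P := pos_INR N); lra).
  rewrite (exp_ln (INR m + 1)) by lra.
  rewrite <- (exp_plus (2 * _)); cbn [INR].
  replace (1 + 1 + 1) with 3 by ring; ring. }
assert (HE : E <= (c8 m alpha theta + 2) * INR N).
{ rewrite c8_add2 by exact Hth.
  unfold E, lK, X.
  apply (exponent_budget (INR m) (INR N) (IZR (rZ alpha 0)) (IZR (sZ alpha 0)) (Q2R (alpha 0%nat))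
     (IZR (RR m alpha)) (IZR (SS m alpha)) (IZR (UU m alpha)) (IZR (VV m alpha)));
   try assumption.
  - apply (IZR_le 0); assert (H := Qred_num_pos _ (Hpos 0%nat ltac:(lia))); unfold rZ; lia.
  - apply Q2R_le_num, Hpos; lia.
  - apply ln_le_sub1; lra.
  - apply ln_ge0; exact B6. }
assert (PB := parameter_balance la lb lH tau delta (c2 m alpha theta) (c8 m alpha theta + 2) (INR m + 1)
  (INR N) Hla Hlb HlHpos Htau Hdelta Hc2 HC ltac:(lra) Hdt Hla2 HA2 HN1).
(* The [2 * la] of [parameter_balance] are the rounding in [lM] and the factor [p] that is still to
   be lost. *)
assert (HEM : E + lM + la < (1 - delta) * (INR N * la)) by (unfold lM; lra).
assert (HNn : (1 <= N)%nat) by (apply INR_le; cbn [INR]; lra).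
assert (HEe : E + lM < INR (N * va - 1) * lp).
{ rewrite minus_INR, mult_INR by nia; cbn [INR].
  assert (INR N * ((1 - delta) * la) <= INR N * (INR va * lp))
    by (apply Rmult_le_compat_l; [apply pos_INR | exact Hvla]).
  lra. }
assert (HAp : (Z.abs A < p ^ Z.of_nat (N * va - 1))%Z).
{ apply lt_IZR; rewrite abs_IZR, <- pow_IZR, pow_exp_ln by exact HIp; fold lp.
  apply Rle_lt_trans with (1 := HAE); apply exp_increasing; exact HEe. }
assert (Hcl : forall T, (N <= T)%nat -> B <> 0%Z /\
  padicQ p (Lpart m alpha ell (Qmake a (Z.to_pos b)) T) = padicZ p A / padicZ p B).
{ intros T HTN; destruct (HT T HTN) as [c [z [Hc Hcz]]].
  destruct (Lpart m alpha ell (Qmake a (Z.to_pos b)) T) as [x d].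
  apply padicQ_close with c z (N * va - 1)%nat; try assumption.
  apply eq_IZR; rewrite !mult_IZR, minus_IZR, !mult_IZR, <- pow_IZR.
  unfold Q2R in Hcz; cbn [Qnum Qden] in Hcz.
  assert (IZR (Zpos d) <> 0) by (apply not_0_IZR; lia).
  rewrite <- Hcz; field; assumption. }
exists (padicZ p A / padicZ p B); split.
{ apply eventually_const_cv with N; intros T HTN; apply Hcl; exact HTN. }
destruct (Hcl N (Nat.le_refl N)) as [HB _].
assert (BA := padicZ_bounds p A Hp1 HA); assert (BB := padicZ_bounds p B Hp1 HB).
assert (PA : 0 < / IZR (Z.abs A)) by (apply Rinv_0_lt_compat, (IZR_lt 0); lia).
assert (PB' : 0 < / IZR (Z.abs B)) by (apply Rinv_0_lt_compat, (IZR_lt 0); lia).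
apply Rlt_le_trans with (/ IZR (Z.abs A)).
- unfold Rpower; fold lH.
  (* The exponent of the theorem: [E + lM < N * la <= (1 + (m + 1) * tau) * lH]. *)
  apply Rlt_le_trans with (/ exp (E + lM)).
  + rewrite <- exp_Ropp; apply exp_increasing.
    assert (0 <= delta * (INR N * la)) by (apply Rmult_le_pos; [lra | apply Rmult_le_pos; [apply pos_INR | lra]]).
    lra.
  + rewrite abs_IZR; apply Rinv_le_contravar; [apply Rabs_pos_lt, not_0_IZR; exact HA | exact HAE].
- apply Rle_trans with (padicZ p A); [lra|].
  apply Rmult_le_reg_r with (padicZ p B); [lra|].
  unfold Rdiv; rewrite Rmult_assoc, Rinv_l by lra.
  apply Rmult_le_compat_l; lra.
Qed.
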